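(* Let $f:\mathbb{R}^d\to\mathbb{R}$, $f(x)=\mathbb{E}_{\xi\sim\Xi(x)}[F(x;\xi)]$, be $L$-Lipschitz continuous, and suppose $\mathbb{E}_{\xi\sim\Xi(x)}[F(x;\xi)]=f(x)$ and $\mathbb{E}_{\xi\sim\Xi(x)}[|F(x;\xi)-f(x)|^2]\le\sigma^2$ for all $x\in\mathbb{R}^d$. Let $\delta>0$ and define the two-point estimator $$g_{\rm 2pt}(y_t,u_t;\xi_t^+,\xi_t^-)=\frac{d}{2\delta}\big(F(y_t+\delta u_t;\xi_t^+)-F(y_t-\delta u_t;\xi_t^-)\big)u_t,$$ where $u_t\sim\mathrm{Unif}(\mathbb{S}^{d-1})$, $\xi_t^+\sim\Xi(y_t+\delta u_t)$ and $\xi_t^-\sim\Xi(y_t-\delta u_t)$. Then $$\mathbb{E}[g_{\rm 2pt}(y_t,u_t;\xi_t^+,\xi_t^-)\mid\mathcal{F}_{t-1}]=\nabla f_\delta(y_t)$$ and $$\mathbb{E}\big[\|g_{\rm 2pt}(y_t,u_t;\xi_t^+,\xi_t^-)\|^2\mid\mathcal{F}_{t-1}\big]\le\frac{d^2\sigma^2}{2\delta^2}+16\sqrt{2\pi}\,dL^2.$$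
   Context: $\|\cdot\|$ is the Euclidean norm, $\mathbb{S}^{d-1}$ the unit sphere and $\mathbb{B}^d$ the closed unit ball of $\mathbb{R}^d$. For each $x\in\mathbb{R}^d$, $\Xi(x)$ is a probability distribution depending on $x$, and $F(x;\xi)$ with $\xi\sim\Xi(x)$ is the noisy value returned by a stochastic zeroth-order oracle queried at $x$. The smoothed surrogate is $f_\delta(x)=\mathbb{E}_{u\sim\mathrm{Unif}(\mathbb{B}^d)}[f(x+\delta u)]$, which is differentiable. $\mathcal{F}_{t-1}$ is the $\sigma$-algebra containing all randomness revealed before constructing the estimator at iteration $t$: $y_t$ is $\mathcal{F}_{t-1}$-measurable, $u_t$ is uniform on $\mathbb{S}^{d-1}$ independently of $\mathcal{F}_{t-1}$, and conditionally on $(\mathcal{F}_{t-1},u_t)$ the samples $\xi_t^+\sim\Xi(y_t+\delta u_t)$ and $\xi_t^-\sim\Xi(y_t-\delta u_t)$ are independent. *)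

(* Defs.v *)
From HB Require Import structures.
From mathcomp Require Import all_boot all_order all_algebra.
From mathcomp Require Import all_classical all_reals all_analysis.
From mathcomp Require Import measurable_realfun.

Set Implicit Arguments.
Unset Strict Implicit.
Unset Printing Implicit Defensive.

Import Order.TTheory GRing.Theory Num.Theory.
Import numFieldNormedType.Exports.

Local Open Scope classical_set_scope.
Local Open Scope ring_scope.

Definition measure_rV_display : measure_display -> measure_display.
Proof. exact. Qed.

(* Row vectors carry the product sigma-algebra, generated by the coordinates
   as for the library's tuples; over R it is the Borel sigma-algebra. *)
Section measurable_rV.
Context {d} {T : sigmaRingType d}.
Variable n : nat.

Definition rV_coord (i : 'I_n) (x : 'rV[T]_n) : T := x ord0 i.

Let rV_set0 : g_sigma_preimage rV_coord set0.
Proof. exact: sigma_algebra0. Qed.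

Let rV_setC A : g_sigma_preimage rV_coord A -> g_sigma_preimage rV_coord (~` A).
Proof. exact: sigma_algebraC. Qed.

Let rV_bigcup (F : _^nat) : (forall i, g_sigma_preimage rV_coord (F i)) ->
  g_sigma_preimage rV_coord (\bigcup_i (F i)).
Proof. exact: sigma_algebra_bigcup. Qed.

HB.instance Definition _ := @isMeasurable.Build (measure_rV_display d)
  'rV[T]_n (g_sigma_preimage rV_coord) rV_set0 rV_setC rV_bigcup.

End measurable_rV.

Lemma measurable_rV_coord d (T : sigmaRingType d) n (i : 'I_n) :
  measurable_fun [set: 'rV[T]_n] (rV_coord i).
Proof.
move=> _ Y mY; rewrite setTI; apply: sub_sigma_algebra => /=.
rewrite -bigcup_seq/=; exists i => /=; first by rewrite mem_index_enum.
by exists Y => //; rewrite setTI.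
Qed.

Lemma measurable_fun_rV d1 d2 (T1 : measurableType d1) (T2 : measurableType d2)
    n (f : T1 -> 'rV[T2]_n) :
  (forall i, measurable_fun [set: T1] (rV_coord i \o f)) ->
  measurable_fun [set: T1] f.
Proof.
move=> mf; pose M := [set B : set 'rV[T2]_n | measurable (f @^-1` B)].
suff sub : measurable `<=` M by move=> _ A mA; rewrite setTI; exact: sub.
apply: smallest_sub.
  split=> [|B mB|F mF]; rewrite /M /=.
  - by rewrite preimage_set0.
  - by rewrite setTD preimage_setC; exact: measurableC.
  - by rewrite preimage_bigcup; exact: bigcupT_measurable.
rewrite -bigcup_seq => B [i _ [C mC <-]]; rewrite /M /= setTI.
by rewrite -[X in measurable X]setTI; exact: mf.
Qed.

Section lebesgue_rV.
Variable R : realType.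

Definition rV_cons n (p : (measurableTypeR R * 'rV[R]_n)%type) : 'rV[R]_n.+1 :=
  row_mx (p.1%:M : 'M[R]_1) p.2.

Lemma measurable_rV_cons n : measurable_fun [set: _] (@rV_cons n).
Proof.
apply: measurable_fun_rV => i.
have [j ->|j ->] := @split_ordP 1 n i.
  rewrite (_ : _ \o _ = fst); first exact: measurable_fst.
  apply/funext => p; rewrite /= /rV_coord /rV_cons.
  by rewrite (@row_mxEl R 1 1 n) mxE !ord1 eqxx mulr1n.
rewrite (_ : _ \o _ = rV_coord j \o snd); last first.
  by apply/funext => p; rewrite /= /rV_coord /rV_cons (@row_mxEr R 1 1 n).
by apply: measurableT_comp => //; exact: measurable_rV_coord.
Qed.

Section step.
Variables (n : nat) (mu : {sigma_finite_measure set 'rV[R]_n -> \bar R}).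

Definition lebesgue_rV_step : set 'rV[R]_n.+1 -> \bar R :=
  pushforward (@lebesgue_measure R \x mu)%E (@rV_cons n).

Let lebesgue_rV_step0 : lebesgue_rV_step set0 = 0%E.
Proof. by rewrite /lebesgue_rV_step /pushforward preimage_set0 measure0. Qed.

Let lebesgue_rV_step_ge0 A : (0 <= lebesgue_rV_step A)%E.
Proof. by rewrite /lebesgue_rV_step /pushforward measure_ge0. Qed.

Let lebesgue_rV_step_sigma_additive : semi_sigma_additive lebesgue_rV_step.
Proof.
by apply: measure_semi_sigma_additive; exact: measurable_rV_cons.
Qed.

HB.instance Definition _ := isMeasure.Build _ _ _ lebesgue_rV_step
  lebesgue_rV_step0 lebesgue_rV_step_ge0 lebesgue_rV_step_sigma_additive.

Definition rV_uncons (x : 'rV[R]_n.+1) : (measurableTypeR R * 'rV[R]_n)%type :=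
  (x ord0 ord0, \row_i x ord0 (lift ord0 i)).

Lemma rV_consK : cancel (@rV_cons n) rV_uncons.
Proof.
move=> [a x]; rewrite /rV_uncons /rV_cons /=; congr (_, _).
  rewrite (_ : @ord0 n = lshift n (@ord0 0)); last exact/val_inj.
  by rewrite (@row_mxEl R 1 1 n) mxE eqxx mulr1n.
apply/rowP => i; rewrite mxE (_ : lift ord0 i = rshift 1 i); last exact/val_inj.
by rewrite (@row_mxEr R 1 1 n).
Qed.

Lemma measurable_rV_uncons : measurable_fun [set: _] rV_uncons.
Proof.
apply/measurable_fun_pairP; split.
  exact: (measurable_rV_coord (T := R) ord0).
apply: measurable_fun_rV => i.
rewrite (_ : _ \o _ = rV_coord (lift ord0 i)); first exact: measurable_rV_coord.
by apply/funext => x; rewrite /= /rV_coord mxE.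
Qed.

Let lebesgue_rV_step_sigma_finite : sigma_finite setT lebesgue_rV_step.
Proof.
have /sigma_finiteP[F [FT ndF Foo]] := sigma_finiteT (@lebesgue_measure R).
have /sigma_finiteP[G [GT ndG Goo]] := sigma_finiteT mu.
exists (fun k => rV_uncons @^-1` (F k `*` G k)).
  rewrite -preimage_bigcup; apply/esym; rewrite -subTset => x _ /=.
  have [k _ Fk] : (\bigcup_i F i) (rV_uncons x).1 by rewrite -FT.
  have [l _ Gl] : (\bigcup_i G i) (rV_uncons x).2 by rewrite -GT.
  exists (maxn k l) => //; split.
    by move: Fk; exact/subsetPset/ndF/leq_maxl.
  by move: Gl; exact/subsetPset/ndG/leq_maxr.
move=> k; have [mF Fk] := Foo k; have [mG Gk] := Goo k; split.
  rewrite -[X in measurable X]setTI; apply: measurable_rV_uncons => //.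
  exact: measurableX.
rewrite /lebesgue_rV_step /pushforward -comp_preimage.
rewrite (_ : _ \o _ = id); last by apply/funext => p; exact: rV_consK.
by rewrite preimage_id product_measure1E// lte_mul_pinfty// ge0_fin_numE.
Qed.

HB.instance Definition _ := @Measure_isSigmaFinite.Build _ _ _ lebesgue_rV_step
  lebesgue_rV_step_sigma_finite.

End step.

Fixpoint lebesgue_rV n : {sigma_finite_measure set 'rV[R]_n -> \bar R} :=
  match n with
  | 0 => \d_(0 : 'rV[R]_0)
  | n'.+1 => lebesgue_rV_step (lebesgue_rV n')
  end.

End lebesgue_rV.

Section lebesgue_rV_box.
Variable R : realType.

Definition rV_box n (a b : 'I_n -> R) : set 'rV[R]_n :=
  [set x | forall i, a i <= x ord0 i <= b i].

Lemma measurable_rV_box n (a b : 'I_n -> R) : measurable (rV_box a b).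
Proof.
rewrite (_ : rV_box a b = \bigcap_(i in [set: 'I_n])
    (setT `&` rV_coord i @^-1` `[a i, b i])); last first.
  apply/seteqP; split=> x /= abx i => [_|].
    by rewrite setTI /= in_itv /= /rV_coord abx.
  by have := abx i Logic.I; rewrite setTI /= in_itv.
apply: fin_bigcap_measurable => // i _.
by apply: measurable_rV_coord => //; exact: measurable_itv.
Qed.

Lemma lebesgue_rV_box n (a b : 'I_n -> R) : (forall i, a i <= b i) ->
  lebesgue_rV R n (rV_box a b) = (\prod_(i < n) (b i - a i))%:E.
Proof.
elim: n a b => [|n IH] a b ab /=.
  by rewrite big_ord0 diracE mem_set// => -[].
rewrite /lebesgue_rV_step /pushforward.
rewrite (_ : _ @^-1` _ = `[a ord0, b ord0] `*`
  rV_box (fun i => a (lift ord0 i)) (fun i => b (lift ord0 i))); last first.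
  apply/seteqP; split=> -[t x]; have [tE /rowP xE] := rV_consK (t, x) => /=.
    move=> abx; split; first by rewrite /= in_itv /= -{1 2}tE; exact: abx.
    by move=> i /=; have := abx (lift ord0 i); have := xE i; rewrite mxE => ->.
  move=> [/= tab xab] i; case: (unliftP ord0 i) => [j ->|->].
    by have := xab j; have := xE j; rewrite mxE /= => ->.
  by rewrite tE; move: tab; rewrite in_itv /=.
rewrite product_measure1E//; last exact: measurable_rV_box.
rewrite big_ord_recl EFinM; congr (_ * _)%E; last exact: IH.
by rewrite /= lebesgue_measure_itv /= lte_fin; case: ltP => // ba;
  rewrite EFinB //; rewrite (@le_anti _ R (a ord0) (b ord0)) ?ab ?ba ?subee.
Qed.

End lebesgue_rV_box.

Section euclidean.
Variables (R : realType) (n : nat).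

(* The library's norm on 'rV[R]_n is the sup norm. *)
Definition enorm (x : 'rV[R]_n) : R := Num.sqrt (\sum_(i < n) x ord0 i ^+ 2).

Lemma measurable_enorm : measurable_fun [set: 'rV[R]_n] enorm.
Proof.
rewrite (_ : enorm = Num.sqrt \o (fun x => \sum_(i < n) x ord0 i ^+ 2)) //.
apply: measurableT_comp.
  by apply: continuous_measurable_fun; exact: sqrt_continuous.
apply: measurable_sum => i.
by apply: measurable_funX; exact: measurable_rV_coord.
Qed.

Definition eball : set 'rV[R]_n := [set x | enorm x <= 1].

Lemma measurable_eball : measurable eball.
Proof.
rewrite (_ : eball = setT `&` enorm @^-1` `]-oo, 1]).
  by apply: measurable_enorm.
by rewrite setTI; apply/seteqP; split => x; rewrite /eball /= in_itv.
Qed.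

Lemma lebesgue_eball_gt0 : (0 < lebesgue_rV R n eball)%E.
Proof.
pose c : R := n.+1%:R^-1.
have c0 : 0 < c by rewrite invr_gt0.
apply: (@lt_le_trans _ _
    (lebesgue_rV R n (rV_box (fun _ : 'I_n => - c) (fun _ => c)))).
  rewrite lebesgue_rV_box => [|i]; last by rewrite ge0_cp// ltW.
  by rewrite lte_fin; apply: prodr_gt0 => i _; rewrite opprK addr_gt0.
apply: le_measure; rewrite ?inE; [exact: measurable_rV_box|exact: measurable_eball|].
move=> x /= xc; rewrite /eball /enorm /= -[leRHS]sqrtr1 ler_wsqrtr//.
have c1 : c <= 1 by rewrite invf_le1// ler1n.
apply: (@le_trans _ _ (\sum_(i < n) c)).
  apply: ler_sum => i _; have := xc i; rewrite -ler_norml => xic.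
  rewrite -real_normK ?num_real// expr2 (le_trans (ler_pM _ _ xic xic))//.
  by rewrite ler_piMl// ltW.
rewrite sumr_const card_ord -[c *+ n]mulr_natr mulrC ler_pdivrMr//.
by rewrite mul1r ler_nat.
Qed.

Lemma lebesgue_eball_lty : (lebesgue_rV R n eball < +oo)%E.
Proof.
apply: (@le_lt_trans _ _
    (lebesgue_rV R n (rV_box (fun _ : 'I_n => - 1) (fun _ => 1)))).
  apply: le_measure; rewrite ?inE;
    [exact: measurable_eball|exact: measurable_rV_box|].
  move=> x /=; rewrite /eball /enorm /= => x1 i; rewrite -ler_norml.
  apply: le_trans x1; rewrite -sqrtr_sqr ler_wsqrtr//.
  by rewrite (bigD1 i)//= lerDl sumr_ge0// => j _; exact: sqr_ge0.
by rewrite lebesgue_rV_box ?ltry// => i; rewrite lerN10.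
Qed.

(* By the two lemmas above, mnormalize never falls back on the Dirac mass. *)
Definition unif_ball : probability 'rV[R]_n R :=
  mnormalize (mrestr (lebesgue_rV R n) measurable_eball) (\d_(0 : 'rV[R]_n)).

Definition enormalize (x : 'rV[R]_n) : 'rV[R]_n := (enorm x)^-1 *: x.

Lemma measurable_enormalize : measurable_fun [set: 'rV[R]_n] enormalize.
Proof.
apply: measurable_fun_rV => i.
rewrite (_ : _ \o _ = (fun x => (enorm x)^-1 * rV_coord i x)); last first.
  by apply/funext => x; rewrite /= /rV_coord mxE.
apply: measurable_funM; last exact: measurable_rV_coord.
under eq_fun do rewrite -powR_inv1 ?sqrtr_ge0//.
exact: measurableT_comp (measurable_powR _) measurable_enorm.
Qed.

HB.instance Definition _ :=
  isMeasurableFun.Build _ _ _ _ enormalize measurable_enormalize.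

(* The normalized surface measure of a Borel subset A of the sphere is the
   normalized volume of the cone {t a | 0 < t <= 1, a in A}, that is the law of
   x / |x| for x uniform on the ball (the junk value at x = 0 is on a null set
   when 0 < n). *)
Definition unif_sphere : probability 'rV[R]_n R :=
  distribution unif_ball enormalize.

End euclidean.

Section zeroth_order.
Variables (R : realType) (n : nat).

Definition grad (f : 'rV[R]_n -> R) (x : 'rV[R]_n) : 'rV[R]_n :=
  \row_(i < n) 'D_(delta_mx ord0 i) f x.

Definition smoothing (f : 'rV[R]_n -> R) (delta : R) (x : 'rV[R]_n) : R :=
  fine ('E_(unif_ball R n)[fun u => f (x + delta *: u)%R])%E.

Definition g2pt (S : Type) (F : 'rV[R]_n -> S -> R) (delta : R)
    (y u : 'rV[R]_n) (s s' : S) : 'rV[R]_n :=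
  (n%:R / (2 * delta) * (F (y + delta *: u) s - F (y - delta *: u) s')) *: u.

End zeroth_order.

Section conditioning.
Context {R : realType} {d : measure_display} {Omega : measurableType d}.
Variable P : probability Omega R.
Implicit Types (G : set (set Omega)) (X Z : Omega -> R).

Definition sub_sigma_algebra_of G :=
  sigma_algebra [set: Omega] G /\ G `<=` @measurable d Omega.

Definition measurable_wrt d' (T : measurableType d') G (X : Omega -> T) :=
  preimage_set_system [set: Omega] X measurable `<=` G.

Definition sigma_join d' (T : measurableType d') G (X : Omega -> T) :=
  <<s G `|` preimage_set_system [set: Omega] X measurable >>.

Definition independent_of d' (T : measurableType d') G (X : Omega -> T) :=
  forall A B, G A -> measurable B ->
    P (A `&` X @^-1` B) = (P A * P (X @^-1` B))%E.

(* Z is a version of E[X | G]. *)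
Definition is_condexp G X Z :=
  [/\ P.-integrable setT (EFin \o X), P.-integrable setT (EFin \o Z),
      measurable_wrt G Z
    & forall A, G A ->
        (\int[P]_(w in A) (Z w)%:E = \int[P]_(w in A) (X w)%:E)%E].

Definition is_condexp_rV n G (X Z : Omega -> 'rV[R]_n) :=
  forall i, is_condexp G (fun w => X w ord0 i) (fun w => Z w ord0 i).

Definition has_cond_law d' (T : measurableType d') G (X : Omega -> T)
    (kappa : Omega -> set T -> \bar R) :=
  forall B, measurable B ->
    is_condexp G \1_(X @^-1` B) (fun w => fine (kappa w B)).

(* P(X in A, Y in B | G) = P(X in A | G) P(Y in B | G); p and q are versions of
   the conditional probabilities on the right. *)
Definition cond_independent d1 d2 (T1 : measurableType d1)
    (T2 : measurableType d2) G (X : Omega -> T1) (Y : Omega -> T2) :=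
  forall A B (p q : Omega -> R), measurable A -> measurable B ->
    is_condexp G \1_(X @^-1` A) p -> is_condexp G \1_(Y @^-1` B) q ->
    is_condexp G \1_(X @^-1` A `&` Y @^-1` B) (p \* q).

End conditioning.

(* Main.v *)
Require Import Defs.
From HB Require Import structures.
From mathcomp Require Import all_boot all_order all_algebra.
From mathcomp Require Import all_classical all_reals all_analysis.
From mathcomp Require Import measurable_realfun.
From mathcomp Require Import ring lra.

Set Implicit Arguments.
Unset Strict Implicit.
Unset Printing Implicit Defensive.

Import Order.TTheory GRing.Theory Num.Theory.
Import numFieldNormedType.Exports.

Local Open Scope classical_set_scope.
Local Open Scope ring_scope.

(** The estimator is a function of the direction u, uniform on the sphere, and of
    two samples that are independent once the query points are known. Integrating
    the samples out ([ge0_conditional_integral], [conditional_integral]) replaces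
    F by its mean f in the first moment, and in the second moment adds the
    variances of the two samples ([second_moment_difference_le]). What is left
    concerns, for fixed y, the function p v = f (y + delta v), which is Lipschitz
    with constant M = delta L, on the unit sphere of dimension n.

    Mean. By symmetry the mean is n / delta times the sphere average of p v. This
    is the gradient of the smoothing, by the divergence theorem on the ball, which
    [ball_average_expansion] proves directly and for Lipschitz p. In polar
    coordinates, translating the unit ball by h moves the end of the ray of
    direction v from radius 1 to radius 1 + <v, h> up to O(|h| ^ 2), so along
    that ray the average changes by n <v, h> p v. The remainder is quadratic in
    h, which gives differentiability of the smoothing.

    Second moment. The squared norm of the estimator has mean at most
    (n / 2 delta) ^ 2 times E |p v - p (- v)| ^ 2 + 2 sigma ^ 2, so the point is
    that E |p v - p (- v)| ^ 2 is O(M ^ 2 / n), a concentration property of the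
    sphere ([antipodal_energy_le]). For a linear isometry T let the energy of T be
    E |p v - p (T v)| ^ 2. Energies are subadditive along commuting involutions
    ([energy_subadditive]). For each c modulo n, the antipodal map is the product
    of the sign flips of the blocks of coordinates {i, c - i}; adding this up over
    c bounds n times the energy of the antipodal map by the sum of the energies of
    the flips of all pairs of coordinates, each counted once
    ([energy_antipodal_le]). The flip of a pair is a half turn in a coordinate
    plane, and cutting it into 2 ^ k rotations of angle t shows that its energy is
    at most 4 ^ k times that of a small rotation ([energy_half_turn]). The latter
    is t ^ 2 E (a i v j - a j v i) ^ 2 to leading order, where a is the gradient of
    p at v, and by the Lagrange identity these squares sum over all pairs to at
    most |a| ^ 2 |v| ^ 2 <= M ^ 2. The argument needs a differentiable p, and
    smoothing at scale 1 / n provides it at a cost of O(M ^ 2 / n ^ 2). The result is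
    E |p v - p (- v)| ^ 2 <= 80 M ^ 2 / n, so that the second moment is at most
    20 n L ^ 2 + n ^ 2 sigma ^ 2 / (2 delta ^ 2), and 20 <= 16 sqrt (2 pi).

    The uniform law on the ball is handled through two consequences of the
    uniqueness of the translation-invariant measure ([lebesgue_rV_additive]): it
    is invariant under linear isometries, and under it direction and norm are
    independent ([unif_ball_polar]). *)

(** * Measurable maps on row vectors *)

Section measurable_vectors.
Context d (T : measurableType d) (R : realType) (n : nat).
Implicit Types f g : T -> 'rV[R]_n.

Lemma measurable_entry f (i : 'I_n) :
  measurable_fun [set: T] f -> measurable_fun [set: T] (fun x => f x ord0 i).
Proof. by move=> mf; apply: (measurableT_comp (measurable_rV_coord i)). Qed.

Lemma measurable_rVP f :
  (forall i, measurable_fun [set: T] (fun x => f x ord0 i)) ->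
  measurable_fun [set: T] f.
Proof. by move=> mf; apply: measurable_fun_rV => i; exact: mf. Qed.

Lemma measurable_rVD f g : measurable_fun [set: T] f ->
  measurable_fun [set: T] g -> measurable_fun [set: T] (fun x => f x + g x).
Proof.
move=> mf mg; apply: measurable_rVP => i; under eq_fun do rewrite mxE.
by apply: measurable_funD; exact: measurable_entry.
Qed.

Lemma measurable_rVZ (c : T -> R) f : measurable_fun [set: T] c ->
  measurable_fun [set: T] f -> measurable_fun [set: T] (fun x => c x *: f x).
Proof.
move=> mc mf; apply: measurable_rVP => i; under eq_fun do rewrite mxE.
by apply: measurable_funM => //; exact: measurable_entry.
Qed.

Lemma measurable_rVN f : measurable_fun [set: T] f ->
  measurable_fun [set: T] (fun x => - f x).
Proof.
by move=> mf; under eq_fun do rewrite -scaleN1r; exact: measurable_rVZ.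
Qed.

Lemma measurable_rVB f g : measurable_fun [set: T] f ->
  measurable_fun [set: T] g -> measurable_fun [set: T] (fun x => f x - g x).
Proof. by move=> mf mg; apply: measurable_rVD => //; exact: measurable_rVN. Qed.

End measurable_vectors.

(** * Invariance properties of the volume *)

Section measure_lemmas.
Context d (T : measurableType d) (R : realType).
Local Open Scope ereal_scope.

Lemma ge0_integral_invariant (m : {measure set T -> \bar R}) (phi : T -> T)
    (k : T -> \bar R) :
  measurable_fun [set: T] phi ->
  (forall A, measurable A -> m (phi @^-1` A) = m A) ->
  measurable_fun [set: T] k -> (forall x, 0 <= k x) ->
  \int[m]_x k (phi x) = \int[m]_x k x.
Proof.
move=> mphi inv mk k0.
transitivity (\int[pushforward m phi]_x k x).
  by rewrite ge0_integral_pushforward.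
by apply: eq_measure_integral => A mA _; exact: inv.
Qed.

Lemma ge0_integral_mrestr (m : {measure set T -> \bar R}) (B : set T)
    (mB : measurable B) (k : T -> \bar R) :
  measurable_fun [set: T] k -> (forall x, 0 <= k x) ->
  \int[mrestr m mB]_x k x = \int[m]_(x in B) k x.
Proof.
move=> mk k0; rewrite (@ge0_negligible_integral _ _ _ (mrestr m mB) setT (~` B))//.
- rewrite setTD setCK; apply: eq_measure_integral => A mA AB.
  by rewrite /= /mrestr setIidl.
- exact: measurableC.
- by rewrite /= /mrestr setICl measure0.
Qed.

End measure_lemmas.

Section lebesgue_rV_invariance.
Variable R : realType.
Local Open Scope ereal_scope.

Lemma lebesgue_measure_shift (a : R) (A : set R) : measurable A ->
  pushforward lebesgue_measure (fun x : R => (x + a)%R : measurableTypeR R) A =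
  lebesgue_measure A.
Proof.
have ma : measurable_fun [set: R] (fun x : R => (x + a)%R : measurableTypeR R).
  exact: measurable_funD.
move=> mA; apply/esym/lebesgue_measure_unique => //= _ [[b c]] _ <-.
rewrite /pushforward (_ : _ @^-1` _ = `](b - a)%R, (c - a)%R]%classic); last first.
  by apply/seteqP; split => x /=; rewrite !in_itv /= ltrBlDr lerBrDr.
rewrite !lebesgue_measure_itv /= !lte_fin ltrD2r -!EFinB.
by rewrite (_ : c - a - (b - a) = c - b)%R//; ring.
Qed.

Lemma product_measure_invariant d1 d2 (T1 : measurableType d1)
    (T2 : measurableType d2) (m1 : {sigma_finite_measure set T1 -> \bar R})
    (m2 : {sigma_finite_measure set T2 -> \bar R}) (f : T1 -> T1) (g : T2 -> T2)
    (A : set (T1 * T2)) :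
  measurable_fun [set: T1] f -> measurable_fun [set: T2] g ->
  (forall B, measurable B -> m1 (f @^-1` B) = m1 B) ->
  (forall B, measurable B -> m2 (g @^-1` B) = m2 B) ->
  measurable A ->
  (m1 \x m2) ((fun p => (f p.1, g p.2)) @^-1` A) = (m1 \x m2) A.
Proof.
move=> mf mg finv ginv mA.
have mfg : measurable_fun [set: T1 * T2] (fun p => (f p.1, g p.2)).
  by apply/measurable_fun_pairP; split;
    [apply: (measurableT_comp mf)|apply: (measurableT_comp mg)].
apply/esym; rewrite -[RHS]/(pushforward (m1 \x m2) (fun p => (f p.1, g p.2)) A).
apply: (@product_measure_unique _ _ _ _ _ m1 m2) => // B C mB mC.
rewrite -finv// -ginv// -product_measure1E//.
- by rewrite -[X in measurable X]setTI; exact: mf.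
- by rewrite -[X in measurable X]setTI; exact: mg.
Qed.

Lemma rV_consD n (p q : R * 'rV[R]_n) :
  (rV_cons p + rV_cons q = rV_cons (p.1 + q.1, p.2 + q.2))%R.
Proof. by rewrite /rV_cons /= raddfD; exact: (@add_row_mx R 1 1 n). Qed.

Lemma rV_consN n (p : R * 'rV[R]_n) : (- rV_cons p = rV_cons (- p.1, - p.2))%R.
Proof. by rewrite /rV_cons /= raddfN; exact: (@opp_row_mx R 1 1 n). Qed.

Lemma rV_unconsK n : cancel (@rV_uncons R n) (@rV_cons R n).
Proof.
move=> x; apply/rowP => i.
case: (@split_ordP 1 n i) => j ->.
  rewrite /rV_cons /= (@row_mxEl R 1 1 n) mxE !ord1 eqxx mulr1n.
  by congr (x _ _); exact/val_inj.
by rewrite /rV_cons /= (@row_mxEr R 1 1 n) mxE; congr (x _ _); exact/val_inj.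
Qed.

(** The volume is built one coordinate at a time, and so is its invariance. *)
Lemma lebesgue_rV_step_invariant n (mu : {sigma_finite_measure set 'rV[R]_n -> \bar R})
    (f : measurableTypeR R -> measurableTypeR R) (g : 'rV[R]_n -> 'rV[R]_n)
    (h : 'rV[R]_n.+1 -> 'rV[R]_n.+1) A :
  measurable_fun setT f -> measurable_fun [set: 'rV[R]_n] g ->
  (forall B, measurable B ->
    lebesgue_measure (f @^-1` B) = lebesgue_measure B) ->
  (forall B, measurable B -> mu (g @^-1` B) = mu B) ->
  (forall p, h (rV_cons p) = rV_cons (f p.1, g p.2)) ->
  measurable A -> lebesgue_rV_step mu (h @^-1` A) = lebesgue_rV_step mu A.
Proof.
move=> mf mg finv ginv hE mA; rewrite /lebesgue_rV_step /pushforward.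
have mcA : measurable (@rV_cons R n @^-1` A).
  by rewrite -[X in measurable X]setTI; exact: measurable_rV_cons.
rewrite -[RHS](product_measure_invariant (m1 := lebesgue_measure) mf mg finv ginv)//.
by congr ((_ \x _) _); apply/seteqP; split => p /=; rewrite hE.
Qed.

Lemma lebesgue_rV_shift n (a : 'rV[R]_n) A : measurable A ->
  lebesgue_rV R n ((fun x : 'rV[R]_n => x + a)%R @^-1` A) = lebesgue_rV R n A.
Proof.
elim: n a A => [|n IH] a A mA /=.
  congr (\d_ _ _); apply/seteqP; split => x /=;
    by rewrite (_ : x + a = x)%R//; apply/rowP => -[].
apply: (lebesgue_rV_step_invariant (f := (fun x : R => x + (rV_uncons a).1)%R)
  (g := (fun x => x + (rV_uncons a).2)%R)) => //.
- exact: measurable_funD.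
- exact: measurable_rVD.
- by move=> B mB; exact: lebesgue_measure_shift.
- by move=> B mB; exact: IH.
- by move=> p; rewrite -[X in (_ + X)%R](rV_unconsK a) -rV_consD.
Qed.

Lemma lebesgue_rVN n A : measurable A ->
  lebesgue_rV R n ((fun x : 'rV[R]_n => - x)%R @^-1` A) = lebesgue_rV R n A.
Proof.
elim: n A => [|n IH] A mA /=.
  congr (\d_ _ _); apply/seteqP; split => x /=;
    by rewrite (_ : - x = x)%R//; apply/rowP => -[].
apply: (lebesgue_rV_step_invariant (f := -%R) (g := (fun x : 'rV[R]_n => - x)%R)) => //.
- exact: measurable_rVN.
- by move=> B mB; exact: lebesgue_measureN.
- by move=> p; rewrite rV_consN.
Qed.

End lebesgue_rV_invariance.

(** Any bijective additive change of variables multiplies volumes by a constant: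
    this is the uniqueness of the translation-invariant measure, whose proof
    integrates 1_A(T x) 1_B(y + T x) over pairs in both orders, absorbing T x
    into y on one side and y into x on the other. *)
Lemma lebesgue_rV_additive (R : realType) n (T T' : 'rV[R]_n -> 'rV[R]_n)
    (A B : set 'rV[R]_n) :
  measurable_fun setT T -> cancel T' T -> {morph T : x y / x + y} ->
  measurable A -> measurable B ->
  (lebesgue_rV R n (T @^-1` A) * lebesgue_rV R n B =
   lebesgue_rV R n A * lebesgue_rV R n (T @^-1` B))%E.
Proof.
move=> mT T'K TD mA mB.
pose k (C D : set 'rV[R]_n) (x y : 'rV[R]_n) : \bar R := (\1_C x * \1_D y)%:E.
have mk dX (X : measurableType dX) C D (f g : X -> 'rV[R]_n) :
    measurable C -> measurable D ->
    measurable_fun setT f -> measurable_fun setT g ->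
    measurable_fun setT (fun p => k C D (f p) (g p)).
  move=> mC mD mf mg; apply/measurable_EFinP; apply: measurable_funM.
    exact: (@measurableT_comp _ _ _ _ _ _ (\1_C : _ -> R)).
  exact: (@measurableT_comp _ _ _ _ _ _ (\1_D : _ -> R)).
have k0 C D x y : (0 <= k C D x y)%E by rewrite lee_fin mulr_ge0.
have factor C D (g : 'rV[R]_n -> 'rV[R]_n -> 'rV[R]_n) : measurable C ->
    measurable D -> (forall x, measurable_fun setT (g x)) ->
    (forall x E, measurable E ->
      lebesgue_rV R n (g x @^-1` E) = lebesgue_rV R n E) ->
    (\int[lebesgue_rV R n]_x \int[lebesgue_rV R n]_y k C D (T x) (g x y) =
     lebesgue_rV R n (T @^-1` C) * lebesgue_rV R n D)%E.
  move=> mC mD mg ginv.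
  have mI (E : set 'rV[R]_n) : measurable E ->
      measurable_fun setT (fun x : 'rV[R]_n => (\1_E x : R)%:E).
    by move=> mE; apply/measurable_EFinP; exact: measurable_indic.
  transitivity (\int[lebesgue_rV R n]_x
      ((\1_C (T x))%:E * lebesgue_rV R n D))%E.
    apply: eq_integral => x _; rewrite /k.
    under eq_integral do rewrite EFinM.
    rewrite ge0_integralZl_EFin//; last first.
      exact: (measurableT_comp (mI _ mD) (mg x)).
    rewrite (ge0_integral_invariant (k := fun y => (\1_D y)%:E))//; last exact: mI.
      by rewrite integral_indic// setIT.
    exact: ginv.
  rewrite ge0_integralZr//; last first.
    exact: (measurableT_comp (mI _ mC) mT).
  congr (_ * _)%E; rewrite -[LHS]/(\int[_]_x (\1_(T @^-1` C) x)%:E)%E.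
  by rewrite integral_indic// ?setIT// -[X in measurable X]setTI; exact: mT.
transitivity (\int[lebesgue_rV R n]_x \int[lebesgue_rV R n]_y
    k A B (T x) (y + T x)%R)%E.
  rewrite factor// => [x|x E mE]; first exact: measurable_rVD.
  exact: lebesgue_rV_shift.
rewrite (fubini_tonelli (fun p : 'rV[R]_n * 'rV[R]_n => k A B (T p.1) (p.2 + T p.1)))//=; last first.
  have mT1 : measurable_fun setT (fun p : 'rV[R]_n * 'rV[R]_n => T p.1).
    by apply: (measurableT_comp mT); exact: measurable_fst.
  by apply: mk => //; apply: measurable_rVD => //; exact: measurable_snd.
transitivity (\int[lebesgue_rV R n]_y \int[lebesgue_rV R n]_x
    k B A (T x) (T x - y)%R)%E.
  apply: eq_integral => y _.
  rewrite -(ge0_integral_invariant (phi := fun x : 'rV[R]_n => x + T' (- y))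
    (k := fun x : 'rV[R]_n => k A B (T x) (y + T x)))//.
  - apply: eq_integral => x _; rewrite /k TD T'K mulrC.
    by rewrite (_ : y + (T x - y) = T x)// addrC subrK.
  - exact: measurable_rVD.
  - by move=> E mE; exact: lebesgue_rV_shift.
  - apply: mk => //; exact: measurable_rVD.
rewrite -(fubini_tonelli (fun p : 'rV[R]_n * 'rV[R]_n => k B A (T p.1) (T p.1 - p.2)))//=; last first.
  have mT1 : measurable_fun setT (fun p : 'rV[R]_n * 'rV[R]_n => T p.1).
    by apply: (measurableT_comp mT); exact: measurable_fst.
  by apply: mk => //; apply: measurable_rVB => //; exact: measurable_snd.
rewrite factor// => [|x|x E mE]; first by rewrite muleC.
  by apply: measurable_rVB => //; exact: measurable_cst.
rewrite (_ : _ @^-1` E = (fun y => - y) @^-1` ((fun y => y + T x) @^-1` E)).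
  rewrite lebesgue_rVN ?lebesgue_rV_shift// -[X in measurable X]setTI.
  by apply: (measurable_rVD (f := id) (g := cst (T x))).
by apply/seteqP; split => y /=; rewrite addrC.
Qed.

(** * Euclidean geometry of row vectors *)

Section euclidean_geometry.
Variables (R : realType) (n : nat).
Implicit Types (a x y : 'rV[R]_n) (c : R).

Definition dotv a x : R := \sum_(i < n) a ord0 i * x ord0 i.

Lemma enorm_ge0 x : 0 <= enorm x. Proof. exact: sqrtr_ge0. Qed.

Lemma sqr_enorm x : enorm x ^+ 2 = \sum_(i < n) x ord0 i ^+ 2.
Proof. by rewrite sqr_sqrtr// sumr_ge0// => i _; exact: sqr_ge0. Qed.

Lemma dotvv x : dotv x x = enorm x ^+ 2.
Proof. by rewrite sqr_enorm; apply: eq_bigr => i _; rewrite expr2. Qed.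

Lemma enorm_le x c : 0 <= c -> (enorm x <= c) = (enorm x ^+ 2 <= c ^+ 2).
Proof. by move=> c0; rewrite ler_sqr ?nnegrE ?enorm_ge0. Qed.

Lemma dotvC a x : dotv a x = dotv x a.
Proof. by apply: eq_bigr => i _; rewrite mulrC. Qed.

Lemma dotvDr a x y : dotv a (x + y) = dotv a x + dotv a y.
Proof. by rewrite -big_split; apply: eq_bigr => i _; rewrite mxE mulrDr. Qed.

Lemma dotvZr a c x : dotv a (c *: x) = c * dotv a x.
Proof. by rewrite mulr_sumr; apply: eq_bigr => i _; rewrite mxE mulrCA. Qed.

Lemma dotvNr a x : dotv a (- x) = - dotv a x.
Proof. by rewrite -scaleN1r dotvZr mulN1r. Qed.

Lemma dotvDl x y a : dotv (x + y) a = dotv x a + dotv y a.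
Proof. by rewrite !(dotvC _ a) dotvDr. Qed.

Lemma dotvZl c x a : dotv (c *: x) a = c * dotv x a.
Proof. by rewrite !(dotvC _ a) dotvZr. Qed.

Lemma dotvNl x a : dotv (- x) a = - dotv x a.
Proof. by rewrite !(dotvC _ a) dotvNr. Qed.

Lemma sqr_enormD x y :
  enorm (x + y) ^+ 2 = enorm x ^+ 2 + 2 * dotv x y + enorm y ^+ 2.
Proof. by rewrite -!dotvv dotvDr !dotvDl (dotvC y x); ring. Qed.

Lemma enormZ c x : enorm (c *: x) = `|c| * enorm x.
Proof.
apply: (@pexpIrn _ 2) => //; rewrite ?nnegrE ?mulr_ge0 ?enorm_ge0//.
by rewrite exprMn real_normK ?num_real// -!dotvv dotvZr dotvZl; ring.
Qed.

Lemma enorm0 : enorm (0 : 'rV[R]_n) = 0.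
Proof. by rewrite -(scale0r 0) enormZ normr0 mul0r. Qed.

Lemma enormN x : enorm (- x) = enorm x.
Proof. by rewrite -scaleN1r enormZ normrN1 mul1r. Qed.

Lemma enorm_eq0 x : (enorm x == 0) = (x == 0).
Proof.
apply/idP/eqP => [/eqP x0|->]; last by rewrite enorm0.
have := sqr_enorm x; rewrite x0 expr0n /= => /esym/eqP.
rewrite psumr_eq0 => [/allP xi0|i _]; last exact: sqr_ge0.
apply/rowP => i; rewrite mxE; apply/eqP.
by have := xi0 i (mem_index_enum _); rewrite /= sqrf_eq0.
Qed.

Lemma ler_entry_enorm x i : `|x ord0 i| <= enorm x.
Proof.
rewrite -[leLHS]sqrtr_sqr ler_wsqrtr// (bigD1 i)//= ler_wpDr// sumr_ge0// => *.
exact: sqr_ge0.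
Qed.

Lemma lagrange_identity a x :
  \sum_(i < n) \sum_(j < n) (a ord0 i * x ord0 j - a ord0 j * x ord0 i) ^+ 2 =
  2 * (enorm a ^+ 2 * enorm x ^+ 2 - dotv a x ^+ 2).
Proof.
transitivity (\sum_(i < n) (a ord0 i ^+ 2 * enorm x ^+ 2
    - 2 * (a ord0 i * x ord0 i) * dotv a x + enorm a ^+ 2 * x ord0 i ^+ 2)).
  apply: eq_bigr => i _.
  rewrite !sqr_enorm /dotv !mulr_sumr mulr_suml -sumrB -big_split/=.
  by apply: eq_bigr => j _; ring.
rewrite big_split/= sumrB -!mulr_suml -!mulr_sumr -!sqr_enorm.
by rewrite -/(dotv a x); ring.
Qed.

Lemma sqr_dotv_le a x : dotv a x ^+ 2 <= enorm a ^+ 2 * enorm x ^+ 2.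
Proof.
rewrite -subr_ge0 -(pmulr_rge0 _ (ltr0n R 2)) -lagrange_identity.
by apply: sumr_ge0 => i _; apply: sumr_ge0 => j _; exact: sqr_ge0.
Qed.

Lemma normr_dotv_le a x : `|dotv a x| <= enorm a * enorm x.
Proof.
rewrite -ler_sqr ?nnegrE ?mulr_ge0 ?enorm_ge0//.
by rewrite real_normK ?num_real// exprMn sqr_dotv_le.
Qed.

Lemma ler_enormD x y : enorm (x + y) <= enorm x + enorm y.
Proof.
rewrite enorm_le ?addr_ge0 ?enorm_ge0// sqr_enormD.
have := le_trans (ler_norm _) (normr_dotv_le x y); nra.
Qed.

Lemma enorm_le_norm x : enorm x <= n%:R * `|x|.
Proof.
rewrite enorm_le ?mulr_ge0// sqr_enorm exprMn.
apply: (@le_trans _ _ (\sum_(i < n) `|x| ^+ 2)).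
  apply: ler_sum => i _; rewrite -real_normK ?num_real// ler_sqr ?nnegrE//.
  rewrite -[leRHS]/(mx_norm x) mx_normE -[leLHS]nngE num_le.
  exact: (le_bigmax _ (fun ij => `|x ij.1 ij.2|%:nng) (ord0, i)).
rewrite sumr_const card_ord -[_ *+ n]mulr_natl ler_wpM2r ?sqr_ge0//.
by rewrite -natrX ler_nat; case: (n) => // m; rewrite leq_pmulr.
Qed.

Lemma enormalizeK x : enorm x *: enormalize x = x.
Proof.
rewrite /enormalize scalerA; have [x0|x0] := eqVneq x 0.
  by rewrite x0 scaler0.
by rewrite divff ?scale1r// enorm_eq0.
Qed.

Lemma enorm_enormalize x : x != 0 -> enorm (enormalize x) = 1.
Proof.
by move=> x0; rewrite enormZ normfV ger0_norm ?enorm_ge0// mulVf ?enorm_eq0.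
Qed.

Lemma enorm_enormalize_le1 x : enorm (enormalize x) <= 1.
Proof.
have [->|x0] := eqVneq x 0; last by rewrite enorm_enormalize.
by rewrite /enormalize scaler0 enorm0.
Qed.

Lemma enormalizeZ c x : 0 < c -> enormalize (c *: x) = enormalize x.
Proof.
move=> c0; rewrite /enormalize enormZ scalerA gtr0_norm// invfM.
by rewrite mulrAC mulVf ?mul1r// gt_eqF.
Qed.

End euclidean_geometry.

(** * The uniform law on the unit ball *)

Section unif_ball_theory.
Variables (R : realType) (n : nat).
Local Notation V := 'rV[R]_n.
Local Notation leb := (lebesgue_rV R n).
Local Notation U := (unif_ball R n).
Implicit Types (A B : set V) (r : R).

Lemma measurable_preimage d1 d2 (T1 : measurableType d1) (T2 : measurableType d2)
    (f : T1 -> T2) (A : set T2) :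
  measurable_fun setT f -> measurable A -> measurable (f @^-1` A).
Proof. by move=> mf mA; rewrite -[X in measurable X]setTI; exact: mf. Qed.

Definition ball_volume : R := fine (leb (@eball R n)).

Lemma ball_volume_gt0 : 0 < ball_volume.
Proof. by rewrite fine_gt0// lebesgue_eball_gt0 lebesgue_eball_lty. Qed.

Lemma ball_volumeE : leb (@eball R n) = ball_volume%:E.
Proof.
by rewrite fineK// ge0_fin_numE ?lebesgue_eball_lty// ltW// lebesgue_eball_gt0.
Qed.

Lemma unif_ballE A : U A = (leb (A `&` @eball R n) * ball_volume^-1%:E)%E.
Proof.
rewrite /= /mnormalize /= /mrestr setTI ball_volumeE.
by rewrite eqe (gt_eqF ball_volume_gt0).
Qed.

(** An additive isometry maps the ball onto itself, so the constant by which it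
    multiplies volumes is 1. *)
Lemma unif_ball_isometry (T T' : V -> V) A :
  measurable_fun setT T -> cancel T' T -> {morph T : x y / x + y} ->
  (forall x, enorm (T x) = enorm x) -> measurable A ->
  U (T @^-1` A) = U A.
Proof.
move=> mT T'K TD Tn mA; rewrite !unif_ballE; congr (_ * _)%E.
have mB := @measurable_eball R n.
have := lebesgue_rV_additive mT T'K TD (measurableI _ _ mA mB) mB.
have TB : T @^-1` (@eball R n) = @eball R n.
  by apply/seteqP; split => x; rewrite /eball /= Tn.
rewrite preimage_setI TB ball_volumeE.
move=> /(congr1 (fun e => e * ball_volume^-1%:E)%E).
by rewrite -!muleA -EFinM divff ?mule1// gt_eqF// ball_volume_gt0.
Qed.

(** The factor is read off on the unit cube. *)
Lemma lebesgue_rV_scale r A : 0 < r -> measurable A ->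
  leb ((fun x => r *: x) @^-1` A) = ((r ^- n)%:E * leb A)%E.
Proof.
move=> r0 mA.
pose box : set V := rV_box (fun=> 0) (fun=> 1).
have mbox : measurable box by exact: measurable_rV_box.
have mT : measurable_fun setT (fun x : V => r *: x) by exact: measurable_rVZ.
have T'K : cancel (fun x : V => r^-1 *: x) (fun x : V => r *: x).
  by move=> x; rewrite scalerA divff ?scale1r// gt_eqF.
have := lebesgue_rV_additive mT T'K (fun x y => scalerDr r x y) mA mbox.
have -> : (fun x : V => r *: x) @^-1` box = rV_box (fun=> 0) (fun=> r^-1).
  apply/seteqP; split => x /= xb i; have := xb i;
    by rewrite mxE pmulr_rge0// mulrC -ler_pdivlMr// div1r.
have r'0 (i : 'I_n) : 0 <= r^-1 by rewrite invr_ge0 ltW.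
rewrite !lebesgue_rV_box//.
rewrite !prodr_const !card_ord !subr0 expr1n mule1 => ->.
by rewrite exprVn muleC.
Qed.

Lemma rV_box_point : [set 0] = rV_box (fun=> 0) (fun=> 0) :> set V.
Proof.
apply/seteqP; split => x /=; first by move=> -> i; rewrite mxE lexx.
by move=> xb; apply/rowP => i; rewrite mxE; apply/esym/le_anti; exact: xb.
Qed.

Lemma lebesgue_rV1 : (0 < n)%N -> leb [set 0] = 0%E.
Proof.
move=> n0; rewrite rV_box_point lebesgue_rV_box//.
by rewrite prodr_const card_ord subr0 expr0n gtn_eqF.
Qed.

Lemma measurable_cone A r : measurable A ->
  measurable [set x : V | A (enormalize x) /\ enorm x <= r].
Proof.
move=> mA; rewrite (_ : mkset _ = @enormalize R n @^-1` A `&`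
    @enorm R n @^-1` `]-oo, r]%classic); last first.
  by apply/seteqP; split => x /=; rewrite in_itv.
apply: measurableI.
  exact: measurable_preimage (@measurable_enormalize R n) mA.
exact: measurable_preimage (@measurable_enorm R n) (measurable_itv _).
Qed.

(** Shrinking the ball by r maps it onto the points of norm at most r and keeps
    directions, so radius and direction are independent. *)
Lemma unif_ball_cone A r : (0 < n)%N -> 0 <= r <= 1 -> measurable A ->
  U [set x | A (enormalize x) /\ enorm x <= r] =
  ((r ^+ n)%:E * U (@enormalize R n @^-1` A))%E.
Proof.
move=> n0 /andP[r0 r1] mA; rewrite !unif_ballE muleA; congr (_ * _)%E.
move: r0; rewrite le_eqVlt => /predU1P[<-|r0].
  rewrite expr0n gtn_eqF// mul0e; apply/eqP; rewrite -measure_le0.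
  rewrite -(lebesgue_rV1 n0) le_measure ?inE//.
  - by apply: measurableI; [exact: measurable_cone|exact: measurable_eball].
  - by rewrite rV_box_point; exact: measurable_rV_box.
  - move=> x [[_ x0] _]; apply/eqP; rewrite -enorm_eq0.
    by rewrite eq_le x0 enorm_ge0.
set C := @enormalize R n @^-1` A `&` @eball R n.
have mC : measurable C.
  apply: measurableI; last exact: measurable_eball.
  by apply: measurable_preimage => //; exact: measurable_enormalize.
rewrite (_ : _ `&` _ = (fun x : V => r^-1 *: x) @^-1` C).
  by rewrite lebesgue_rV_scale ?invr_gt0// exprVn invrK.
apply/seteqP; split => x.
  rewrite /C /eball /= => -[[Ax xr] _]; rewrite enormalizeZ ?invr_gt0//.
  by split=> //; rewrite enormZ gtr0_norm ?invr_gt0// ler_pdivrMl// mulr1.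
rewrite /C /eball /= enormalizeZ ?invr_gt0// enormZ.
rewrite gtr0_norm ?invr_gt0// ler_pdivrMl// mulr1 => -[Ax xr].
by split => //; exact: le_trans r1.
Qed.

(** The ball of radius 2 contains every translate of the unit ball by a vector
    of norm at most 1; a uniform point 2 w of it that falls in the translate by
    h is uniform there. This puts balls with different centres on the same
    probability space. *)
Lemma unif_ball_affine A (h : V) : enorm h <= 1 -> measurable A ->
  U A = ((2 ^+ n)%:E *
    U ((fun w : V => 2 *: w - h)%R @^-1` A `&`
       [set w : V | enorm (2 *: w - h) <= 1]%R))%E.
Proof.
move=> h1 mA.
have mAB := measurableI _ _ mA (@measurable_eball R n).
have mhAB : measurable ((fun x : V => x - h) @^-1` (A `&` @eball R n)).
  by apply: measurable_preimage => //; exact: measurable_rVB.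
rewrite !unif_ballE muleA; congr (_ * _)%E.
rewrite [in RHS](_ : _ `&` @eball R n =
    (fun w : V => 2 *: w) @^-1` ((fun x : V => x - h) @^-1` (A `&` @eball R n))).
  rewrite lebesgue_rV_scale// lebesgue_rV_shift// muleA -EFinM divff ?mul1e//.
apply/seteqP; split => w /=; first by move=> [[Aw w1] _]; split.
move=> [Aw w1]; split => //; rewrite /eball /=.
have : enorm (2 *: w) <= 1 + 1.
  rewrite -[2 *: w](subrK h); apply: le_trans (ler_enormD _ _) _.
  exact: lerD.
by rewrite enormZ ger0_norm// -[leRHS]/(2%:R) -[leRHS]mulr1 ler_pM2l.
Qed.

End unif_ball_theory.

(** * Polar coordinates *)

Section polar.
Variables (R : realType) (n : nat).
Hypothesis n_gt0 : (0 < n)%N.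
Local Notation V := 'rV[R]_n.
Local Notation U := (unif_ball R n).

Lemma measurable_closed_rays :
  @measurable _ (measurableTypeR R) =
  <<s [set A | exists r : R, A = `]-oo, r]%classic] >>.
Proof.
apply/seteqP; split; last first.
  by apply: smallest_sub => [|_ [r ->]]; [exact: sigma_algebra_measurable|
    exact: measurable_itv].
rewrite -[X in X `<=` _]/((@ocitv R).-sigma.-measurable) RGenOInfty.measurableE.
apply: smallest_sub; first exact: smallest_sigma_algebra.
move=> _ [r ->]; rewrite -setCitvl.
have [_ sC _] := @smallest_sigma_algebra R setT
  [set A | exists r : R, A = `]-oo, r]%classic].
rewrite -setTD; apply: sC.
by apply: sub_gen_smallest; exists r.
Qed.

Lemma eq_measure_rays (m1 m2 : {measure set (measurableTypeR R) -> \bar R}) :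
  (m1 setT < +oo)%E ->
  (forall r, m1 `]-oo, r]%classic = m2 `]-oo, r]%classic) ->
  forall A : set (measurableTypeR R), measurable A -> m1 A = m2 A.
Proof.
move=> m1oo m12; apply: (@measure_unique _ R (measurableTypeR R) _
  (fun k : nat => `]-oo, k%:R]%classic) measurable_closed_rays).
- move=> _ _ [r ->] [s ->]; exists (Num.min r s).
  by apply/seteqP; split => x /=; rewrite !in_itv /= le_min; [move=> [-> ->]|move/andP].
- by move=> k; exists k%:R.
- apply/seteqP; split => // x _; exists (Num.truncn `|x|).+1 => //=.
  by rewrite in_itv /= (le_trans (ler_norm _))// ltW// truncnS_gt.
- by move=> _ [r ->].
- move=> k; apply: le_lt_trans m1oo; apply: le_measure; rewrite ?inE//.
Qed.

Lemma unif_ball_enorm_le A (r : R) : measurable A ->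
  U [set x | A (enormalize x) /\ enorm x <= r] =
  (U (@enormalize R n @^-1` A) * U [set x : V | enorm x <= r]%R)%E.
Proof.
move=> mA; have [r0|r0] := ltP r 0.
  have N0 (x : V) : ~ enorm x <= r by apply/negP; rewrite -ltNge (lt_le_trans r0)// enorm_ge0.
  rewrite (_ : mkset _ = set0) ?measure0; last by apply/seteqP; split=> x // -[_ /N0].
  by rewrite (_ : mkset _ = set0) ?measure0 ?mule0//; apply/seteqP; split=> x // /N0.
have UT : U setT = 1%E by exact: probability_setT.
have setTE s : U [set x : V | enorm x <= s] =
    U [set x : V | setT (enormalize x) /\ enorm x <= s].
  by congr (U _); apply/seteqP; split => x //= -[].
have [r1|r1] := leP r 1.
  rewrite setTE !unif_ball_cone ?r0//.
  by rewrite preimage_setT UT mule1 muleC.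
have large (B : set V) : U (B `&` [set x | enorm x <= r]) = U B.
  rewrite !unif_ballE; congr (lebesgue_rV R n _ * _)%E; apply/seteqP; split => x /=.
    by move=> [[Bx _] x1].
  by move=> [Bx x1]; split => //; split => //; exact: le_trans (ltW r1).
by rewrite -[X in (_ * U X)%E]setTI !large UT mule1.
Qed.

(** Direction and norm of a uniform point of the ball are independent, so the
    norm may be taken from a second point w. *)
Lemma unif_ball_polar (k : V -> \bar R) : measurable_fun setT k ->
  (forall x, (0 <= k x)%E) ->
  (\int[U]_x k x = \int[U]_x \int[U]_w k (enorm w *: enormalize x))%E.
Proof.
move=> mk k0.
have mE := @measurable_enormalize R n.
have mN := @measurable_enorm R n.
have mP : measurable_fun setT
    (fun x : V => (enormalize x, enorm x) : V * measurableTypeR R).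
  exact/measurable_fun_pairP.
pose mNm := isMeasurableFun.Build _ _ _ _ (@enorm R n : V -> measurableTypeR R) mN.
pose N : {mfun V >-> measurableTypeR R} := HB.pack (@enorm R n) mNm.
pose k' (p : V * measurableTypeR R) := k (p.2 *: p.1).
have mk' : measurable_fun setT k'.
  by apply: (measurableT_comp mk); apply: measurable_rVZ;
    [exact: measurable_snd|exact: measurable_fst].
transitivity (\int[unif_sphere R n \x distribution U N]_p k' p)%E.
  transitivity (\int[pushforward U
      (fun x : V => (enormalize x, enorm x) : V * measurableTypeR R)]_p k' p)%E.
    rewrite ge0_integral_pushforward//=; last by move=> y _; exact: k0.
    by apply: eq_integral => x _; rewrite /k' /= enormalizeK.
  apply: eq_measure_integral => X mX _; apply/esym/product_measure_unique => //.
  move=> A I mA mI /=.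
  pose mC := measurable_preimage mE mA.
  pose c : {nonneg R} := NngNum (fine_ge0 (measure_ge0 U (@enormalize R n @^-1` A))).
  have cE : c%:num%:E = U (@enormalize R n @^-1` A).
    by rewrite /= fineK// fin_num_measure.
  transitivity (pushforward (mrestr U mC) N I).
    by rewrite /pushforward /mrestr setIC.
  rewrite (@eq_measure_rays (pushforward (mrestr U mC) N)
    (mscale c (distribution U N)) _ _ I mI).
  - by rewrite /mscale /= -cE.
  - rewrite -[X in (X < _)%E]/(U (setT `&` @enormalize R n @^-1` A)) setTI.
    by rewrite (le_lt_trans (probability_le1 _ _))// ltry.
  - move=> r; rewrite /mscale -[X in _ = (X * _)%E]/(c%:num%:E) cE.
    rewrite -[RHS]/(_ * U (N @^-1` _))%E.
    rewrite (_ : N @^-1` _ = [set x : V | enorm x <= r]); last first.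
      by apply/seteqP; split => x /=; rewrite in_itv.
    rewrite -unif_ball_enorm_le// /pushforward /mrestr; congr (U _).
    by apply/seteqP; split => x /=; rewrite in_itv; [move=> []|move=> []].
have k'0 p : (0 <= k' p)%E by exact: k0.
rewrite fubini_tonelli1// ge0_integral_pushforward//=.
- rewrite preimage_setT; apply: eq_integral => x _; rewrite /fubini_F.
  rewrite ge0_integral_pushforward//=.
  by apply: (measurableT_comp mk'); exact: measurable_pair1.
- exact: measurable_fun_fubini_tonelli_F.
- by move=> x _; exact: integral_ge0.
Qed.

End polar.

(** * Integrals depending on a parameter *)

Lemma measurable_kernel_integral {R : realType} d d1 (T : measurableType d)
    (T1 : measurableType d1) (K : R.-pker T ~> T1) (k : T * T1 -> \bar R) :
  measurable_fun setT k ->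
  measurable_fun setT (fun y => \int[K y]_x k (y, x))%E.
Proof.
move=> mk.
have mp := measurable_fun_integral_sfinite_kernel _ K
  (@funepos_ge0 _ _ k) (measurable_funepos mk).
have mn := measurable_fun_integral_sfinite_kernel _ K
  (@funeneg_ge0 _ _ k) (measurable_funeneg mk).
apply: eq_measurable_fun (emeasurable_funB mp mn) => y _ /=.
rewrite [RHS]integralE; congr (_ - _)%E; apply: eq_integral => s _.
  by rewrite !funeposE.
by rewrite !funenegE.
Qed.

Section constant_law.
Context {R : realType} d d1 (T : measurableType d) (T1 : measurableType d1).
Variable Q : probability T1 R.
Local Open Scope ereal_scope.

Definition constant_law (_ : T) : {measure set T1 -> \bar R} := Q.

Let measurable_constant_law U : measurable U ->
  measurable_fun setT (constant_law ^~ U).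
Proof. by move=> mU; exact: measurable_cst. Qed.

HB.instance Definition _ := isKernel.Build _ _ _ _ R
  constant_law measurable_constant_law.

Let constant_law_setT x : constant_law x setT = 1.
Proof. exact: probability_setT. Qed.

HB.instance Definition _ := Kernel_isProbability.Build _ _ _ _ R
  constant_law constant_law_setT.

End constant_law.


Lemma measurable_Rintegral (R : realType) d1 d2 (T1 : measurableType d1)
    (T2 : measurableType d2) (P : probability T2 R) (k : T1 * T2 -> R) :
  measurable_fun setT k -> measurable_fun setT (fun x => \int[P]_y k (x, y)).
Proof.
move=> mk; have mk' : measurable_fun setT (EFin \o k) by exact/measurable_EFinP.
exact: measurableT_comp (fine_measurable measurableT)
  (measurable_kernel_integral (@constant_law R _ _ T1 _ P) mk').
Qed.

Lemma integral_probability_cst (R : realType) d (T : measurableType d)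
    (P : probability T R) (c : \bar R) : (\int[P]_x c = c)%E.
Proof.
rewrite integral_cst// [X in (c * X)%E](_ : _ = 1%E) ?mule1//.
exact: probability_setT.
Qed.

(** * Expectations of bounded functions *)

Section bounded_expectation.
Context d (T : measurableType d) (R : realType) (P : probability T R).
Implicit Types (k l : T -> R) (c : R).

Definition bounded_measurable k :=
  measurable_fun setT k /\ exists c, forall x, `|k x| <= c.

Lemma bounded_measurable_cst c : bounded_measurable (cst c).
Proof. by split=> //; exists `|c|. Qed.

Lemma bounded_measurableN k :
  bounded_measurable k -> bounded_measurable (fun x => - k x).
Proof.
move=> [mk [c kc]]; split; first exact: measurableT_comp.
by exists c => x; rewrite normrN.
Qed.

Lemma bounded_measurableD k l : bounded_measurable k -> bounded_measurable l ->
  bounded_measurable (fun x => k x + l x).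
Proof.
move=> [mk [c kc]] [ml [c' lc]]; split; first exact: measurable_funD.
by exists (c + c') => x; rewrite (le_trans (ler_normD _ _))// lerD.
Qed.

Lemma bounded_measurableB k l : bounded_measurable k -> bounded_measurable l ->
  bounded_measurable (fun x => k x - l x).
Proof.
by move=> bk bl; apply: bounded_measurableD => //; exact: bounded_measurableN.
Qed.

Lemma bounded_measurableM k l : bounded_measurable k -> bounded_measurable l ->
  bounded_measurable (fun x => k x * l x).
Proof.
move=> [mk [c kc]] [ml [c' lc]]; split; first exact: measurable_funM.
by exists (c * c') => x; rewrite normrM ler_pM.
Qed.

Lemma bounded_measurableZ c k :
  bounded_measurable k -> bounded_measurable (fun x => c * k x).
Proof. exact/bounded_measurableM/bounded_measurable_cst. Qed.

Lemma bounded_measurable_norm k :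
  bounded_measurable k -> bounded_measurable (fun x => `|k x|).
Proof.
move=> [mk [c kc]]; split; first exact: measurableT_comp.
by exists c => x; rewrite normr_id.
Qed.

Lemma bounded_measurable_integrable k :
  bounded_measurable k -> P.-integrable setT (EFin \o k).
Proof.
move=> [mk [c kc]]; apply: measurable_bounded_integrable => //.
  by rewrite (le_lt_trans (probability_le1 _ _))// ltry.
exists c; split=> [|e ce x _ /=]; first exact: num_real.
by rewrite (le_trans (kc x))// ltW.
Qed.

Lemma EFin_expectation k : bounded_measurable k ->
  (\int[P]_x k x)%:E = (\int[P]_x (k x)%:E)%E.
Proof.
by move=> bk; rewrite fineK//; apply: integrable_fin_num => //;
  exact: bounded_measurable_integrable.
Qed.

Lemma expectationD_bounded k l : bounded_measurable k -> bounded_measurable l ->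
  \int[P]_x (k x + l x) = \int[P]_x k x + \int[P]_x l x.
Proof. by move=> bk bl; apply: RintegralD => //; exact: bounded_measurable_integrable. Qed.

Lemma expectationB_bounded k l : bounded_measurable k -> bounded_measurable l ->
  \int[P]_x (k x - l x) = \int[P]_x k x - \int[P]_x l x.
Proof. by move=> bk bl; apply: RintegralB => //; exact: bounded_measurable_integrable. Qed.

Lemma expectationZ_bounded c k : bounded_measurable k ->
  \int[P]_x (c * k x) = c * \int[P]_x k x.
Proof. by move=> bk; apply: RintegralZl => //; exact: bounded_measurable_integrable. Qed.

Lemma expectation_cst_bounded c : \int[P]_x c = c.
Proof. by rewrite Rintegral_cst// [X in fine X]probability_setT/= mulr1. Qed.

Lemma le_expectation_bounded k l : bounded_measurable k -> bounded_measurable l ->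
  (forall x, k x <= l x) -> \int[P]_x k x <= \int[P]_x l x.
Proof.
by move=> bk bl kl; apply: le_Rintegral => //; exact: bounded_measurable_integrable.
Qed.

Lemma normr_expectation_le k l : bounded_measurable k -> bounded_measurable l ->
  (forall x, `|k x| <= l x) -> `|\int[P]_x k x| <= \int[P]_x l x.
Proof.
move=> bk bl kl; apply: le_trans (le_normr_Rintegral _ _) _ => //.
  exact: bounded_measurable_integrable.
by apply: le_expectation_bounded => //; exact: bounded_measurable_norm.
Qed.

Lemma normr_expectation_ae_le k c : bounded_measurable k ->
  {ae P, forall x, `|k x| <= c} -> 0 <= c -> `|\int[P]_x k x| <= c.
Proof.
move=> bk kc c0; rewrite -lee_fin EFin_normr_Rintegral//; last first.
  exact: bounded_measurable_integrable.
have mk : measurable_fun setT (EFin \o k) by apply/measurable_EFinP; case: bk.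
apply: le_trans (le_abse_integral _ _ mk) _ => //.
rewrite -[leRHS]mule1 -(probability_setT P); apply: integral_le_bound => //.
by apply: filterS kc => x kxc _ /=; rewrite lee_fin.
Qed.

Lemma expectation_invariant_bounded (phi : T -> T) k :
  measurable_fun setT phi ->
  (forall A, measurable A -> P (phi @^-1` A) = P A) -> bounded_measurable k ->
  \int[P]_x k (phi x) = \int[P]_x k x.
Proof.
move=> mphi inv bk; have [mk [c kc]] := bk; rewrite /Rintegral; congr fine.
transitivity (\int[pushforward P phi]_x (k x)%:E)%E; last first.
  by apply: eq_measure_integral => A mA _; exact: inv.
rewrite integral_pushforward//; first exact/measurable_EFinP.
apply: bounded_measurable_integrable; split; last by exists c => x; exact: kc.
exact: measurableT_comp.
Qed.

End bounded_expectation.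

Lemma measurable_expectation (R : realType) d1 d2 (T1 : measurableType d1)
    (T2 : measurableType d2) (P : probability T2 R) (k : T1 * T2 -> R) :
  bounded_measurable k ->
  bounded_measurable (fun x => \int[P]_y k (x, y)).
Proof.
move=> [mk [c kc]]; split; first exact: measurable_Rintegral.
exists c => x; rewrite -[leRHS](expectation_cst_bounded P).
apply: normr_expectation_le => //; last exact: bounded_measurable_cst.
split; last by exists c => y; exact: kc.
by apply: (measurableT_comp mk); exact: measurable_pair1.
Qed.

(** * First-order expansion of a ball average *)

Section expansion_estimates.
Variable R : realType.
Implicit Types (z : R) (n : nat).

(** The constants only have to be independent of z: they end up in remainders
    that are sent to zero. *)
Lemma expr1D_estimate n z : `|z| <= 1 ->
  `|(1 + z) ^+ n - 1 - n%:R * z| <= 4 ^+ n * z ^+ 2.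
Proof.
move=> z1; elim: n => [|n IH].
  by rewrite !expr0 mul0r subrr subr0 normr0 mul1r sqr_ge0.
have -> : (1 + z) ^+ n.+1 - 1 - n.+1%:R * z =
    (1 + z) * ((1 + z) ^+ n - 1 - n%:R * z) + n%:R * z ^+ 2.
  by rewrite exprS -natr1; ring.
apply: le_trans (ler_normD _ _) _; rewrite normrM.
have n4 : n%:R <= 4 ^+ n :> R by rewrite -natrX ler_nat ltnW// ltn_expl.
have z2 := sqr_ge0 z.
have : `|1 + z| <= 2.
  by apply: le_trans (ler_normD _ _) _; rewrite normr1 -[leRHS]/(1 + 1) lerD2l.
have nz0 : 0 <= n%:R * z ^+ 2 by apply: mulr_ge0.
rewrite (ger0_norm nz0).
move=> z12; have := ler_pM (normr_ge0 _) (normr_ge0 _) z12 IH.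
have := ler_wpM2r z2 n4; have : 0 <= 4 ^+ n * z ^+ 2 by apply: mulr_ge0 => //; exact: exprn_ge0.
rewrite (exprS 4) -mulrA; lra.
Qed.

Lemma expr1B1_estimate n z : `|z| <= 1 ->
  `|(1 + z) ^+ n - 1| <= (n%:R + 4 ^+ n) * `|z|.
Proof.
move=> z1; have := expr1D_estimate n z1.
move=> e; rewrite -[X in `|X|](subrK (n%:R * z)).
apply: le_trans (ler_normD _ _) _.
rewrite normrM normr_nat mulrDl addrC lerD2l; apply: le_trans e _.
apply: ler_wpM2l; first exact: exprn_ge0.
by rewrite -real_normK ?num_real// expr2 ler_piMl.
Qed.

End expansion_estimates.

Section ball_average_expansion.
Variables (R : realType) (n : nat).
Hypothesis n_gt0 : (0 < n)%N.
Local Notation V := 'rV[R]_n.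
Local Notation U := (unif_ball R n).
Implicit Types (h v w x : V).

Definition cball (r : R) : set V := [set x | enorm x <= r].

Lemma measurable_cball r : measurable (cball r).
Proof.
rewrite (_ : cball r = @enorm R n @^-1` `]-oo, r]%classic); last first.
  by apply/seteqP; split => x /=; rewrite in_itv.
exact: measurable_preimage (@measurable_enorm R n) (measurable_itv _).
Qed.

Lemma ge0_integral_unif_ball_affine h (k : V -> \bar R) : enorm h <= 1 ->
  measurable_fun setT k -> (forall x, (0 <= k x)%E) ->
  (\int[U]_x k x = \int[U]_w
     ((2 ^+ n)%:E * (k (2 *: w - h)%R * (\1_(cball 1) (2 *: w - h)%R)%:E)))%E.
Proof.
move=> h1 mk k0.
pose T w : V := 2 *: w - h.
have mT : measurable_fun setT T by apply: measurable_rVB => //; exact: measurable_rVZ.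
have mTB : measurable (T @^-1` cball 1) by exact: measurable_preimage mT (measurable_cball 1).
have c0 : (0 <= 2 ^- n :> R) by rewrite invr_ge0; exact: exprn_ge0.
have cK : (2 ^+ n * 2 ^- n = 1 :> R) by rewrite divff// expf_eq0 andbC.
transitivity ((2 ^+ n)%:E * \int[U]_(w in T @^-1` cball 1) k (T w))%E.
  transitivity ((2 ^+ n)%:E * \int[mscale (NngNum c0) U]_x k x)%E.
    by rewrite ge0_integral_mscale//= muleA -EFinM cK mul1e.
  congr (_ * _)%E; transitivity (\int[pushforward (mrestr U mTB) T]_x k x)%E.
    apply: eq_measure_integral => A mA _.
    rewrite /= /mscale /= -/(U A) (unif_ball_affine h1 mA).
    by rewrite muleA -EFinM mulrC cK mul1e.
  rewrite ge0_integral_pushforward//= preimage_setT ge0_integral_mrestr//.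
  exact: measurableT_comp.
have mkT : measurable_fun setT (k \o T) by exact: measurableT_comp.
have mI : measurable_fun setT (fun w => (\1_(cball 1) (T w) : R)%:E).
  apply/measurable_EFinP; apply: (@measurableT_comp _ _ _ _ _ _ (\1_(cball 1) : V -> R)) => //.
  by apply: measurable_indic; exact: measurable_cball.
rewrite ge0_integralZl_EFin//; last 2 first.
  by move=> w _; rewrite mule_ge0// lee_fin.
  exact: emeasurable_funM.
congr (_ * _)%E; rewrite [LHS]integral_mkcond. apply: eq_integral => w _.
rewrite patchE indicE.
have -> : (w \in T @^-1` cball 1) = (2 *: w - h \in cball 1).
  by apply/idP/idP; rewrite !inE.
by case: ifPn => wT; rewrite ?mule1 ?mule0.
Qed.

(** The contribution of the ray through x to the average of q over the unit ball
    centred at h, with radii drawn from the ball of radius 2 around the origin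
    whatever h is. *)
Definition ray_average (q : V -> R) h x : R :=
  \int[U]_w (2 ^+ n * (q ((2 * enorm w) *: enormalize x) *
                       \1_(cball 1) ((2 * enorm w) *: enormalize x - h))).

Let bounded_ray (q : V -> R) h (dX : measure_display) (X : measurableType dX)
    (v : X -> V) (w : X -> V) :
  measurable_fun setT v -> measurable_fun setT w -> bounded_measurable q ->
  bounded_measurable (fun z => 2 ^+ n * (q ((2 * enorm (w z)) *: v z) *
                       \1_(cball 1) ((2 * enorm (w z)) *: v z - h)) : R).
Proof.
move=> mv mw [mq [c qc]].
have mr : measurable_fun setT (fun z => (2 * enorm (w z)) *: v z).
  apply: measurable_rVZ => //; apply: measurable_funM => //.
  by apply: (measurableT_comp (@measurable_enorm R n)).
apply: bounded_measurableZ; apply: bounded_measurableM.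
  by split; [exact: (measurableT_comp mq)|exists c => z; exact: qc].
split; last by exists 1 => z; rewrite indicE normr_nat lern1 leq_b1.
apply: (@measurableT_comp _ _ _ _ _ _ (\1_(cball 1) : V -> R)) => //.
  by apply: measurable_indic; exact: measurable_cball.
exact: measurable_rVB.
Qed.

Lemma bounded_ray_average q h : bounded_measurable q ->
  bounded_measurable (ray_average q h).
Proof.
move=> bq; apply: (measurable_expectation U (k := fun p => _ * (q ((2 * enorm p.2) *:
  enormalize p.1) * \1_(cball 1) ((2 * enorm p.2) *: enormalize p.1 - h)))).
apply: bounded_ray => //.
by apply: (measurableT_comp (@measurable_enormalize R n)); exact: measurable_fst.
Qed.

(** The average over a translated ball, written in polar coordinates inside the
    concentric ball of radius 2, which contains the translated ball. *)
Lemma expectation_shift_polar (q : V -> R) h : enorm h <= 1 ->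
  bounded_measurable q -> (forall x, 0 <= q x) ->
  \int[U]_u q (u + h) = \int[U]_x ray_average q h x.
Proof.
move=> h1 bq q0; have [mq [c qc]] := bq.
have mqh : measurable_fun setT (fun u : V => q (u + h)).
  by apply: (measurableT_comp mq); exact: measurable_rVD.
apply: EFin_inj; rewrite !EFin_expectation; [|exact: bounded_ray_average|by split => //; exists c => x; exact: qc].
rewrite (ge0_integral_unif_ball_affine (h := h))//; last 2 first.
  exact/measurable_EFinP.
  by move=> x; rewrite lee_fin.
under eq_integral do rewrite -!EFinM.
rewrite [LHS]unif_ball_polar//; last 2 first.
- have mT : measurable_fun setT (fun w : V => 2 *: w - h).
    by apply: measurable_rVB => //; exact: measurable_rVZ.
  apply/measurable_EFinP; apply: measurable_funM; [exact: measurable_cst|apply: measurable_funM].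
    exact: (measurableT_comp mqh).
  apply: (@measurableT_comp _ _ _ _ _ _ (\1_(cball 1) : V -> R)) => //.
  by apply: measurable_indic; exact: measurable_cball.
- by move=> x; rewrite lee_fin !mulr_ge0 ?exprn_ge0.
apply: eq_integral => x _; rewrite /ray_average EFin_expectation.
  by apply: eq_integral => w _; rewrite scalerA subrK.
exact: bounded_ray.
Qed.

End ball_average_expansion.

Section ball_average_derivative.
Variables (R : realType) (n : nat).
Hypothesis n_gt0 : (0 < n)%N.
Local Notation V := 'rV[R]_n.
Local Notation U := (unif_ball R n).
Implicit Types (h v w x : V) (c M r : R).

(** The distance from the origin, in the unit direction v, to the boundary of
    the unit ball centred at h. *)
Definition exit_radius v h : R :=
  dotv v h + Num.sqrt (1 - enorm h ^+ 2 + dotv v h ^+ 2).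

(** The inequality on the left is quadratic in r; the exit radius is its larger
    root, and the other root is at most 0. *)
Lemma exit_radiusP v h r : enorm v = 1 -> enorm h <= 1 -> 0 <= r ->
  (enorm (r *: v - h) <= 1) = (r <= exit_radius v h).
Proof.
move=> v1 h1 r0; rewrite enorm_le// expr1n sqr_enormD enormN enormZ dotvNr dotvZl.
rewrite v1 mulr1 real_normK ?num_real// /exit_radius.
have e0 := enorm_ge0 h; set e := enorm h in h1 e0 *.
have se := sqr_dotv_le v h; rewrite v1 expr1n mul1r -/e in se.
set s := dotv v h in se *.
have a0 : 0 <= 1 - e ^+ 2 + s ^+ 2 by nra.
have := sqr_sqrtr a0; have := sqrtr_ge0 (1 - e ^+ 2 + s ^+ 2).
set t := Num.sqrt _ => t0 tE.
have st : `|s| <= t.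
  by rewrite -ler_sqr ?nnegrE// real_normK ?num_real// tE; nra.
move: st; rewrite ler_norml => /andP[st1 st2].
have rsE : (r ^+ 2 + 2 * - (r * s) + e ^+ 2 <= 1) = ((r - s) ^+ 2 <= t ^+ 2).
  by rewrite tE; apply/idP/idP => H; nra.
rewrite rsE -(real_normK (num_real (r - s))) ler_sqr ?nnegrE// ler_norml.
by apply/idP/idP => [/andP[_ ?]|?]; [|apply/andP; split]; lra.
Qed.

Lemma exit_radius_estimate v h : enorm v = 1 -> enorm h <= 1 ->
  `|exit_radius v h - 1 - dotv v h| <= enorm h ^+ 2.
Proof.
move=> v1 h1; rewrite /exit_radius.
have e0 := enorm_ge0 h; set e := enorm h in h1 e0 *.
have se := sqr_dotv_le v h; rewrite v1 expr1n mul1r -/e in se.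
set s := dotv v h in se *.
have a0 : 0 <= 1 - e ^+ 2 + s ^+ 2 by nra.
have := sqr_sqrtr a0; have := sqrtr_ge0 (1 - e ^+ 2 + s ^+ 2).
set t := Num.sqrt _ => t0 tE.
have t1 : t <= 1 by rewrite -(@expr_le1 _ 2)//; lra.
have s2 := sqr_ge0 s; have e2 := sqr_ge0 e.
have tt : t ^+ 2 <= t by rewrite expr2 ler_piMl.
rewrite ler_norml; apply/andP; split; lra.
Qed.

Lemma cball_expectation r : 0 <= r <= 1 -> \int[U]_w \1_(cball r) w = r ^+ n.
Proof.
move=> r01; apply: EFin_inj; rewrite EFin_expectation; last first.
  split; first by apply: measurable_indic; exact: measurable_cball.
  by exists 1 => z; rewrite indicE normr_nat lern1 leq_b1.
rewrite integral_indic//; last exact: measurable_cball.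
have := unif_ball_cone n_gt0 r01 (@measurableT _ V).
rewrite preimage_setT [X in (_ * X)%E](@probability_setT _ _ _ U) mule1 => <-.
by rewrite setIT; congr (U _); apply/seteqP; split => x //= -[].
Qed.

Lemma bounded_cball r : bounded_measurable (\1_(cball r) : V -> R).
Proof.
split; first by apply: measurable_indic; exact: measurable_cball.
by exists 1 => z; rewrite indicE normr_nat lern1 leq_b1.
Qed.

Lemma indic_cball_ray v h w : enorm v = 1 -> enorm h <= 1 ->
  \1_(cball 1) ((2 * enorm w) *: v - h) = \1_(cball (exit_radius v h / 2)) w :> R.
Proof.
move=> v1 h1; rewrite !indicE; congr (nat_of_bool _)%:R.
have w0 : 0 <= 2 * enorm w by rewrite mulr_ge0 ?enorm_ge0.
apply/idP/idP; rewrite !inE /cball /= exit_radiusP// ler_pdivlMr// mulrC//.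
Qed.

Lemma exit_radius0 v : enorm v = 1 -> exit_radius v 0 = 1.
Proof.
move=> v1; rewrite /exit_radius -(scale0r 0) dotvZr mul0r scale0r enorm0.
by rewrite expr0n subr0 addr0 sqrtr1 add0r.
Qed.

(** Moving the centre from 0 to h moves the end of the segment cut out on the ray
    of direction v from radius 1 to the exit radius rho. The average changes by
    an integral over radii between 1 and rho, where q is close to q v, and whose
    total mass rho ^ n - 1 is n <v, h> to first order. *)
Lemma ray_average_estimate (q : V -> R) c M h x : x != 0 -> enorm h <= 2^-1 ->
  measurable_fun setT q -> (forall y, `|q y| <= c) -> 0 <= M ->
  (forall y z, `|q y - q z| <= M * enorm (y - z)) ->
  `|ray_average q h x - ray_average q 0 x
    - n%:R * (q (enormalize x) * dotv (enormalize x) h)| <=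
  4 * (n%:R + 4 ^+ n) * (M + c) * enorm h ^+ 2.
Proof.
move=> x0 h12 mq qc M0 lipq.
have h1 : enorm h <= 1 by apply: le_trans h12 _; rewrite invf_le1// ler1n.
have v1 := enorm_enormalize x0; set v := enormalize x in v1 *.
have := exit_radius_estimate v1 h1.
have := normr_dotv_le v h; rewrite v1 mul1r.
have e0 := enorm_ge0 h; set e := enorm h in h1 h12 e0 *.
set s := dotv v h; set rho := exit_radius v h => se rhoE.
have e2 : e ^+ 2 <= e / 2 by rewrite expr2 ler_wpM2l.
have rho1 : `|rho - 1| <= 2 * e.
  rewrite -[rho - 1](subrK s); apply: le_trans (ler_normD _ _) _; lra.
have rho11 : `|rho - 1| <= 1 by apply: le_trans rho1 _; lra.
have rho2 : 0 <= rho / 2 <= 1.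
  by move: rho11; rewrite ler_norml => /andP[? ?]; apply/andP; split; lra.
have half1 : 0 <= (2^-1 : R) <= 1 by apply/andP; split; lra.
set K := n%:R + 4 ^+ n : R.
have n0 : 0 <= n%:R :> R by [].
have n4 : 0 <= 4 ^+ n :> R by exact: exprn_ge0.
have e20 := sqr_ge0 e.
pose D w : R := \1_(cball (rho / 2)) w - \1_(cball 2^-1) w.
have bD : bounded_measurable D.
  by apply: bounded_measurableB; exact: bounded_cball.
have bqr : bounded_measurable (fun w => q ((2 * enorm w) *: v)).
  split; last by exists c => w; exact: qc.
  apply: (measurableT_comp mq); apply: measurable_rVZ => //.
  by apply: measurable_funM => //; exact: measurable_enorm.
have ED : 2 ^+ n * \int[U]_w D w = rho ^+ n - 1.
  rewrite expectationB_bounded; [|exact: bounded_cball..].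
  rewrite !cball_expectation// mulrBr -!exprMn (mulrC 2 (rho / 2)) divfK//.
  by rewrite divff// expr1n.
have rayE : ray_average q h x - ray_average q 0 x =
    2 ^+ n * \int[U]_w (q ((2 * enorm w) *: v) * D w).
  rewrite /ray_average -/v.
  under eq_Rintegral do rewrite indic_cball_ray//.
  under [X in _ - X]eq_Rintegral do rewrite indic_cball_ray ?enorm0// exit_radius0// div1r.
  rewrite !expectationZ_bounded -?mulrBr -?expectationB_bounded;
    do ?by apply: bounded_measurableM => //; exact: bounded_cball.
  by congr (_ * _); apply: eq_Rintegral => w _; rewrite -mulrBr.
have step1 : `|ray_average q h x - ray_average q 0 x - q v * (rho ^+ n - 1)| <=
    M * `|rho - 1| * `|rho ^+ n - 1|.
  (* the sign of D w, which is the same for all w *)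
  pose a : R := if 1 <= rho then 1 else -1.
  have mem t w : (w \in cball t) = (enorm w <= t) by apply/idP/idP; rewrite inE.
  have aD w : `|D w| = a * D w.
    rewrite /a /D !indicE !mem.
    case: (leP (enorm w) (rho / 2)) => w1; case: (leP (enorm w) 2^-1) => w2;
      rewrite ?subrr ?normr0 ?mulr0 // ?subr0 ?sub0r ?normrN normr1.
      by rewrite ifT ?mulr1//; clear -w1 w2; lra.
    by rewrite ifF ?mulrNN ?mulr1//; apply/negbTE; rewrite -ltNge; clear -w1 w2; lra.
  have qD w : `|(q ((2 * enorm w) *: v) - q v) * D w| <= M * `|rho - 1| * (a * D w).
    rewrite normrM aD; have [D0|D0] := eqVneq (D w) 0.
      by rewrite D0 !mulr0.
    rewrite ler_wpM2r//; first by rewrite -aD.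
    apply: le_trans (lipq _ _) _; rewrite ler_wpM2l//.
    rewrite -[X in _ - X]scale1r -scalerBl enormZ v1 mulr1.
    move: D0; rewrite /D !indicE !mem.
    case: (leP (enorm w) (rho / 2)) => w1; case: (leP (enorm w) 2^-1) => w2;
      rewrite ?subrr ?eqxx // => _.
      by apply: le_trans (ler_norm (rho - 1)); rewrite ger0_norm; clear -w1 w2; lra.
    rewrite ler0_norm; last by clear -w1 w2; lra.
    by have := ler_norm (- (rho - 1)); rewrite normrN; clear -w1 w2; lra.
  have bqv : bounded_measurable (fun w => (q ((2 * enorm w) *: v) - q v) * D w).
    apply: bounded_measurableM => //; apply: bounded_measurableB => //.
    exact: bounded_measurable_cst.
  have -> : ray_average q h x - ray_average q 0 x - q v * (rho ^+ n - 1) =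
      2 ^+ n * \int[U]_w ((q ((2 * enorm w) *: v) - q v) * D w).
    rewrite rayE -ED mulrCA -mulrBr -expectationZ_bounded// -expectationB_bounded.
    - by congr (_ * _); apply: eq_Rintegral => w _; rewrite mulrBl.
    - exact: bounded_measurableM.
    - exact: bounded_measurableZ.
  rewrite normrM ger0_norm ?exprn_ge0//.
  have aDn : `|rho ^+ n - 1| = 2 ^+ n * \int[U]_w (a * D w).
    rewrite -ED normrM ger0_norm ?exprn_ge0//; congr (_ * _).
    rewrite -[RHS]ger0_norm; last first.
      by apply: Rintegral_ge0 => w _; rewrite -aD.
    rewrite expectationZ_bounded// normrM /a.
    by case: ifP => _; rewrite ?normrN1 ?normr1 mul1r.
  rewrite aDn mulrCA ler_wpM2l ?exprn_ge0// -expectationZ_bounded; last first.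
    exact: bounded_measurableZ.
  apply: normr_expectation_le => //.
  by apply: bounded_measurableZ; exact: bounded_measurableZ.
have onez : 1 + (rho - 1) = rho by ring.
have step2 : `|rho ^+ n - 1 - n%:R * s| <= 4 * K * e ^+ 2.
  have := expr1D_estimate n rho11; rewrite onez => est.
  have -> : rho ^+ n - 1 - n%:R * s =
    (rho ^+ n - 1 - n%:R * (rho - 1)) + n%:R * (rho - 1 - s) by ring.
  apply: le_trans (ler_normD _ _) _; rewrite normrM normr_nat.
  have r2 : (rho - 1) ^+ 2 <= 4 * e ^+ 2.
    rewrite -real_normK ?num_real//.
    have -> : 4 * e ^+ 2 = (2 * e) ^+ 2 by ring.
    by rewrite ler_sqr ?nnegrE// mulr_ge0.
  have := ler_wpM2l n4 r2; have := ler_wpM2l n0 rhoE.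
  have := mulr_ge0 n0 e20; have := mulr_ge0 n4 e20; move: est; rewrite /K; clear; lra.
have step3 : M * `|rho - 1| * `|rho ^+ n - 1| <= M * (4 * K * e ^+ 2).
  rewrite -mulrA ler_wpM2l//.
  have := expr1B1_estimate n rho11; rewrite onez -/K => est.
  have K0 : 0 <= K by exact: addr_ge0.
  apply: le_trans (ler_wpM2l _ est) _ => //.
  have -> : 4 * K * e ^+ 2 = 2 * e * (K * (2 * e)) by ring.
  by apply: ler_pM => //; [exact: mulr_ge0|exact: ler_wpM2l].
have split3 (A b z N t : R) : A - N * (b * t) = (A - b * z) + b * (z - N * t).
  by clear; ring.
rewrite (split3 _ _ (rho ^+ n - 1)).
apply: le_trans (ler_normD _ _) _; rewrite normrM.
have := ler_pM (normr_ge0 _) (normr_ge0 _) (qc v) step2.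
move: step1 step3; clear; lra.
Qed.

End ball_average_derivative.

Section first_order_expansion.
Variables (R : realType) (n : nat).
Hypothesis n_gt0 : (0 < n)%N.
Local Notation V := 'rV[R]_n.
Local Notation U := (unif_ball R n).
Implicit Types (h v w x : V) (c M : R) (p q : V -> R).

Lemma unif_ball_ae_neq0 : {ae U, forall x : V, x != 0}.
Proof.
exists [set 0]; split.
- by rewrite rV_box_point; exact: measurable_rV_box.
- rewrite unif_ballE; apply/eqP; rewrite mule_eq0; apply/orP; left.
  rewrite -measure_le0 -(lebesgue_rV1 R n_gt0) le_measure ?inE//.
  + apply: measurableI; last exact: measurable_eball.
    by rewrite rV_box_point; exact: measurable_rV_box.
  + by rewrite rV_box_point; exact: measurable_rV_box.
- by move=> x /= /negP; rewrite negbK => /eqP.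
Qed.

Lemma unif_ball_ae_le1 : {ae U, forall x : V, enorm x <= 1}.
Proof.
exists (~` @eball R n); split.
- apply: measurableC; exact: measurable_eball.
- by rewrite unif_ballE setICl measure0 mul0e.
- by move=> x.
Qed.

Lemma eq_expectation_eball p q :
  measurable_fun setT p -> measurable_fun setT q ->
  (forall x, enorm x <= 1 -> p x = q x) -> \int[U]_x p x = \int[U]_x q x.
Proof.
move=> mp mq pq; rewrite /Rintegral; congr fine; apply: ae_eq_integral => //.
- exact/measurable_EFinP.
- exact/measurable_EFinP.
- by apply: filterS unif_ball_ae_le1 => x x1 _ /=; rewrite pq.
Qed.

Lemma measurable_dotv h : measurable_fun setT (fun x => dotv x h).
Proof.
apply: measurable_sum => i; apply: measurable_funM => //.
exact: measurable_rV_coord.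
Qed.

Lemma bounded_on_directions q : measurable_fun setT q ->
  (exists c, forall v, enorm v <= 1 -> `|q v| <= c) ->
  bounded_measurable (fun x => q (enormalize x)).
Proof.
move=> mq [c qc]; split.
  by apply: (measurableT_comp mq); exact: measurable_enormalize.
by exists c => x; apply: qc; exact: enorm_enormalize_le1.
Qed.

Lemma bounded_dotv_direction h :
  bounded_measurable (fun x => dotv (enormalize x) h).
Proof.
apply: (bounded_on_directions (q := fun v => dotv v h)).
  exact: measurable_dotv.
exists (enorm h) => v v1; apply: le_trans (normr_dotv_le _ _) _.
by rewrite ler_piMl ?enorm_ge0.
Qed.

Lemma expectation_dotv_direction h : \int[U]_x dotv (enormalize x) h = 0.
Proof.
have inv := @expectation_invariant_bounded _ _ _ U (fun x => - x)
  (fun x => dotv (enormalize x) h).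
have : \int[U]_x dotv (enormalize (- x)) h = \int[U]_x dotv (enormalize x) h.
  apply: inv; last exact: bounded_dotv_direction.
    exact: measurable_rVN.
  move=> A mA; apply: (unif_ball_isometry (T' := fun x => - x)) => //.
  - exact: measurable_rVN.
  - exact: opprK.
  - by move=> x y; rewrite opprD.
  - exact: enormN.
under eq_Rintegral do rewrite /enormalize enormN scalerN dotvNl -mulN1r.
rewrite expectationZ_bounded; last exact: bounded_dotv_direction.
by rewrite /enormalize; lra.
Qed.

Lemma ball_average_expansion_bounded q c M h : enorm h <= 2^-1 ->
  measurable_fun setT q -> (forall y, 0 <= q y <= c) -> 0 <= M ->
  (forall y z, `|q y - q z| <= M * enorm (y - z)) ->
  `|\int[U]_u q (u + h) - \int[U]_u q u
    - n%:R * \int[U]_x (q (enormalize x) * dotv (enormalize x) h)| <=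
  4 * (n%:R + 4 ^+ n) * (M + c) * enorm h ^+ 2.
Proof.
move=> h12 mq qc M0 lipq.
have h1 : enorm h <= 1 by apply: le_trans h12 _; rewrite invf_le1// ler1n.
have q0 y : 0 <= q y by have /andP[] := qc y.
have qc' y : `|q y| <= c by rewrite ger0_norm//; have /andP[] := qc y.
have c0 : 0 <= c by apply: le_trans (normr_ge0 _) (qc' 0).
have bq : bounded_measurable q by split => //; exists c.
have e1 := expectation_shift_polar n_gt0 h1 bq q0.
have h01 : enorm (0 : V) <= 1 by rewrite enorm0.
have := expectation_shift_polar n_gt0 h01 bq q0.
under eq_Rintegral do rewrite addr0.
move=> e0; rewrite e1 e0.
have bqv : bounded_measurable (fun x => q (enormalize x) * dotv (enormalize x) h).
  apply: bounded_measurableM; last exact: bounded_dotv_direction.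
  by apply: bounded_on_directions => //; exists c.
rewrite -expectationB_bounded; [|exact: bounded_ray_average..].
rewrite -expectationZ_bounded// -expectationB_bounded; last 2 first.
  by apply: bounded_measurableB; exact: bounded_ray_average.
  exact: bounded_measurableZ.
apply: normr_expectation_ae_le.
- apply: bounded_measurableB; last exact: bounded_measurableZ.
  by apply: bounded_measurableB; exact: bounded_ray_average.
- by apply: filterS unif_ball_ae_neq0 => x x0; exact: ray_average_estimate.
- apply: mulr_ge0 (sqr_ge0 _); apply: mulr_ge0 (addr_ge0 M0 c0).
  by apply: mulr_ge0 => //; apply: addr_ge0 => //; exact: exprn_ge0.
Qed.

Definition clamp c (t : R) : R := Num.max (- c) (Num.min c t).

Lemma clamp_bound c t : 0 <= c -> - c <= clamp c t <= c.
Proof.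
move=> c0; rewrite /clamp le_max lexx/= ge_max ge_min lexx/= andbT.
by lra.
Qed.

Lemma clamp_id c t : `|t| <= c -> clamp c t = t.
Proof.
by rewrite ler_norml /clamp => /andP[ct tc]; rewrite (min_idPr _)// (max_idPr _).
Qed.

Lemma clamp_lipschitz c s t : 0 <= c -> `|clamp c s - clamp c t| <= `|s - t|.
Proof.
move=> c0; rewrite /clamp /Num.min /Num.max.
do 4 case: ifPn => //; rewrite -?leNgt => *;
  rewrite ler_norml; apply/andP; split; have := ler_norm (s - t); have := ler_norm (t - s); rewrite (distrC t s); lra.
Qed.

(** The divergence theorem on the ball: the derivative of the average of p is n
    times the average of p v over the sphere. Clamping p - p 0 makes p bounded
    without changing it on the ball of radius 2, which contains all the points
    involved, and the additive constant b is harmless because directions average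
    to zero. *)
Lemma ball_average_expansion p M h : enorm h <= 2^-1 ->
  measurable_fun setT p -> 0 <= M ->
  (forall y z, `|p y - p z| <= M * enorm (y - z)) ->
  `|\int[U]_u p (u + h) - \int[U]_u p u
    - n%:R * \int[U]_x (p (enormalize x) * dotv (enormalize x) h)| <=
  20 * (n%:R + 4 ^+ n) * M * enorm h ^+ 2.
Proof.
move=> h12 mp M0 lipp.
pose q x := clamp (2 * M) (p x - p 0) + 2 * M.
pose b := p 0 - 2 * M.
have M20 : 0 <= 2 * M by rewrite mulr_ge0.
have mq : measurable_fun setT q.
  apply: measurable_funD => //; apply: measurable_maxr => //.
  by apply: measurable_minr => //; exact: measurable_funB.
have qc y : 0 <= q y <= 4 * M.
  by have := clamp_bound (p y - p 0) M20; rewrite /q; lra.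
have lipq y z : `|q y - q z| <= M * enorm (y - z).
  rewrite /q opprD addrACA subrr addr0 (le_trans (clamp_lipschitz _ _ M20))//.
  by rewrite opprB addrA subrK.
have pq x : enorm x <= 2 -> p x = q x + b.
  move=> x2; rewrite /q /b clamp_id; first by ring.
  apply: le_trans (lipp _ _) _; rewrite subr0 mulrC.
  exact: ler_wpM2r.
have bq : bounded_measurable q.
  by split => //; exists (4 * M) => x; rewrite ger0_norm; have := qc x; lra.
have bqh : bounded_measurable (fun u : V => q (u + h)).
  split; last by exists (4 * M) => x; rewrite ger0_norm; have := qc (x + h); lra.
  by apply: (measurableT_comp mq); exact: measurable_rVD.
have bb := bounded_measurable_cst V b.
have -> : \int[U]_u p (u + h) = \int[U]_u q (u + h) + b.
  rewrite -[X in _ + X](expectation_cst_bounded U) -expectationD_bounded//.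
  apply: eq_expectation_eball.
  - by apply: (measurableT_comp mp); exact: measurable_rVD.
  - by apply: measurable_funD => //; case: bqh.
  - move=> x x1; apply: pq; apply: le_trans (ler_enormD _ _) _; lra.
have -> : \int[U]_u p u = \int[U]_u q u + b.
  rewrite -[X in _ + X](expectation_cst_bounded U) -expectationD_bounded//.
  apply: eq_expectation_eball => //.
  - exact: measurable_funD.
  - by move=> x x1; apply: pq; lra.
have bqv : bounded_measurable (fun x => q (enormalize x) * dotv (enormalize x) h).
  apply: bounded_measurableM; last exact: bounded_dotv_direction.
  by apply: bounded_on_directions => //; exists (4 * M) => x _; rewrite ger0_norm; have := qc x; lra.
have bv := bounded_dotv_direction h.
have -> : \int[U]_x (p (enormalize x) * dotv (enormalize x) h) =
    \int[U]_x (q (enormalize x) * dotv (enormalize x) h).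
  transitivity (\int[U]_x (q (enormalize x) * dotv (enormalize x) h
                          + b * dotv (enormalize x) h)).
    apply: eq_Rintegral => x _; rewrite pq ?mulrDl//.
    by have := enorm_enormalize_le1 x; lra.
  rewrite expectationD_bounded//; last exact: bounded_measurableZ.
  by rewrite expectationZ_bounded// expectation_dotv_direction mulr0 addr0.
have := ball_average_expansion_bounded h12 mq qc M0 lipq.
have -> : \int[U]_u q (u + h) + b - (\int[U]_u q u + b) =
  \int[U]_u q (u + h) - \int[U]_u q u by ring.
move=> /le_trans; apply; rewrite le_eqVlt; apply/orP; left; apply/eqP; ring.
Qed.

End first_order_expansion.

(** * Smoothing a Lipschitz function *)

Lemma differentiable_quadratic_remainder (R : realType) (V W : normedModType R)
    (g : V -> W) (df : {linear V -> W}) (x : V) (C r : R) :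
  continuous df -> 0 <= C -> 0 < r ->
  (forall h, `|h| <= r -> `|g (x + h) - g x - df h| <= C * `|h| ^+ 2) ->
  differentiable g x /\ 'd g x = df :> (V -> W).
Proof.
move=> dfc C0 r0 gh.
have dfE : g \o shift x = cst (g x) + df +o_ 0 id.
  apply/eqaddoP => e e0; near=> h.
  rewrite /= !fctE /= opprD addrA (addrC h).
  apply: le_trans (gh _ _) _; first by near: h; apply: nbhs0_le.
  rewrite expr2 mulrA ler_wpM2r//.
  have : `|h| <= e / (C + 1) by near: h; apply: nbhs0_le; rewrite divr_gt0// ltr_wpDl.
  rewrite ler_pdivlMr ?ltr_wpDl// mulrDr mulr1 mulrC => He.
  by apply: le_trans He; rewrite lerDl.
have dE := diff_unique dfc dfE; split => //.
by apply/diff_locallyP; rewrite dE.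
Unshelve. all: by end_near. Qed.

Section smoothing_theory.
Variables (R : realType) (n : nat).
Hypothesis n_gt0 : (0 < n)%N.
Local Notation V := 'rV[R]_n.
Local Notation U := (unif_ball R n).
Variables (f : V -> R) (M : R).
Hypothesis mf : measurable_fun setT f.
Hypothesis M_ge0 : 0 <= M.
Hypothesis lipf : forall x y, `|f x - f y| <= M * enorm (x - y).
Implicit Types (h v w x : V) (eta : R).

Lemma smoothingE eta x : smoothing f eta x = \int[U]_u f (x + eta *: u).
Proof. by rewrite /smoothing unlock. Qed.

Lemma measurable_affine_comp eta x (g : V -> V) : measurable_fun setT g ->
  measurable_fun setT (fun u => f (x + eta *: g u)).
Proof.
move=> mg; apply: (measurableT_comp mf); apply: measurable_rVD => //.
exact: measurable_rVZ.
Qed.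

(** The gradient of the smoothing, as the divergence theorem gives it. *)
Definition sphere_gradient eta x : V :=
  \row_i (n%:R / eta *
    \int[U]_u (f (x + eta *: enormalize u) * enormalize u ord0 i)).

Lemma lipschitz_ball_bound eta x v : enorm v <= 1 ->
  `|f (x + eta *: v) - f x| <= M * `|eta|.
Proof.
move=> v1; apply: le_trans (lipf _ _) _.
by rewrite addrC addKr ler_wpM2l// enormZ ler_piMr.
Qed.

Lemma lipschitz_ball_norm eta x v : enorm v <= 1 ->
  `|f (x + eta *: v)| <= `|f x| + M * `|eta|.
Proof.
move=> v1; rewrite -[f (x + _)](subrK (f x)) addrC (le_trans (ler_normD _ _))//.
by rewrite lerD2l lipschitz_ball_bound.
Qed.

Lemma bounded_on_sphere eta x :
  bounded_measurable (fun u => f (x + eta *: enormalize u)).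
Proof.
apply: (bounded_on_directions (q := fun v => f (x + eta *: v))).
  exact: measurable_affine_comp.
by exists (`|f x| + M * `|eta|) => v; exact: lipschitz_ball_norm.
Qed.

(** Cutting the integrand off outside the ball makes it bounded without changing
    the average. *)
Lemma smoothing_cutoff eta x :
  bounded_measurable (fun u : V => f (x + eta *: u) * \1_(cball 1) u) /\
  smoothing f eta x = \int[U]_u (f (x + eta *: u) * \1_(cball 1) u).
Proof.
have bk : bounded_measurable (fun u : V => f (x + eta *: u) * \1_(cball 1) u).
  split.
    apply: measurable_funM; first exact: measurable_affine_comp.
    by apply: measurable_indic; exact: measurable_cball.
  exists (`|f x| + M * `|eta|) => u; rewrite indicE.
  case: (boolP (u \in cball 1)) => [|_]; last by rewrite mulr0 normr0 addr_ge0// mulr_ge0.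
  by rewrite inE mulr1; exact: lipschitz_ball_norm.
split => //; rewrite smoothingE; apply: eq_expectation_eball.
- exact: measurable_affine_comp.
- by case: bk.
- by move=> u u1; rewrite indicE mem_set// mulr1.
Qed.

Lemma bounded_direction_entry (i : 'I_n) :
  bounded_measurable (fun u : V => enormalize u ord0 i).
Proof.
apply: (bounded_on_directions (q := fun v => v ord0 i)).
  exact: measurable_rV_coord.
by exists 1 => v v1; apply: le_trans (ler_entry_enorm _ _) _.
Qed.

Lemma expectation_sum_bounded (I : Type) (s : seq I) (k : I -> V -> R) :
  (forall i, bounded_measurable (k i)) ->
  bounded_measurable (fun u => \sum_(i <- s) k i u) /\
  \int[U]_u \sum_(i <- s) k i u = \sum_(i <- s) \int[U]_u k i u.
Proof.
move=> bk; elim: s => [|i s [IHb IHe]].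
  have -> : (fun u => \sum_(i <- [::]) k i u) = cst 0.
    by apply/funext => u; rewrite big_nil.
  by rewrite big_nil; split;
    [exact: bounded_measurable_cst|exact: expectation_cst_bounded].
have -> : (fun u => \sum_(j <- i :: s) k j u) =
    (fun u => k i u + \sum_(j <- s) k j u).
  by apply/funext => u; rewrite big_cons.
by rewrite big_cons expectationD_bounded// IHe; split => //;
  exact: bounded_measurableD.
Qed.

Lemma dotv_sphere_gradient eta x h : dotv (sphere_gradient eta x) h =
  n%:R / eta * \int[U]_u (f (x + eta *: enormalize u) * dotv (enormalize u) h).
Proof.
have bk i : bounded_measurable (fun u : V =>
    h ord0 i * (f (x + eta *: enormalize u) * enormalize u ord0 i)).
  apply: bounded_measurableZ; apply: bounded_measurableM.
    exact: bounded_on_sphere.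
  exact: bounded_direction_entry.
rewrite [X in _ * X](_ : _ = \sum_i \int[U]_u
    (h ord0 i * (f (x + eta *: enormalize u) * enormalize u ord0 i))); last first.
  have [_ <-] := expectation_sum_bounded (index_enum 'I_n) bk.
  apply: eq_Rintegral => u _; rewrite /dotv mulr_sumr.
  by apply: eq_bigr => i _; ring.
rewrite mulr_sumr; apply: eq_bigr => i _; rewrite mxE expectationZ_bounded.
  by ring.
apply: bounded_measurableM; first exact: bounded_on_sphere.
exact: bounded_direction_entry.
Qed.

Definition smoothing_remainder : R := 20 * (n%:R + 4 ^+ n) * M.

(** The remainder is quadratic although f is only Lipschitz, because the
    increment h is absorbed by the ball and not by f. *)
Lemma smoothing_expansion eta x h : 0 < eta -> enorm h <= eta / 2 ->
  `|smoothing f eta (x + h) - smoothing f eta x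
    - dotv (sphere_gradient eta x) h| <=
  smoothing_remainder / eta * enorm h ^+ 2.
Proof.
move=> eta0 hle; rewrite !smoothingE dotv_sphere_gradient.
pose p w := f (x + eta *: w).
have h12 : enorm (eta^-1 *: h) <= 2^-1.
  by rewrite enormZ gtr0_norm ?invr_gt0// ler_pdivrMl.
have mp : measurable_fun setT p by exact: measurable_affine_comp.
have lipp y z : `|p y - p z| <= M * eta * enorm (y - z).
  apply: le_trans (lipf _ _) _; rewrite opprD addrACA subrr add0r -scalerBr.
  by rewrite enormZ gtr0_norm// mulrA.
have := ball_average_expansion n_gt0 h12 mp (mulr_ge0 M_ge0 (ltW eta0)) lipp.
under eq_Rintegral do rewrite /p scalerDr scalerA divff ?gt_eqF// scale1r
  addrA addrAC.
under [X in _ - _ * X]eq_Rintegral do rewrite dotvZr mulrCA.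
rewrite expectationZ_bounded; last first.
  by apply: bounded_measurableM; [exact: bounded_on_sphere|exact: bounded_dotv_direction].
under eq_Rintegral do rewrite addrAC.
rewrite mulrA => /le_trans; apply; rewrite enormZ gtr0_norm ?invr_gt0//.
rewrite exprMn /smoothing_remainder le_eqVlt; apply/orP; left; apply/eqP.
by field; rewrite gt_eqF.
Qed.

Lemma smoothing_lipschitz eta x y :
  `|smoothing f eta x - smoothing f eta y| <= M * enorm (x - y).
Proof.
have [bx ->] := smoothing_cutoff eta x; have [bY ->] := smoothing_cutoff eta y.
rewrite -expectationB_bounded// -[leRHS](expectation_cst_bounded U).
apply: normr_expectation_le.
- exact: bounded_measurableB.
- exact: bounded_measurable_cst.
- move=> u; rewrite -mulrBl normrM -[leRHS]mulr1.
  apply: ler_pM => //; last by rewrite indicE normr_nat lern1 leq_b1.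
  by apply: le_trans (lipf _ _) _; rewrite opprD addrACA subrr addr0.
Qed.

Lemma smoothing_close eta x : 0 <= eta -> `|smoothing f eta x - f x| <= M * eta.
Proof.
move=> eta0; rewrite smoothingE.
have [bx sx] := smoothing_cutoff eta x.
have -> : \int[U]_u f (x + eta *: u) - f x =
    \int[U]_u ((f (x + eta *: u) - f x) * \1_(cball 1) u).
  rewrite -smoothingE sx -[X in _ - X](expectation_cst_bounded U).
  rewrite -expectationB_bounded//; last exact: bounded_measurable_cst.
  apply: eq_expectation_eball.
  - by apply: measurable_funB => //; case: bx.
  - apply: measurable_funM; last by apply: measurable_indic; exact: measurable_cball.
    by apply: measurable_funB => //; exact: measurable_affine_comp.
  - by move=> u u1; rewrite indicE mem_set// !mulr1.
have b1 : bounded_measurable (fun u : V => (f (x + eta *: u) - f x) * \1_(cball 1) u).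
  under eq_fun do rewrite mulrBl; apply: bounded_measurableB => //.
  apply: bounded_measurableM; first exact: bounded_measurable_cst.
  exact: bounded_cball.
rewrite -[leRHS](expectation_cst_bounded U); apply: normr_expectation_le => //.
  exact: bounded_measurable_cst.
move=> u; rewrite indicE; case: (boolP (u \in cball 1)) => [|_].
  by rewrite inE mulr1 => u1; have := lipschitz_ball_bound eta x u1; rewrite (ger0_norm eta0).
by rewrite mulr0 normr0 mulr_ge0.
Qed.

(** Otherwise the smoothing would grow along its gradient faster than its
    Lipschitz constant allows. *)
Lemma sphere_gradient_le eta x : 0 < eta -> enorm (sphere_gradient eta x) <= M.
Proof.
move=> eta0; rewrite leNgt; apply/negP => Ma.
set a := sphere_gradient eta x in Ma.
have a0 : 0 < enorm a by exact: le_lt_trans Ma.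
set e := enorm a in Ma a0.
pose C := smoothing_remainder / eta.
have C0 : 0 <= C.
  apply: divr_ge0; last exact: ltW.
  by apply: mulr_ge0 => //; apply: mulr_ge0.
(* a step t a short enough for the linear gain t |a| (|a| - M) to exceed the
   quadratic remainder *)
pose t := Num.min (eta / 2 / e) ((e - M) / (2 * ((C + 1) * e))).
have t0 : 0 < t.
  by rewrite lt_min !divr_gt0// ?subr_gt0// !mulr_gt0// ltr_wpDl.
have ta : enorm (t *: a) = t * e by rewrite enormZ gtr0_norm.
have tle : enorm (t *: a) <= eta / 2.
  by rewrite ta -ler_pdivlMr// ge_min lexx.
have := smoothing_expansion x eta0 tle; rewrite distrC => /(le_trans (ler_norm _)).
have := smoothing_lipschitz eta (x + t *: a) x.
rewrite -/C -/a (addrC x) addrK ta dotvZr dotvv -/e.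
rewrite ler_norml => /andP[_ lip] expn.
have tC : t * (2 * ((C + 1) * e)) <= e - M.
  by rewrite -ler_pdivlMr ?mulr_gt0 ?ltr_wpDl// ge_min lexx orbT.
have : t * e ^+ 2 - M * (t * e) <= C * (t * e) ^+ 2 by lra.
have -> : t * e ^+ 2 - M * (t * e) = (t * e) * (e - M) by ring.
have -> : C * (t * e) ^+ 2 = (t * e) * (t * (C * e)) by ring.
rewrite ler_pM2l ?mulr_gt0//.
have : 0 < t * (C * e + 2 * e).
  by apply: mulr_gt0 => //; apply: ltr_wpDl; [exact: mulr_ge0 (ltW _)|exact: mulr_gt0].
lra.
Qed.

Fact dotv_linear (a : V) : linear (dotv a : V -> R^o).
Proof. by move=> c x y; rewrite dotvDr dotvZr. Qed.

Lemma continuous_dotv (a : V) : continuous (dotv a : V -> R^o).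
Proof.
move=> x; pose F : set_system V := nbhs x.
have FF : Filter F by exact: nbhs_filter.
apply: (@cvg_big _ _ _ _ _ _ _ F); first exact: add_continuous.
move=> i _; apply: cvgM; first exact: cvg_cst.
exact: coord_continuous.
Qed.

Lemma smoothing_differentiable eta x : 0 < eta ->
  differentiable (smoothing f eta) x /\
  grad (smoothing f eta) x = sphere_gradient eta x.
Proof.
move=> eta0.
pose a := sphere_gradient eta x.
pose lin := GRing.isLinear.Build R V R^o *:%R (dotv a) (dotv_linear a).
pose df : {linear V -> R^o} := HB.pack (dotv a : V -> R^o) lin.
have C0 : 0 <= smoothing_remainder / eta.
  apply: divr_ge0; last exact: ltW.
  by apply: mulr_ge0 => //; apply: mulr_ge0.
have n2 : 0 < n%:R :> R by rewrite ltr0n.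
have [|||diffx dE] := @differentiable_quadratic_remainder R V R^o
  (smoothing f eta) df x (smoothing_remainder / eta * n%:R ^+ 2)
  (eta / 2 / n%:R) (@continuous_dotv a).
- by rewrite mulr_ge0// exprn_ge0.
- by rewrite !divr_gt0.
- move=> h hr; have hn := enorm_le_norm h.
  apply: le_trans (smoothing_expansion _ _ _) _ => //.
    by apply: le_trans hn _; rewrite mulrC -ler_pdivlMr.
  rewrite -[leRHS]mulrA; apply: ler_wpM2l => //.
  by rewrite -exprMn ler_sqr ?nnegrE ?enorm_ge0// mulr_ge0.
split => //; apply/rowP => i; rewrite mxE deriveE// dE /=.
rewrite -/a /dotv (bigD1 i)//= big1 => [|j ji]; last first.
  by rewrite [delta_mx _ _ _ _]mxE (negbTE ji) andbF mulr0.
by rewrite [delta_mx _ _ _ _]mxE !eqxx mulr1 addr0.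
Qed.

End smoothing_theory.

(** * Antipodal differences of a Lipschitz function on the sphere *)

Section energy.
Variables (R : realType) (n : nat).
Local Notation V := 'rV[R]_n.
Local Notation U := (unif_ball R n).
Implicit Types (h : V -> R) (S T : V -> V).

Definition linear_isometry T :=
  [/\ measurable_fun setT T, {morph T : x y / x + y},
      forall c x, T (c *: x) = c *: T x, forall x, enorm (T x) = enorm x
    & exists T', cancel T' T].

Lemma linear_isometry_comp S T :
  linear_isometry S -> linear_isometry T -> linear_isometry (S \o T).
Proof.
move=> [mS SD SZ Sn [S' S'K]] [mT TD TZ Tn [T' T'K]]; split.
- exact: measurableT_comp.
- by move=> x y /=; rewrite TD SD.
- by move=> c x /=; rewrite TZ SZ.
- by move=> x /=; rewrite Sn Tn.
- by exists (T' \o S') => x /=; rewrite T'K S'K.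
Qed.

Lemma linear_isometry_direction T x : linear_isometry T ->
  T (enormalize x) = enormalize (T x).
Proof. by move=> [_ _ TZ Tn _]; rewrite /enormalize TZ Tn. Qed.

Lemma ge0_integral_isometry T (k : V -> \bar R) : linear_isometry T ->
  measurable_fun setT k -> (forall x, (0 <= k x)%E) ->
  (\int[U]_x k (T (enormalize x)) = \int[U]_x k (enormalize x))%E.
Proof.
move=> iT mk k0; have [mT TD TZ Tn [T' T'K]] := iT.
under eq_integral do rewrite linear_isometry_direction//.
apply: (ge0_integral_invariant (phi := T) (k := fun x => k (enormalize x))) => //.
- by move=> A mA; exact: unif_ball_isometry T'K TD Tn mA.
- by apply: (measurableT_comp mk); exact: measurable_enormalize.
Qed.

(** A Dirichlet energy on the sphere in which the isometry T replaces an
    infinitesimal displacement. *)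
Definition energy h T : \bar R :=
  (\int[U]_x ((h (enormalize x) - h (T (enormalize x))) ^+ 2)%:E)%E.

Lemma measurable_energy h S T : measurable_fun setT h ->
  measurable_fun setT S -> measurable_fun setT T ->
  measurable_fun setT (fun v => ((h (S v) - h (T v)) ^+ 2)%:E).
Proof.
move=> mh mS mT; apply/measurable_EFinP; apply: measurable_funX.
by apply: measurable_funB; exact: (measurableT_comp mh).
Qed.

Lemma energy_ge0 h T : (0 <= energy h T)%E.
Proof. by apply: integral_ge0 => x _; rewrite lee_fin sqr_ge0. Qed.

Lemma energy_translate h S T : measurable_fun setT h ->
  linear_isometry S -> linear_isometry T ->
  (\int[U]_x ((h (S (enormalize x)) - h (T (S (enormalize x)))) ^+ 2)%:E)%E =
  energy h T.
Proof.
move=> mh iS [mT _ _ _ _].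
apply: (ge0_integral_isometry (k := fun v => ((h v - h (T v)) ^+ 2)%:E)) => //.
  exact: (measurable_energy (S := id)).
by move=> x; rewrite lee_fin sqr_ge0.
Qed.

Let msq h S T : measurable_fun setT h ->
  measurable_fun setT S -> measurable_fun setT T ->
  measurable_fun setT (fun x : V =>
    ((h (S (enormalize x)) - h (T (enormalize x))) ^+ 2)%:E).
Proof.
move=> mh mS mT; apply: (measurable_energy (S := S \o _) (T := T \o _)) => //;
  by apply: measurableT_comp => //; exact: measurable_enormalize.
Qed.

(** For isometries that do not commute, splitting the displacement costs a
    factor 2. *)
Lemma energy_comp_le h S T : measurable_fun setT h ->
  linear_isometry S -> linear_isometry T ->
  (energy h (S \o T) <= 2%:E * (energy h T + energy h S))%E.
Proof.
move=> mh iS iT; have [mS _ _ _ _] := iS; have [mT _ _ _ _] := iT.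
rewrite -[energy h S](energy_translate mh iT iS) /energy.
have m1 := msq mh (@measurable_id _ V setT) mT.
have m2 := msq mh mT (measurableT_comp mS mT).
have p0 (a b : R) : (0 <= ((a - b) ^+ 2)%:E)%E by rewrite lee_fin sqr_ge0.
rewrite -ge0_integralD// -ge0_integralZl_EFin//; last 2 first.
- by move=> x _; rewrite adde_ge0.
- exact: emeasurable_funD.
apply: ge0_le_integral => //.
- exact: (msq mh (@measurable_id _ V setT) (measurableT_comp mS mT)).
- by apply: emeasurable_funM => //; exact: emeasurable_funD.
move=> x _; rewrite -EFinD -EFinM lee_fin /=.
set a := h (enormalize x); set b := h (T (enormalize x)).
set c := h (S (T (enormalize x))).
by have := sqr_ge0 (a - b - (b - c)); nra.
Qed.

(** Subadditivity along commuting involutions: the inequality between the sides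
    and the diagonals of a quadrilateral, applied to the values of h at v, S v,
    S T v and T v; the four sides have mean squares energy h S and energy h T
    twice each, and both diagonals have mean square energy h (S o T). *)
Lemma energy_subadditive h S T : measurable_fun setT h ->
  linear_isometry S -> linear_isometry T ->
  involutive T -> (forall x, S (T x) = T (S x)) ->
  (energy h (S \o T) <= energy h S + energy h T)%E.
Proof.
move=> mh iS iT TK ST; have [mS _ _ _ _] := iS; have [mT _ _ _ _] := iT.
have iST := linear_isometry_comp iS iT.
have mST := measurableT_comp mS mT.
have mid := @measurable_id _ V setT.
have p0 (a b : R) : (0 <= ((a - b) ^+ 2)%:E)%E by rewrite lee_fin sqr_ge0.
have e1 : (\int[U]_x ((h (T (enormalize x)) - h (S (enormalize x))) ^+ 2)%:E)%E =
    energy h (S \o T).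
  rewrite -(energy_translate mh iT iST); apply: eq_integral => x _ /=.
  by rewrite TK.
have e2 := energy_translate mh iT iS.
have e3 : (\int[U]_x ((h (S (enormalize x)) - h (S (T (enormalize x)))) ^+ 2)%:E)%E =
    energy h T.
  by rewrite -(energy_translate mh iS iT); apply: eq_integral => x _; rewrite ST.
suff : (energy h (S \o T) + energy h (S \o T) <=
    (energy h S + energy h S) + (energy h T + energy h T))%E.
  case: (energy h S) (energy_ge0 h S) => [a| |]// _;
  case: (energy h T) (energy_ge0 h T) => [b| |]// _;
  case: (energy h (S \o T)) (energy_ge0 h (S \o T)) => [c| |]// _;
  rewrite ?leey// -?EFinD ?lee_fin//; lra.
have m1 := msq mh mid mST; have m2 := msq mh mT mS; have m3 := msq mh mid mS.
have m4 := msq mh mT mST; have m5 := msq mh mid mT; have m6 := msq mh mS mST.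
have m12 := emeasurable_funD m1 m2; have m34 := emeasurable_funD m3 m4.
have m56 := emeasurable_funD m5 m6; have m3456 := emeasurable_funD m34 m56.
rewrite -{2}e1 -{2}e2 -{2}e3 /energy -!ge0_integralD//; last 2 first.
- by move=> x _; rewrite adde_ge0.
- by move=> x _; rewrite adde_ge0.
apply: ge0_le_integral => // x _; rewrite -!EFinD lee_fin /=.
  by rewrite addr_ge0 ?sqr_ge0.
set a := h (enormalize x); set b := h (T _).
set e := h (S (T _)); set c := h (S _).
by have := sqr_ge0 (a - b - c + e); nra.
Qed.

End energy.

Section sign_flips.
Variables (R : realType) (n : nat).
Local Notation V := 'rV[R]_n.
Implicit Types (h : V -> R) (b : 'I_n -> bool).

Definition flip b (x : V) : V := \row_i ((-1) ^+ b i * x ord0 i).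

Lemma flipD b b' x : flip b (flip b' x) = flip (fun i => b i (+) b' i) x.
Proof. by apply/rowP => i; rewrite !mxE signr_addb mulrA. Qed.

Lemma flip_false x : flip (fun=> false) x = x.
Proof. by apply/rowP => i; rewrite mxE mul1r. Qed.

Lemma flip_true x : flip (fun=> true) x = - x.
Proof. by apply/rowP => i; rewrite !mxE mulN1r. Qed.

Lemma flipK b : involutive (flip b).
Proof.
move=> x; rewrite flipD -[RHS]flip_false; congr (flip _ x).
by apply/funext => i; rewrite addbb.
Qed.

Lemma linear_isometry_flip b : linear_isometry (flip b).
Proof.
split.
- apply: measurable_rVP => i; under eq_fun do rewrite mxE.
  by apply: measurable_funM => //; exact: measurable_rV_coord.
- by move=> x y; apply/rowP => i; rewrite !mxE mulrDr.
- by move=> c x; apply/rowP => i; rewrite !mxE mulrCA.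
- move=> x; rewrite /enorm; congr Num.sqrt; apply: eq_bigr => i _.
  by rewrite mxE exprMn sqrr_sign mul1r.
- by exists (flip b); exact: flipK.
Qed.

(** Sign flips are commuting involutions, so energies are subadditive along
    their products. *)
Lemma energy_flip_sum h (I : Type) (s : seq I) (P : pred I)
    (B : I -> 'I_n -> bool) : measurable_fun setT h ->
  (energy h (flip (fun k => \big[addb/false]_(i <- s | P i) B i k)) <=
   \sum_(i <- s | P i) energy h (flip (B i)))%E.
Proof.
move=> mh; elim: s => [|i s IH].
  rewrite big_nil /energy integral0_eq// => x _.
  rewrite (_ : flip _ _ = enormalize x) ?subrr ?expr0n//.
  by rewrite -[RHS]flip_false; congr (flip _ _); apply/funext => k; rewrite big_nil.
rewrite big_cons; case: ifPn => Pi; last first.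
  rewrite (_ : flip _ = flip (fun k => \big[addb/false]_(i <- s | P i) B i k))//.
  by congr flip; apply/funext => k; rewrite big_cons (negbTE Pi).
rewrite (_ : flip _ = flip (B i) \o
    flip (fun k => \big[addb/false]_(i <- s | P i) B i k)); last first.
  apply/funext => x /=; rewrite flipD; congr (flip _ x).
  by apply/funext => k; rewrite big_cons Pi.
apply: le_trans (energy_subadditive _ _ _ _ _) _ => //.
- exact: linear_isometry_flip.
- exact: linear_isometry_flip.
- exact: flipK.
- move=> x; rewrite !flipD; congr (flip _ x).
  by apply/funext => k; rewrite addbC.
- exact: leeD2l.
Qed.

Definition pair_pred (i j : 'I_n) : 'I_n -> bool := fun k => (k == i) || (k == j).

End sign_flips.

Section antipodal_decomposition.
Variables (R : realType) (n : nat).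
Local Notation V := 'rV[R]_n.+1.
Implicit Types (h : V -> R) (c i j k : 'I_n.+1).

(** The block of k under the reflection i -> c - i is {k, c - k}; it is indexed
    by its smaller element. *)
Lemma xor_reflection_pairs c k :
  \big[addb/false]_(i : 'I_n.+1 | (i <= (c - i)%R)%N) pair_pred i (c - i) k = true.
Proof.
have ck : c - (c - k) = k by rewrite opprB addrC subrK.
pose i0 := if (k <= (c - k)%R)%N then k else c - k.
have Pi0 : (i0 <= (c - i0)%R)%N.
  by rewrite /i0; case: ifPn => //; rewrite -ltnNge ck => /ltnW.
rewrite (bigD1 i0)// big1 => [|i /andP[Pi ii0]].
  rewrite [LHS]addbF /pair_pred /i0; case: ifPn => _; rewrite ?eqxx// ck eqxx orbT//.
apply/negbTE; rewrite /pair_pred negb_or; apply/andP; split.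
  by apply: contraNneq ii0 => kE; rewrite /i0 kE Pi.
apply: contraNneq ii0 => kE; have ki : c - k = i by rewrite kE opprB addrC subrK.
rewrite /i0; case: ifPn => [kle|_]; last by rewrite ki.
rewrite -ki; apply/eqP/val_inj/eqP; rewrite eqn_leq.
by rewrite kle andbT; move: Pi; rewrite -kE -{1}ki.
Qed.

(** For each c modulo n, the reflection i -> c - i partitions the coordinates
    into blocks of one or two; flipping the blocks in turn is the antipodal map.
    When c runs through all residues, each block occurs for exactly one c. *)
Lemma energy_antipodal_le h : measurable_fun setT h ->
  (n.+1%:R%:E * energy h -%R <=
   \sum_(i : 'I_n.+1) \sum_(j : 'I_n.+1 | (i <= j)%N)
     energy h (flip (pair_pred i j)))%E.
Proof.
move=> mh.
have le c : (energy h -%R <= \sum_(i : 'I_n.+1 | (i <= (c - i)%R)%N)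
    energy h (flip (pair_pred i (c - i)%R)))%E.
  apply: le_trans (energy_flip_sum _ _ _ mh).
  rewrite (_ : flip _ = -%R)//; apply/funext => x; rewrite -flip_true.
  by congr (flip _ x); apply/funext => k; rewrite xor_reflection_pairs.
apply: (@le_trans _ _ (\sum_(c : 'I_n.+1) \sum_(i : 'I_n.+1 | (i <= (c - i)%R)%N)
    energy h (flip (pair_pred i (c - i)%R)))%E).
  have -> : (n.+1%:R%:E * energy h -%R = \sum_(c : 'I_n.+1) energy h -%R)%E.
    by rewrite mule_natl sumr_const card_ord.
  by apply: lee_sum => c _; exact: le.
rewrite (exchange_big_dep xpredT)//; apply: lee_sum => i _.
rewrite (reindex_inj (addIr i)).
rewrite le_eqVlt; apply/orP; left; apply/eqP.
by apply: eq_big => [j|j _]; rewrite addrK.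
Qed.

End antipodal_decomposition.

Section trigonometric_estimates.
Variable R : realType.
Implicit Types t : R.

Lemma normr_sin_le t : 0 <= t -> `|sin t| <= t.
Proof.
move=> t0; have [c _] := @MVT_segment R sin cos 0 t t0 (fun x _ => is_derive_sin x)
  (continuous_subspaceT (@continuous_sin R)).
rewrite sin0 !subr0 => ->.
by rewrite normrM (ger0_norm t0) ler_piMl// cos_max.
Qed.

Lemma cos_estimate t : 0 <= t -> 0 <= 2 * (1 - cos t) <= t ^+ 2.
Proof.
move=> t0; have t20 : 0 <= t / 2 by rewrite divr_ge0.
have E : 2 * (1 - cos t) = (2 * sin (t / 2)) ^+ 2.
  rewrite [in LHS](splitr t) cosD exprMn; have := cos2Dsin2 (t / 2); nra.
rewrite E sqr_ge0/=.
have := normr_sin_le t20; rewrite -ler_sqr ?nnegrE// real_normK ?num_real// => s2.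
by rewrite exprMn; lra.
Qed.

End trigonometric_estimates.

Section coordinate_rotations.
Variables (R : realType) (n : nat) (i j : 'I_n).
Hypothesis ij : i != j.
Local Notation V := 'rV[R]_n.
Implicit Types (h : V -> R) (x a : V) (s t : R).

Definition rotation t x : V := \row_k
  (if k == i then cos t * x ord0 i - sin t * x ord0 j
   else if k == j then sin t * x ord0 i + cos t * x ord0 j
   else x ord0 k).

Let ji : j == i = false. Proof. by rewrite eq_sym (negbTE ij). Qed.

Lemma rotation_i t x : rotation t x ord0 i = cos t * x ord0 i - sin t * x ord0 j.
Proof. by rewrite mxE eqxx. Qed.

Lemma rotation_j t x : rotation t x ord0 j = sin t * x ord0 i + cos t * x ord0 j.
Proof. by rewrite mxE ji eqxx. Qed.

Lemma rotation_other t x k : k != i -> k != j -> rotation t x ord0 k = x ord0 k.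
Proof. by move=> ki kj; rewrite mxE (negbTE ki) (negbTE kj). Qed.

Lemma sum_split_plane (g : 'I_n -> R) :
  \sum_k g k = g i + (g j + \sum_(k | (k != i) && (k != j)) g k).
Proof. by rewrite (bigD1 i)//= (bigD1 j)//= eq_sym. Qed.

Lemma rotationD s t x : rotation s (rotation t x) = rotation (s + t) x.
Proof.
apply/rowP => k; have [->|ki] := eqVneq k i.
  by rewrite !rotation_i rotation_j sinD cosD; ring.
have [->|kj] := eqVneq k j; last by rewrite !rotation_other.
by rewrite !rotation_j rotation_i sinD cosD; ring.
Qed.

Lemma rotation0 x : rotation 0 x = x.
Proof.
apply/rowP => k; have [->|ki] := eqVneq k i.
  by rewrite rotation_i sin0 cos0; ring.
have [->|kj] := eqVneq k j; last by rewrite rotation_other.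
by rewrite rotation_j sin0 cos0; ring.
Qed.

Lemma rotation_pi x : rotation pi x = flip (pair_pred i j) x.
Proof.
apply/rowP => k; rewrite [RHS]mxE /pair_pred.
have [->|ki] := eqVneq k i; first by rewrite rotation_i sinpi cospi /=; ring.
have [->|kj] := eqVneq k j; last by rewrite rotation_other//= expr0 mul1r.
by rewrite rotation_j sinpi cospi /=; ring.
Qed.

Lemma linear_isometry_rotation t : linear_isometry (rotation t).
Proof.
split.
- apply: measurable_rVP => k.
  have mk l : measurable_fun setT (fun x : V => x ord0 l).
    exact: measurable_rV_coord.
  have [->|ki] := eqVneq k i.
    under eq_fun do rewrite rotation_i.
    by apply: measurable_funB; exact: measurable_funM.
  have [->|kj] := eqVneq k j.
    under eq_fun do rewrite rotation_j.
    by apply: measurable_funD; exact: measurable_funM.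
  rewrite (_ : (fun x => _) = (fun x : V => x ord0 k)) //.
  by apply/funext => x; exact: rotation_other.
- by move=> x y; apply/rowP => k; rewrite !mxE; do ?case: ifP => _; ring.
- by move=> c x; apply/rowP => k; rewrite !mxE; do ?case: ifP => _; ring.
- move=> x; rewrite /enorm; congr Num.sqrt; rewrite !sum_split_plane.
  rewrite rotation_i rotation_j addrA [RHS]addrA; congr (_ + _).
    by rewrite -[RHS]mul1r -(cos2Dsin2 t); ring.
  by apply: eq_bigr => k /andP[ki kj]; rewrite rotation_other.
- exists (rotation (- t)) => x.
  by rewrite rotationD subrr rotation0.
Qed.

Lemma dotv_rotation a t x : dotv a (rotation t x - x) =
  (cos t - 1) * (a ord0 i * x ord0 i + a ord0 j * x ord0 j)
  + sin t * (a ord0 j * x ord0 i - a ord0 i * x ord0 j).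
Proof.
rewrite dotvDr dotvNr /dotv !sum_split_plane rotation_i rotation_j.
rewrite (eq_bigr (fun k => a ord0 k * x ord0 k)); last first.
  by move=> k /andP[ki kj]; rewrite rotation_other.
ring.
Qed.

Lemma enorm_rotation_sub t x : 0 <= t -> enorm x <= 1 ->
  enorm (rotation t x - x) <= t.
Proof.
move=> t0 x1; rewrite enorm_le// sqr_enorm sum_split_plane.
have mxB k : (rotation t x - x) ord0 k = rotation t x ord0 k - x ord0 k.
  by rewrite !mxE.
rewrite big1 => [|k /andP[ki kj]]; last first.
  by rewrite mxB rotation_other// subrr expr0n.
rewrite !mxB rotation_i rotation_j addr0.
have xle : x ord0 i ^+ 2 + x ord0 j ^+ 2 <= 1.
  apply: (@le_trans _ _ (enorm x ^+ 2)); last by rewrite expr_le1// enorm_ge0.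
  rewrite sqr_enorm sum_split_plane addrA lerDl sumr_ge0// => k _.
  exact: sqr_ge0.
have /andP[c0 ct] := cos_estimate t0.
have -> : (cos t * x ord0 i - sin t * x ord0 j - x ord0 i) ^+ 2 +
    (sin t * x ord0 i + cos t * x ord0 j - x ord0 j) ^+ 2 =
    2 * (1 - cos t) * (x ord0 i ^+ 2 + x ord0 j ^+ 2).
  set c := cos t; set s := sin t; set p := x ord0 i; set q := x ord0 j.
  transitivity ((c ^+ 2 + s ^+ 2) * (p ^+ 2 + q ^+ 2)
    + (1 - 2 * c) * (p ^+ 2 + q ^+ 2)); first by ring.
  by rewrite cos2Dsin2; ring.
by apply: le_trans ct; rewrite ler_piMr.
Qed.

Lemma energy_rotation_double h t : measurable_fun setT h ->
  (energy h (rotation (2 * t)) <= 4%:E * energy h (rotation t))%E.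
Proof.
move=> mh; rewrite (_ : rotation (2 * t) = rotation t \o rotation t); last first.
  by apply/funext => x /=; rewrite rotationD; congr rotation; ring.
have it := linear_isometry_rotation t.
apply: le_trans (energy_comp_le mh it it) _.
case: (energy h (rotation t)) (energy_ge0 h (rotation t)) => [e| |]// _.
  by rewrite -EFinD -!EFinM lee_fin; lra.
by rewrite ?gt0_muley ?lte_fin// leey.
Qed.

(** The half turn is cut into 2 ^ m small rotations. Each doubling of the angle
    multiplies the energy by at most 4, which is also what it does to first
    order at small angles, so the bound stays sharp as m grows. *)
Lemma energy_half_turn h m : measurable_fun setT h ->
  (energy h (rotation pi) <=
   (4 ^+ m)%:E * energy h (rotation (pi / 2 ^+ m)))%E.
Proof.
move=> mh; elim: m => [|m IH]; first by rewrite !expr0 divr1 mul1e.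
apply: le_trans IH _; rewrite exprSr EFinM -muleA; apply: lee_wpmul2l.
  by rewrite lee_fin exprn_ge0.
have -> : pi / 2 ^+ m = 2 * (pi / 2 ^+ m.+1) :> R.
  by rewrite exprS; field; rewrite expf_neq0.
exact: energy_rotation_double.
Qed.

End coordinate_rotations.

Section smooth_antipodal_bound.
Variables (R : realType) (m : nat).
Local Notation n := m.+1.
Local Notation V := 'rV[R]_n.
Local Notation U := (unif_ball R n).
Variables (h : V -> R) (a : V -> V) (M C r : R).
Hypothesis mh : measurable_fun setT h.
Hypothesis M_ge0 : 0 <= M.
Hypothesis lip_h : forall x y, `|h x - h y| <= M * enorm (x - y).
Hypothesis C_ge0 : 0 <= C.
Hypothesis r_gt0 : 0 < r.
Hypothesis aM : forall x, enorm (a x) <= M.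
Hypothesis expansion : forall x k, enorm k <= r ->
  `|h (x + k) - h x - dotv (a x) k| <= C * enorm k ^+ 2.

(** To first order in t, the rotation moves v by t along the tangent vector with
    entries - v j and v i, so h changes by t times the (i, j) entry of the wedge
    product of v with the gradient a v. *)
Lemma rotation_increment (i j : 'I_n) (t : R) (v : V) : i != j ->
  0 <= t <= r -> enorm v <= 1 ->
  (h v - h (rotation i j t v)) ^+ 2 <=
  2 * t ^+ 2 * (a v ord0 i * v ord0 j - a v ord0 j * v ord0 i) ^+ 2
  + 2 * (M + C) ^+ 2 * t ^+ 4.
Proof.
move=> ij /andP[t0 tr] v1.
set w := a v ord0 i * v ord0 j - _; have t20 := sqr_ge0 t.
have kt := enorm_rotation_sub ij t0 v1.
have := expansion v (le_trans kt tr); rewrite (addrC v) subrK dotv_rotation//.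
have -> : a v ord0 j * v ord0 i - a v ord0 i * v ord0 j = - w by rewrite /w opprB.
set p := _ + a v ord0 j * v ord0 j => e1.
have pM : `|p| <= 2 * M.
  have entry l : `|a v ord0 l * v ord0 l| <= M.
    rewrite normrM -[leRHS]mulr1 ler_pM//.
      exact: le_trans (ler_entry_enorm _ _) (aM v).
    exact: le_trans (ler_entry_enorm _ _) v1.
  apply: le_trans (ler_normD _ _) _; rewrite mulr_natl mulr2n.
  exact: lerD.
have e2 : `|h v - h (rotation i j t v)| <= t * `|w| + (M + C) * t ^+ 2.
  have -> : h v - h (rotation i j t v) = - ((h (rotation i j t v) - h v
      - ((cos t - 1) * p + sin t * - w)) + ((cos t - 1) * p + sin t * - w)).
    by ring.
  rewrite normrN; apply: le_trans (ler_normD _ _) _.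
  have e3 : C * enorm (rotation i j t v - v) ^+ 2 <= C * t ^+ 2.
    by rewrite ler_wpM2l// ler_sqr ?nnegrE ?enorm_ge0.
  have e4 : `|(cos t - 1) * p + sin t * - w| <= M * t ^+ 2 + t * `|w|.
    apply: le_trans (ler_normD _ _) _; rewrite !normrM normrN; apply: lerD.
      have /andP[c0 ct] := cos_estimate t0.
      have c1 : 0 <= 1 - cos t by lra.
      rewrite distrC (ger0_norm c1).
      apply: (@le_trans _ _ (t ^+ 2 / 2 * (2 * M))); last by rewrite le_eqVlt; apply/orP; left; apply/eqP; field.
      by apply: ler_pM => //; lra.
    by rewrite ler_wpM2r// normr_sin_le.
  move: e1 e3 e4; lra.
rewrite -[leLHS]real_normK ?num_real//.
have b0 : 0 <= t * `|w| + (M + C) * t ^+ 2.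
  by apply: addr_ge0; apply: mulr_ge0 => //; exact: addr_ge0.
apply: (@le_trans _ _ ((t * `|w| + (M + C) * t ^+ 2) ^+ 2)).
  by rewrite ler_sqr ?nnegrE.
rewrite -(real_normK (num_real w)).
have := sqr_ge0 (t * `|w| - (M + C) * t ^+ 2); lra.
Qed.

Definition coordinate_pairs : seq ('I_n * 'I_n) :=
  [seq p : 'I_n * 'I_n <- index_enum _ | (p.1 < p.2)%N].

Lemma coordinate_pairs_neq p : p \in coordinate_pairs -> p.1 != p.2.
Proof.
by rewrite mem_filter => /andP[lt _]; apply: contraTneq lt => ->; rewrite ltnn.
Qed.

(** The wedge product of x and y has norm at most |x| |y|. *)
Lemma sum_coordinate_pairs_le (x y : V) :
  \sum_(p <- coordinate_pairs) (x ord0 p.1 * y ord0 p.2 - x ord0 p.2 * y ord0 p.1) ^+ 2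
  <= enorm x ^+ 2 * enorm y ^+ 2.
Proof.
pose F (i j : 'I_n) := (x ord0 i * y ord0 j - x ord0 j * y ord0 i) ^+ 2.
rewrite big_filter (eq_bigr (fun p => F p.1 p.2))// -(pair_big_dep xpredT (fun i j : 'I_n => (i < j)%N) F)/=.
have F0 i j : 0 <= F i j by exact: sqr_ge0.
have sym : \sum_(i < n) \sum_(j < n | (j < i)%N) F i j =
    \sum_(i < n) \sum_(j < n | (i < j)%N) F i j.
  rewrite (exchange_big_dep xpredT)//=; apply: eq_bigr => i _.
  by apply: eq_bigr => j _; rewrite /F; ring.
rewrite -(ler_pM2l (ltr0n R 2)).
apply: (@le_trans _ _ (\sum_i \sum_j F i j)); last first.
  rewrite lagrange_identity ler_pM2l//.
  by rewrite lerBlDr lerDl sqr_ge0.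
rewrite mulr_natl mulr2n -{2}sym -big_split/=; apply: ler_sum => i _.
rewrite [leRHS](bigID (fun j : 'I_n => (i < j)%N))/= lerD2l.
rewrite [leRHS]big_mkcond [leLHS]big_mkcond/=; apply: ler_sum => j _.
by case: (ltngtP i j) => //=.
Qed.

Definition pair_energies : \bar R :=
  (\sum_(p <- coordinate_pairs) energy h (flip (pair_pred p.1 p.2)))%E.

(** The first-order terms are summed over all pairs before they are integrated:
    pointwise they add up to at most t ^ 2 |a v| ^ 2, whatever the dimension. *)
Lemma pair_energies_le k : pi / 2 ^+ k <= r ->
  (pair_energies <= (2 * pi ^+ 2 * M ^+ 2
     + (size coordinate_pairs)%:R * 2 * (M + C) ^+ 2 * pi ^+ 4 / 4 ^+ k)%:E)%E.
Proof.
set t := pi / 2 ^+ k => tr.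
have t0 : 0 <= t by rewrite divr_ge0 ?pi_ge0// exprn_ge0.
have k4 : 0 < 4 ^+ k :> R by exact: exprn_gt0.
have t4 : 4 ^+ k * t ^+ 2 = pi ^+ 2.
  rewrite /t exprMn exprVn -exprM mulnC exprM (_ : 2 ^+ 2 = 4 :> R); last by ring.
  by rewrite mulrCA divff ?mulr1// gt_eqF.
apply: (@le_trans _ _ ((4 ^+ k)%:E *
    \sum_(p <- coordinate_pairs) energy h (rotation p.1 p.2 t))%E).
  rewrite ge0_sume_distrr; last by move=> p _; exact: energy_ge0.
  rewrite /pair_energies !big_seq; apply: lee_sum => p /coordinate_pairs_neq pp.
  rewrite -(funext (rotation_pi pp)); exact: energy_half_turn.
(* setting g p to 0 when p.1 = p.2 makes it measurable for every p *)
pose g (p : 'I_n * 'I_n) (x : V) : \bar R := if p.1 == p.2 then 0%E else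
  ((h (enormalize x) - h (rotation p.1 p.2 t (enormalize x))) ^+ 2)%:E.
have mg p : measurable_fun setT (g p).
  rewrite /g; case: (boolP (p.1 == p.2)) => // pp.
  have mdir := @measurable_enormalize R n.
  have [mrot _ _ _ _] := linear_isometry_rotation pp t.
  exact: (measurable_energy mh mdir (measurableT_comp mrot mdir)).
have g0 p x : (0 <= g p x)%E by rewrite /g; case: ifP => // _; rewrite lee_fin sqr_ge0.
pose B := 2 * t ^+ 2 * M ^+ 2 + (size coordinate_pairs)%:R * (2 * (M + C) ^+ 2 * t ^+ 4).
have sumB x : (\sum_(p <- coordinate_pairs) g p x <= B%:E)%E.
  set v := enormalize x.
  have v1 : enorm v <= 1 by exact: enorm_enormalize_le1.
  apply: (@le_trans _ _ (\sum_(p <- coordinate_pairs) (2 * t ^+ 2 *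
      (a v ord0 p.1 * v ord0 p.2 - a v ord0 p.2 * v ord0 p.1) ^+ 2
      + 2 * (M + C) ^+ 2 * t ^+ 4)%:E)%E).
    rewrite !big_seq; apply: lee_sum => p /coordinate_pairs_neq pp.
    rewrite /g (negbTE pp) lee_fin; apply: rotation_increment => //.
    by rewrite t0.
  rewrite sumEFin lee_fin big_split/= -mulr_sumr lerD//.
    apply: ler_wpM2l; first by rewrite mulr_ge0 ?sqr_ge0.
    apply: le_trans (sum_coordinate_pairs_le _ _) _.
    rewrite -[leRHS]mulr1; apply: ler_pM; rewrite ?sqr_ge0 ?expr_le1 ?enorm_ge0//.
    by rewrite ler_sqr ?nnegrE ?enorm_ge0.
  by rewrite [leRHS]mulr_natl big_const_seq count_predT iter_addr_0.
apply: (@le_trans _ _ ((4 ^+ k)%:E * B%:E)%E).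
  apply: lee_wpmul2l; first by rewrite lee_fin ltW.
  rewrite [leLHS](_ : _ = \sum_(p <- coordinate_pairs) \int[U]_x g p x)%E; last first.
    rewrite !big_seq; apply: eq_bigr => p /coordinate_pairs_neq pp.
    by apply: eq_integral => x _; rewrite /g (negbTE pp).
  rewrite -ge0_integral_sum//.
  rewrite -[leRHS]mule1 -(probability_setT U) -integral_cst//.
  apply: ge0_le_integral => //.
  - by move=> x _; apply: sume_ge0 => p _.
  - exact: emeasurable_sum.
rewrite -EFinM lee_fin le_eqVlt; apply/orP; left; apply/eqP.
rewrite /B mulrDr; congr (_ + _).
  by rewrite -t4; ring.
rewrite -[RHS]mulrA; have -> : pi ^+ 4 / 4 ^+ k = 4 ^+ k * t ^+ 4.
  rewrite (_ : pi ^+ 4 = (pi ^+ 2) ^+ 2); last by ring.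
  by rewrite -t4; field; rewrite gt_eqF.
ring.
Qed.

(** The rotation angle pi / 2 ^ k tends to zero. *)
Lemma pair_energies_bound : (pair_energies <= (2 * pi ^+ 2 * M ^+ 2)%:E)%E.
Proof.
apply/lee_addgt0Pr => e e0.
set K := (size coordinate_pairs)%:R * 2 * (M + C) ^+ 2 * pi ^+ 4.
have K0 : 0 <= K.
  apply: mulr_ge0; last by rewrite exprn_ge0// pi_ge0.
  by apply: mulr_ge0; [exact: mulr_ge0|exact: sqr_ge0].
pose k := (Num.truncn (Num.max (K / e) (pi / r))).+1.
have kle x : x <= Num.max (K / e) (pi / r) -> x <= 2 ^+ k.
  move=> /le_trans; apply; apply: (@le_trans _ _ k%:R).
    by rewrite ltW// truncnS_gt.
  by rewrite -natrX ler_nat ltnW// ltn_expl.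
have k2 : 0 < 2 ^+ k :> R by exact: exprn_gt0.
have kr : pi / 2 ^+ k <= r.
  by rewrite ler_pdivrMr// mulrC -ler_pdivrMr// kle// le_max lexx orbT.
apply: le_trans (pair_energies_le kr) _; rewrite -/K -EFinD lee_fin lerD2l.
rewrite ler_pdivrMr ?exprn_gt0// mulrC -ler_pdivrMr//.
apply: (@le_trans _ _ (2 ^+ k)); first by rewrite kle// le_max lexx.
by rewrite lerXn2r ?nnegrE// ler_nat.
Qed.

(** Flipping coordinate i moves v by 2 |v i|, and the squares of these distances
    add up to 4 |v| ^ 2. *)
Lemma diagonal_energies_bound :
  (\sum_(i : 'I_n) energy h (flip (pair_pred i i)) <= (4 * M ^+ 2)%:E)%E.
Proof.
pose g (i : 'I_n) (x : V) : \bar R :=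
  ((h (enormalize x) - h (flip (pair_pred i i) (enormalize x))) ^+ 2)%:E.
have mg i : measurable_fun setT (g i).
  have mdir := @measurable_enormalize R n.
  have [mf _ _ _ _] := linear_isometry_flip R (pair_pred i i).
  exact: (measurable_energy mh mdir (measurableT_comp mf mdir)).
have g0 i x : (0 <= g i x)%E by rewrite lee_fin sqr_ge0.
rewrite -ge0_integral_sum//; last by move=> i x _; exact: g0 i x.
rewrite -[leRHS]mule1 -(probability_setT U) -integral_cst//.
apply: ge0_le_integral => //.
- by move=> x _; apply: sume_ge0 => i _; exact: g0 i x.
- by apply: emeasurable_sum => i; exact: mg i.
move=> x _; set v := enormalize x.
rewrite sumEFin lee_fin.
apply: (@le_trans _ _ (\sum_i 4 * M ^+ 2 * v ord0 i ^+ 2)); last first.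
  rewrite -mulr_sumr -sqr_enorm; apply: ler_piMr.
    by apply: mulr_ge0 => //; exact: sqr_ge0.
  exact: exprn_ile1 (enorm_ge0 _) (enorm_enormalize_le1 _).
apply: ler_sum => i _.
have -> : 4 * M ^+ 2 * v ord0 i ^+ 2 = (M * (2 * `|v ord0 i|)) ^+ 2.
  by rewrite -(real_normK (num_real (v ord0 i))); ring.
rewrite -[leLHS]real_normK ?num_real// ler_sqr ?nnegrE//; last first.
  by do 2?apply: mulr_ge0.
apply: le_trans (lip_h _ _) _; apply: ler_wpM2l => //.
rewrite enorm_le; last exact: mulr_ge0.
rewrite sqr_enorm (bigD1 i)//= big1 => [|l li]; last first.
  by rewrite !mxE /pair_pred (negbTE li) /= expr0 mul1r subrr expr0n.
rewrite !mxE /pair_pred eqxx /= addr0 exprMn real_normK ?num_real//.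
rewrite le_eqVlt; apply/orP; left; apply/eqP; ring.
Qed.

(** The n different ways of writing the antipodal map as a product of flips use
    each pair of coordinates once in total, whence the factor n on the left
    against a bound free of the dimension. *)
Lemma smooth_antipodal_energy :
  (n%:R%:E * energy h -%R <= (36 * M ^+ 2)%:E)%E.
Proof.
apply: le_trans (energy_antipodal_le mh) _.
pose F i j := energy h (flip (pair_pred i j)).
rewrite (_ : \sum_i _ = \sum_i F i i + pair_energies)%E; last first.
  rewrite /pair_energies /coordinate_pairs big_filter.
  rewrite -(pair_big_dep xpredT (fun i j : 'I_n => (i < j)%N) F)/= -big_split/=.
  apply: eq_bigr => i _; rewrite (bigD1 i)//=; congr (_ + _)%E.
  by apply: eq_bigl => j; rewrite ltn_neqAle andbC eq_sym.
apply: le_trans (leeD diagonal_energies_bound pair_energies_bound) _.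
rewrite -EFinD lee_fin.
(* 36 = 2 * 16 + 4 *)
have p4 : pi ^+ 2 <= 16 :> R.
  have := pi_ge0 R; have := pihalf_lt2 R; nra.
have := ler_wpM2r (sqr_ge0 M) p4; lra.
Qed.

End smooth_antipodal_bound.

(** Concentration of measure for the odd part of a Lipschitz function on the
    sphere: the trivial bound 4 M ^ 2 improves by a factor of order n. *)
Lemma antipodal_energy_le (R : realType) (n : nat) (p : 'rV[R]_n -> R) (M : R) :
  (0 < n)%N -> measurable_fun setT p -> 0 <= M ->
  (forall x y, `|p x - p y| <= M * enorm (x - y)) ->
  (energy p -%R <= (80 * M ^+ 2 / n%:R)%:E)%E.
Proof.
case: n p => // m p _ mp M0 lipp; set n := m.+1.
have n1 : 1 <= n%:R :> R by rewrite ler1n.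
have n0 : 0 < n%:R :> R by rewrite ltr0n.
(* smoothing at scale 1 / n makes p differentiable and moves it by at most
   M / n, which costs O(M ^ 2 / n ^ 2) *)
pose eta : R := n%:R^-1.
have eta0 : 0 < eta by rewrite invr_gt0.
pose h := smoothing p eta.
have mh : measurable_fun setT h.
  rewrite (_ : h = fun x => \int[unif_ball R n]_u p (x + eta *: u)); last first.
    by apply/funext => x; exact: smoothingE.
  apply: (measurable_Rintegral (unif_ball R n)
    (k := fun z : 'rV[R]_n * 'rV[R]_n => p (z.1 + eta *: z.2))).
  apply: (measurableT_comp mp); apply: measurable_rVD => //.
  by apply: measurable_rVZ => //; exact: measurable_snd.
have C0 : 0 <= smoothing_remainder n M / eta.
  by apply: divr_ge0; [apply: mulr_ge0 => //; exact: mulr_ge0|exact: ltW].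
have hE := smooth_antipodal_energy mh M0
  (smoothing_lipschitz mp M0 lipp eta) C0 (divr_gt0 eta0 (ltr0n R 2))
  (fun x => sphere_gradient_le (ltn0Sn m) mp M0 lipp x eta0)
  (fun x k hk => smoothing_expansion (ltn0Sn m) mp M0 lipp x eta0 hk).
have close x : `|h x - p x| <= M * eta.
  exact: (smoothing_close mp M0 lipp x (ltW eta0)).
have mdir := @measurable_enormalize R n.
have mN : measurable_fun setT (fun x : 'rV[R]_n => - x) by exact: measurable_rVN.
have m1 : measurable_fun setT (fun x : 'rV[R]_n =>
    ((h (enormalize x) - h (- enormalize x)) ^+ 2)%:E).
  exact: (measurable_energy mh mdir (measurableT_comp mN mdir)).
have ple : (energy p -%R <= 2%:E * energy h -%R + (8 * (M * eta) ^+ 2)%:E)%E.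
  rewrite /energy -ge0_integralZl_EFin//; last by move=> x _; rewrite lee_fin sqr_ge0.
  rewrite -[X in (_ + X)%E]mule1 -(probability_setT (unif_ball R n)).
  rewrite -integral_cst// -ge0_integralD//; last 3 first.
  - by move=> x _; rewrite lee_fin mulr_ge0// sqr_ge0.
  - exact: emeasurable_funM.
  - by move=> x _; rewrite lee_fin mulr_ge0// sqr_ge0.
  apply: ge0_le_integral => //.
  - by move=> x _; rewrite lee_fin sqr_ge0.
  - exact: (measurable_energy mp mdir (measurableT_comp mN mdir)).
  - by apply: emeasurable_funD => //; exact: emeasurable_funM.
  move=> x _; rewrite -EFinM -EFinD lee_fin.
  have := close (enormalize x); have := close (- enormalize x).
  have me : 0 <= M * eta by rewrite mulr_ge0// ltW.
  set a := h (enormalize x); set b := h (- enormalize x).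
  set c := p (enormalize x); set d := p (- enormalize x).
  move: (M * eta) me => e e0; clearbody a b c d.
  rewrite !ler_norml => /andP[? ?] /andP[? ?].
  have : ((c - d) - (a - b)) ^+ 2 <= (2 * e) ^+ 2.
    rewrite -[leLHS]real_normK ?num_real// ler_sqr ?nnegrE ?mulr_ge0//.
    by rewrite ler_norml; apply/andP; split; lra.
  have := sqr_ge0 ((c - d) - 2 * (a - b)); nra.
have hfin : exists e : R, energy h -%R = e%:E.
  case: (energy h -%R) (energy_ge0 h -%R) hE => [e| |]// _; first by exists e.
  by rewrite gt0_muley ?lte_fin// leye_eq.
(* 80 = 2 * 36 + 8, using n >= 1 *)
have [e eE] := hfin; move: hE ple; rewrite eE -!EFinM -EFinD lee_fin => hE.
move=> /le_trans; apply; rewrite lee_fin ler_pdivlMr//.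
have n2 : (M * eta) ^+ 2 * n%:R <= M ^+ 2.
  rewrite (_ : _ * n%:R = M ^+ 2 * eta); last by rewrite /eta; field; rewrite gt_eqF.
  by apply: ler_piMr; [exact: sqr_ge0|rewrite invf_le1].
move: hE n2; rewrite -/n; move: ((M * eta) ^+ 2) (M ^+ 2) (n%:R : R) => q M2 N.
by clear; lra.
Qed.

(** * Disintegration along conditional laws *)

Section kernels.
Context {R : realType}.
Local Open Scope ereal_scope.

Section kernel_pull.
Context d d1 d2 {T : measurableType d} {T1 : measurableType d1}
  {T2 : measurableType d2}.
Variables (K : R.-pker T1 ~> T2) (phi : T -> T1).
Hypothesis mphi : measurable_fun setT phi.

Definition kernel_pull of measurable_fun setT phi :=
  fun x : T => (K (phi x) : {measure set T2 -> \bar R}).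

Let measurable_kernel_pull U : measurable U ->
  measurable_fun setT (kernel_pull mphi ^~ U).
Proof. by move=> mU; apply: (measurableT_comp (measurable_kernel K U mU)). Qed.

HB.instance Definition _ := isKernel.Build _ _ _ _ R
  (kernel_pull mphi) measurable_kernel_pull.

Let kernel_pull_prob x : kernel_pull mphi x setT = 1.
Proof. exact: prob_kernel. Qed.

HB.instance Definition _ := Kernel_isProbability.Build _ _ _ _ R
  (kernel_pull mphi) kernel_pull_prob.

End kernel_pull.

Section kernel_law.
Context d d1 {T : measurableType d} {T1 : measurableType d1}.
Variable K : R.-pker T ~> T1.

(** The values of a probability kernel, as probability measures. *)
Definition kernel_law (x : T) : set T1 -> \bar R := K x.

HB.instance Definition _ x := Measure.copy (kernel_law x) (K x).

Let kernel_law_setT x : kernel_law x setT = 1.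
Proof. exact: prob_kernel. Qed.

HB.instance Definition _ x := Measure_isProbability.Build _ _ _
  (kernel_law x) (kernel_law_setT x).

End kernel_law.

Section kernel_prod.
Context d d1 d2 {T : measurableType d} {T1 : measurableType d1}
  {T2 : measurableType d2}.
Variables (K1 : R.-pker T ~> T1) (K2 : R.-pker T ~> T2).

Definition kernel_prod (x : T) : {measure set (T1 * T2) -> \bar R} :=
  kernel_law K1 x \x kernel_law K2 x.

Lemma kernel_prod_rectangle x A B : measurable A -> measurable B ->
  kernel_prod x (A `*` B) = K1 x A * K2 x B.
Proof. by move=> mA mB; exact: product_measure1E. Qed.

Let measurable_kernel_prod U : measurable U ->
  measurable_fun setT (kernel_prod ^~ U).
Proof.
move=> mU.
have mk : measurable_fun setT (fun p : T * T1 => K2 p.1 (xsection U p.2)).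
  pose K2' : R.-pker (T * T1) ~> T2 := kernel_pull K2 (@measurable_fst _ _ T T1).
  rewrite (_ : (fun p => _) = fun p : T * T1 => \int[K2' p]_s (\1_U (p.2, s))%:E).
    apply: (measurable_fun_integral_sfinite_kernel
      (fun z : (T * T1) * T2 => (\1_U (z.1.2, z.2))%:E) K2').
      by move=> z; rewrite lee_fin.
    apply/measurable_EFinP; apply: (@measurableT_comp _ _ _ _ _ _ (\1_U : _ -> R)).
      exact: measurable_indic.
    apply/measurable_fun_pairP; split => /=; last exact: measurable_snd.
    by apply: (measurableT_comp measurable_snd); exact: measurable_fst.
  apply/funext => p.
  rewrite (eq_integral (fun s => (\1_(xsection U p.2) s)%:E)).
    by rewrite integral_indic ?setIT//; exact: measurable_xsection.
  by move=> s _; rewrite !indicE mem_xsection.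
exact: (measurable_fun_integral_sfinite_kernel
  (fun p : T * T1 => K2 p.1 (xsection U p.2)) K1).
Qed.

HB.instance Definition _ := isKernel.Build _ _ _ _ R
  kernel_prod measurable_kernel_prod.

Let kernel_prod_prob x : kernel_prod x setT = 1.
Proof.
by rewrite -setXTT kernel_prod_rectangle// !prob_kernel mule1.
Qed.

HB.instance Definition _ := Kernel_isProbability.Build _ _ _ _ R
  kernel_prod kernel_prod_prob.

Lemma ge0_integral_kernel_prod x (k : T1 * T2 -> \bar R) :
  measurable_fun setT k -> (forall p, 0 <= k p) ->
  \int[kernel_prod x]_p k p = \int[K1 x]_s \int[K2 x]_s' k (s, s').
Proof. by move=> mk k0; exact: fubini_tonelli1. Qed.

End kernel_prod.

Section mixture.
Context dO d (Omega : measurableType dO) (Z : measurableType d).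
Variables (m : {measure set Omega -> \bar R}) (K : R.-pker Omega ~> Z).

Hypothesis m_fin : m setT < +oo.

(** A finite measure as a kernel from a point, so that kernel composition
    applies to it. *)
Definition constant_kernel of m setT < +oo :=
  fun _ : unit => (m : {measure set Omega -> \bar R}).

Let measurable_constant_kernel U : measurable U ->
  measurable_fun setT (constant_kernel m_fin ^~ U).
Proof. by move=> mU; exact: measurable_cst. Qed.

HB.instance Definition _ := isKernel.Build _ _ _ _ R
  (constant_kernel m_fin) measurable_constant_kernel.

Let constant_kernel_uub : measure_fam_uub (constant_kernel m_fin).
Proof.
exists (fine (m setT) + 1)%R => x; rewrite /constant_kernel EFinD.
by rewrite fineK ?ge0_fin_numE// lteDl ?lte_fin// ge0_fin_numE.
Qed.

HB.instance Definition _ := Kernel_isFinite.Build _ _ _ _ R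
  (constant_kernel m_fin) constant_kernel_uub.

(** The law of an outcome of K w when w is drawn from m. *)
Definition mixture : {measure set Z -> \bar R} :=
  mkcomp (constant_kernel m_fin)
    (kernel_pull K (@measurable_snd _ _ unit Omega)) tt.

Lemma mixtureE C : mixture C = \int[m]_w K w C.
Proof. by []. Qed.

Lemma ge0_integral_mixture (k : Z -> \bar R) :
  measurable_fun setT k -> (forall z, 0 <= k z) ->
  \int[mixture]_z k z = \int[m]_w \int[K w]_z k z.
Proof.
move=> mk k0; exact: (integral_kcomp (constant_kernel m_fin)
  (kernel_pull K (@measurable_snd _ _ unit Omega)) tt k0 mk).
Qed.

End mixture.
End kernels.

Section disintegration.
Context {R : realType} dO {Omega : measurableType dO} (P : probability Omega R).
Local Open Scope ereal_scope.

Lemma eq_measure_rectangles d1 d2 (T1 : measurableType d1)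
    (T2 : measurableType d2) (m1 m2 : {measure set (T1 * T2) -> \bar R}) :
  m1 setT < +oo ->
  (forall A B, measurable A -> measurable B -> m1 (A `*` B) = m2 (A `*` B)) ->
  forall C, measurable C -> m1 C = m2 C.
Proof.
move=> m1oo m12; apply: (measure_unique _ (fun=> setT)
  (measurable_prod_measurableType T1 T2)).
- move=> _ _ [A mA [B mB <-]] [A' mA' [B' mB' <-]]; rewrite -setXI.
  by exists (A `&` A'); [exact: measurableI|exists (B `&` B') => //; exact: measurableI].
- by move=> _; exists setT => //; exists setT => //; rewrite setXTT.
- by rewrite bigcup_const.
- by move=> _ [A mA [B mB <-]]; exact: m12.
- by [].
Qed.

(** Both sides are finite measures in E, determined by their values on
    rectangles. *)
Lemma conditional_pair_law d d1 d2 (T : measurableType d)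
    (T1 : measurableType d1) (T2 : measurableType d2)
    (K1 : R.-pker T ~> T1) (K2 : R.-pker T ~> T2)
    (A : set Omega) (Y : Omega -> T) (X1 : Omega -> T1) (X2 : Omega -> T2) :
  measurable A -> measurable_fun setT Y ->
  measurable_fun setT X1 -> measurable_fun setT X2 ->
  (forall B1 B2, measurable B1 -> measurable B2 ->
    P (A `&` (X1 @^-1` B1 `&` X2 @^-1` B2)) =
    \int[P]_(w in A) (K1 (Y w) B1 * K2 (Y w) B2)) ->
  forall E, measurable E ->
    P (A `&` (fun w => (X1 w, X2 w)) @^-1` E) =
    \int[P]_(w in A) kernel_prod K1 K2 (Y w) E.
Proof.
move=> mA mY mX1 mX2 rect E mE.
have mX : measurable_fun setT (fun w => (X1 w, X2 w)).
  exact/measurable_fun_pairP.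
have PA : mrestr P mA setT < +oo.
  by rewrite /mrestr setTI (le_lt_trans (probability_le1 _ _))// ltry.
pose K : R.-pker T ~> (T1 * T2)%type := kernel_prod K1 K2.
transitivity (pushforward (mrestr P mA) (fun w => (X1 w, X2 w)) E).
  by rewrite /pushforward /mrestr setIC.
rewrite (@eq_measure_rectangles _ _ _ _
  (pushforward (mrestr P mA) (fun w => (X1 w, X2 w)))
  (mixture (kernel_pull K mY) PA))//.
  rewrite mixtureE ge0_integral_mrestr//.
  exact: measurable_kernel.
move=> B1 B2 mB1 mB2; rewrite mixtureE ge0_integral_mrestr//; last first.
  by apply: measurable_kernel; exact: measurableX.
rewrite -[LHS]/(P ((X1 @^-1` B1 `&` X2 @^-1` B2) `&` A)) setIC rect//.
by apply: eq_integral => w _; rewrite -kernel_prod_rectangle.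
Qed.

(** If kappa (Y w) is the law of X given a sigma-algebra that makes Y
    measurable, then Y may be treated as a constant when X is integrated out. *)
Lemma disintegration d d1 (T : measurableType d) (T1 : measurableType d1)
    (K : R.-pker T ~> T1) (A : set Omega) (Y : Omega -> T) (X : Omega -> T1)
    (k : T * T1 -> \bar R) :
  measurable A -> measurable_fun setT Y -> measurable_fun setT X ->
  (forall C B, measurable C -> measurable B ->
    P (A `&` Y @^-1` C `&` X @^-1` B) =
    \int[P]_(w in A `&` Y @^-1` C) K (Y w) B) ->
  measurable_fun setT k -> (forall p, 0 <= k p) ->
  \int[P]_(w in A) k (Y w, X w) =
  \int[P]_(w in A) \int[K (Y w)]_x k (Y w, x).
Proof.
move=> mA mY mX rect mk k0.
have mYX : measurable_fun setT (fun w => (Y w, X w)).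
  exact/measurable_fun_pairP.
have PA : mrestr P mA setT < +oo.
  by rewrite /mrestr setTI (le_lt_trans (probability_le1 _ _))// ltry.
pose G : R.-pker T ~> (T * T1)%type :=
  kernel_prod (kdirac (@measurable_id _ T setT)) K.
transitivity (\int[pushforward (mrestr P mA) (fun w => (Y w, X w))]_p k p).
  rewrite ge0_integral_pushforward//= preimage_setT ge0_integral_mrestr//.
  exact: (measurableT_comp mk).
transitivity (\int[mixture (kernel_pull G mY) PA]_p k p).
  apply: eq_measure_integral => C mC _; apply: eq_measure_rectangles => //.
  move=> D B mD mB; rewrite mixtureE ge0_integral_mrestr//; last first.
    by apply: measurable_kernel; exact: measurableX.
  rewrite -[LHS]/(P ((Y @^-1` D `&` X @^-1` B) `&` A)) setIC setIA rect//.
  rewrite integral_mkcondr; apply: eq_integral => w _.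
  rewrite patchE /kernel_pull kernel_prod_rectangle//= diracE.
  have -> : (w \in Y @^-1` D) = (Y w \in D) by apply/idP/idP; rewrite !inE.
  by case: (Y w \in D); rewrite ?mul1e ?mul0e.
rewrite ge0_integral_mixture// ge0_integral_mrestr//; last 2 first.
- apply: measurable_fun_integral_kernel => // B mB.
  exact: (measurable_kernel (kernel_pull G mY)).
- by move=> w; exact: integral_ge0.
apply: eq_integral => w _; rewrite /kernel_pull ge0_integral_kernel_prod//=.
rewrite integral_dirac//= ?diracT ?mul1e//.
exact: (measurable_fun_fubini_tonelli_F (m2 := kernel_law K (Y w))).
Qed.

End disintegration.

Section signed_disintegration.
Context {R : realType} dO {Omega : measurableType dO} (P : probability Omega R).
Local Open Scope ereal_scope.

Lemma disintegration_integrable d d1 (T : measurableType d)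
    (T1 : measurableType d1)
    (K : R.-pker T ~> T1) (A : set Omega) (Y : Omega -> T) (X : Omega -> T1)
    (k : T * T1 -> R) :
  measurable A -> measurable_fun setT Y -> measurable_fun setT X ->
  (forall C B, measurable C -> measurable B ->
    P (A `&` Y @^-1` C `&` X @^-1` B) =
    \int[P]_(w in A `&` Y @^-1` C) K (Y w) B) ->
  measurable_fun setT k ->
  (forall y, (K y).-integrable setT (fun x => (k (y, x))%:E)) ->
  P.-integrable A (fun w => (k (Y w, X w))%:E) ->
  P.-integrable A (fun w => \int[K (Y w)]_x (k (Y w, x))%:E) /\
  \int[P]_(w in A) (k (Y w, X w))%:E =
  \int[P]_(w in A) \int[K (Y w)]_x (k (Y w, x))%:E.
Proof.
move=> mA mY mX rect mk Kk Pk.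
pose kE : T * T1 -> \bar R := EFin \o k.
have mkE : measurable_fun setT kE by exact/measurable_EFinP.
have mp := measurable_funepos mkE; have mn := measurable_funeneg mkE.
have ep := disintegration mA mY mX rect mp (funepos_ge0 kE).
have en := disintegration mA mY mX rect mn (funeneg_ge0 kE).
have posE w : (fun w => (k (Y w, X w))%:E)^\+ w = kE^\+ (Y w, X w).
  by rewrite !funeposE.
have negE w : (fun w => (k (Y w, X w))%:E)^\- w = kE^\- (Y w, X w).
  by rewrite !funenegE.
have kposE y : \int[K y]_x kE^\+ (y, x) = \int[K y]_x ((fun x => (k (y, x))%:E)^\+ x).
  by apply: eq_integral => x _; rewrite !funeposE.
have knegE y : \int[K y]_x kE^\- (y, x) = \int[K y]_x ((fun x => (k (y, x))%:E)^\- x).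
  by apply: eq_integral => x _; rewrite !funenegE.
pose kp w := \int[K (Y w)]_x kE^\+ (Y w, x).
pose kn w := \int[K (Y w)]_x kE^\- (Y w, x).
have kpkn w : \int[K (Y w)]_x (k (Y w, x))%:E = kp w - kn w.
  by rewrite integralE /kp /kn kposE knegE.
have mkp : measurable_fun setT kp.
  have m0 := measurable_kernel_integral K mp; exact: (measurableT_comp m0 mY).
have mkn : measurable_fun setT kn.
  have m0 := measurable_kernel_integral K mn; exact: (measurableT_comp m0 mY).
have kp0 w : 0 <= kp w by exact: integral_ge0.
have kn0 w : 0 <= kn w by exact: integral_ge0.
have ikp : P.-integrable A kp.
  apply/integrableP; split; first exact: measurable_funTS.
  under eq_integral do rewrite gee0_abs//.
  rewrite -ep; have := integral_funepos_lt_pinfty mA Pk.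
  by under eq_integral do rewrite posE.
have ikn : P.-integrable A kn.
  apply/integrableP; split; first exact: measurable_funTS.
  under eq_integral do rewrite gee0_abs//.
  rewrite -en; have := integral_funeneg_lt_pinfty mA Pk.
  by under eq_integral do rewrite negE.
have eqk : (fun w => \int[K (Y w)]_x (k (Y w, x))%:E) = (fun w => kp w - kn w).
  exact/funext.
rewrite eqk; split; first exact: integrableB.
rewrite integralB// [LHS]integralE; congr (_ - _).
  by rewrite -ep; apply: eq_integral => w _; rewrite posE.
by rewrite -en; apply: eq_integral => w _; rewrite negE.
Qed.

End signed_disintegration.

Lemma measurable_kernel_mean {R : realType} d d1 (T : measurableType d)
    (S : measurableType d1) (Xi : R.-pker T ~> S) (F : T -> S -> R) (f : T -> R) :
  measurable_fun setT (fun p : T * S => F p.1 p.2) ->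
  (forall x, (\int[Xi x]_s (F x s)%:E = (f x)%:E)%E) ->
  measurable_fun setT f.
Proof.
move=> mF meanF.
have mFE : measurable_fun setT (fun p : T * S => (F p.1 p.2)%:E).
  exact/measurable_EFinP.
have := measurableT_comp (fine_measurable measurableT)
  (measurable_kernel_integral Xi mFE).
by apply: eq_measurable_fun => x _ /=; rewrite meanF.
Qed.

Section second_moment.
Context {R : realType} d (S : measurableType d).

Lemma integrable_moment (Q : probability S R) (X : S -> R) (m v : R) :
  measurable_fun setT X ->
  (\int[Q]_s (`|X s - m| ^+ 2)%:E <= v%:E)%E ->
  Q.-integrable setT (fun s => (`|X s - m| ^+ 2)%:E).
Proof.
move=> mX varX; apply/integrableP; split.
  apply/measurable_EFinP; apply: measurable_funX.
  by apply: measurableT_comp => //; exact: measurable_funB.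
under eq_integral do rewrite gee0_abs ?lee_fin ?sqr_ge0//.
exact: le_lt_trans varX (ltry _).
Qed.

(** Bias-variance decomposition around a point t other than the mean m. *)
Lemma second_moment_le (Q : probability S R) (X : S -> R) (m v t : R) :
  Q.-integrable setT (EFin \o X) -> (\int[Q]_s (X s)%:E = m%:E)%E ->
  (\int[Q]_s (`|X s - m| ^+ 2)%:E <= v%:E)%E ->
  (\int[Q]_s ((t - X s) ^+ 2)%:E <= ((t - m) ^+ 2 + v)%:E)%E.
Proof.
move=> iX meanX varX.
have mX : measurable_fun setT X by apply/measurable_EFinP; exact: (measurable_int Q).
have i2 := integrable_moment mX varX.
have ic (c : R) : Q.-integrable setT (cst c%:E).
  exact: finite_measure_integrable_cst.
have iB : Q.-integrable setT (fun s => m%:E - (X s)%:E)%E.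
  exact: (integrableB measurableT (ic m) iX).
have iZ : Q.-integrable setT (fun s => (2 * (t - m))%:E * (m%:E - (X s)%:E))%E.
  exact: integrableZl.
have i1 : Q.-integrable setT
    (fun s => ((t - m) ^+ 2)%:E + (2 * (t - m))%:E * (m%:E - (X s)%:E))%E.
  exact: (integrableD measurableT (ic _) iZ).
rewrite (eq_integral (fun s => ((t - m) ^+ 2)%:E +
    (2 * (t - m))%:E * (m%:E - (X s)%:E) + (`|X s - m| ^+ 2)%:E)%E); last first.
  move=> s _; rewrite -EFinB -EFinM -!EFinD real_normK ?num_real//.
  by congr (_%:E); ring.
rewrite (integralD measurableT i1 i2) (integralD measurableT (ic _) iZ).
rewrite (integralZl measurableT iB) (integralB measurableT (ic m) iX).
have -> : (\int[Q]_x (EFin \o X) x = m%:E)%E by exact: meanX.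
rewrite !integral_probability_cst -EFinB subrr mule0 adde0.
by rewrite EFinD leeD2l.
Qed.

End second_moment.

Section second_moment_difference.
Context {R : realType} d d' (S : measurableType d) (S' : measurableType d').

(** The variances of independent samples add up. *)
Lemma second_moment_difference_le (Q : probability S R) (Q' : probability S' R) (X : S -> R) (X' : S' -> R)
    (m m' v v' : R) :
  Q.-integrable setT (EFin \o X) -> (\int[Q]_s (X s)%:E = m%:E)%E ->
  (\int[Q]_s (`|X s - m| ^+ 2)%:E <= v%:E)%E ->
  Q'.-integrable setT (EFin \o X') -> (\int[Q']_s (X' s)%:E = m'%:E)%E ->
  (\int[Q']_s (`|X' s - m'| ^+ 2)%:E <= v'%:E)%E ->
  (\int[Q]_s \int[Q']_s' ((X s - X' s') ^+ 2)%:E <=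
   ((m - m') ^+ 2 + (v + v'))%:E)%E.
Proof.
move=> iX meanX varX iX' meanX' varX'.
have mX : measurable_fun setT X by apply/measurable_EFinP; exact: (measurable_int Q).
have mX' : measurable_fun setT X'.
  by apply/measurable_EFinP; exact: (measurable_int Q').
have v'0 : 0 <= v'.
  rewrite -lee_fin; apply: le_trans varX'; apply: integral_ge0 => s _.
  by rewrite lee_fin sqr_ge0.
apply: (@le_trans _ _ (\int[Q]_s (((m' - X s) ^+ 2)%:E + v'%:E))%E).
  apply: ge0_le_integral => //.
  - by move=> s _; apply: integral_ge0 => s' _; rewrite lee_fin sqr_ge0.
  - have mD : measurable_fun setT (fun p : S * S' => ((X p.1 - X' p.2) ^+ 2)%:E).
      apply/measurable_EFinP; apply: measurable_funX.
      by apply: measurable_funB; apply: measurableT_comp.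
    by apply: (measurable_fun_fubini_tonelli_F (m2 := Q') _ mD) => p;
      rewrite lee_fin sqr_ge0.
  - apply: emeasurable_funD => //; apply/measurable_EFinP; apply: measurable_funX.
    exact: measurable_funB.
  - move=> s _; rewrite -EFinD (_ : (m' - X s) ^+ 2 = (X s - m') ^+ 2); last by ring.
    exact: second_moment_le.
rewrite ge0_integralD//; last 2 first.
- by move=> s _; rewrite lee_fin sqr_ge0.
- apply/measurable_EFinP; apply: measurable_funX; exact: measurable_funB.
rewrite integral_probability_cst.
apply: (le_trans (leeD2r _ (second_moment_le m' iX meanX varX))).
by rewrite -EFinD lee_fin -[(m' - m) ^+ 2]sqrrN opprB addrA.
Qed.

End second_moment_difference.

(** * Integrating out a conditional law *)

Lemma sigma_algebra_setI T (G : set (set T)) :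
  sigma_algebra setT G -> setI_closed G.
Proof.
move=> [G0 GC GU] A B GA GB.
have -> : A `&` B = setT `\` \bigcup_i bigcup2 (setT `\` A) (setT `\` B) i.
  by rewrite bigcup2E !setTD setCU !setCK.
by apply: (GC); apply: GU => -[|[|i]] /=; do ?exact: GC.
Qed.

Section sub_sigma_algebra.
Context {R : realType} d (Omega : measurableType d).
Variables (G : set (set Omega)).
Hypothesis subG : sub_sigma_algebra_of G.

Lemma measurable_wrt_fun d' (T : measurableType d') (Y : Omega -> T) :
  measurable_wrt G Y -> measurable_fun setT Y.
Proof.
move=> GY _ B mB; case: subG => _; apply; apply: GY; exists B => //.
Qed.

Lemma measurable_wrt_comp d1 d2 (T1 : measurableType d1)
    (T2 : measurableType d2) (Y : Omega -> T1) (h : T1 -> T2) :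
  measurable_fun setT h -> measurable_wrt G Y -> measurable_wrt G (h \o Y).
Proof.
move=> mh GY _ [B mB <-]; apply: GY; exists (h @^-1` B) => //.
by rewrite -[X in measurable X]setTI; exact: mh.
Qed.

Lemma measurable_wrt_pair d1 d2 (T1 : measurableType d1)
    (T2 : measurableType d2) (Y1 : Omega -> T1) (Y2 : Omega -> T2) :
  measurable_wrt G Y1 -> measurable_wrt G Y2 ->
  measurable_wrt G (fun w => (Y1 w, Y2 w)).
Proof.
move=> GY1 GY2 _ [C mC <-]; rewrite setTI.
have [[G0 GC GU] _] := subG.
pose M := [set C : set (T1 * T2) | G ((fun w => (Y1 w, Y2 w)) @^-1` C)].
suff sub : measurable `<=` M by exact: sub.
rewrite measurable_prod_measurableType; apply: smallest_sub.
  split=> [|B mB|E mE]; rewrite /M /=.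
  - by rewrite preimage_set0.
  - by rewrite setTD preimage_setC -setTD; exact: GC.
  - by rewrite preimage_bigcup; exact: GU.
move=> _ [A mA [B mB <-]]; rewrite /M /=.
apply: (@sigma_algebra_setI _ G _ (Y1 @^-1` A) (Y2 @^-1` B)).
- by case: subG.
- by apply: GY1; exists A => //; rewrite setTI.
- by apply: GY2; exists B => //; rewrite setTI.
Qed.

Lemma sub_sigma_join d' (T : measurableType d') (u : Omega -> T) :
  G `<=` sigma_join G u.
Proof. by move=> A GA; apply: sub_sigma_algebra; left. Qed.

Lemma measurable_wrt_join d' (T : measurableType d') (u : Omega -> T) :
  measurable_wrt (sigma_join G u) u.
Proof. by move=> A uA; apply: sub_sigma_algebra; right. Qed.

Lemma sub_sigma_algebra_join d' (T : measurableType d') (u : Omega -> T) :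
  measurable_fun setT u -> sub_sigma_algebra_of (sigma_join G u).
Proof.
move=> mu; split; first exact: smallest_sigma_algebra.
apply: smallest_sub; first exact: sigma_algebra_measurable.
move=> A [GA|[B mB <-]]; first by case: subG => _; apply.
exact: mu.
Qed.

End sub_sigma_algebra.

Section conditional_law.
Context {R : realType} dO (Omega : measurableType dO) (P : probability Omega R).
Variables (G : set (set Omega)).
Hypothesis subG : sub_sigma_algebra_of G.
Local Open Scope ereal_scope.

(** The law of X given G is the kernel K evaluated at the G-measurable Y. *)
Definition conditional_law d d1 (T : measurableType d) (T1 : measurableType d1)
    (Y : Omega -> T) (X : Omega -> T1) (K : R.-pker T ~> T1) :=
  forall A B, G A -> measurable B ->
    P (A `&` X @^-1` B) = \int[P]_(w in A) K (Y w) B.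

Section integrals.
Context d d1 (T : measurableType d) (T1 : measurableType d1)
  (Y : Omega -> T) (X : Omega -> T1) (K : R.-pker T ~> T1).
Hypothesis GY : measurable_wrt G Y.
Hypothesis mX : measurable_fun setT X.
Hypothesis XK : conditional_law Y X K.

Let rect A C B : G A -> measurable C -> measurable B ->
  P (A `&` Y @^-1` C `&` X @^-1` B) = \int[P]_(w in A `&` Y @^-1` C) K (Y w) B.
Proof.
move=> GA mC mB; apply: XK => //; apply: sigma_algebra_setI => //.
  by case: subG.
by apply: GY; exists C => //; rewrite setTI.
Qed.

Lemma ge0_conditional_integral A (k : T * T1 -> \bar R) : G A ->
  measurable_fun setT k -> (forall p, 0 <= k p) ->
  \int[P]_(w in A) k (Y w, X w) =
  \int[P]_(w in A) \int[K (Y w)]_x k (Y w, x).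
Proof.
move=> GA mk k0; apply: disintegration => //.
- by case: subG => _; apply.
- exact: measurable_wrt_fun GY.
- by move=> C B; exact: rect.
Qed.

Lemma conditional_integral A (k : T * T1 -> R) : G A ->
  measurable_fun setT k ->
  (forall y, (K y).-integrable setT (fun x => (k (y, x))%:E)) ->
  P.-integrable A (fun w => (k (Y w, X w))%:E) ->
  P.-integrable A (fun w => \int[K (Y w)]_x (k (Y w, x))%:E) /\
  \int[P]_(w in A) (k (Y w, X w))%:E =
  \int[P]_(w in A) \int[K (Y w)]_x (k (Y w, x))%:E.
Proof.
move=> GA mk Kk Pk; apply: disintegration_integrable => //.
- by case: subG => _; apply.
- exact: measurable_wrt_fun GY.
- by move=> C B; exact: rect.
Qed.

End integrals.

Lemma conditional_law_pair d d1 d2 (T : measurableType d)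
    (T1 : measurableType d1) (T2 : measurableType d2) (Y : Omega -> T)
    (X1 : Omega -> T1) (X2 : Omega -> T2)
    (K1 : R.-pker T ~> T1) (K2 : R.-pker T ~> T2) :
  measurable_wrt G Y -> measurable_fun setT X1 -> measurable_fun setT X2 ->
  has_cond_law P G X1 (fun w => K1 (Y w)) ->
  has_cond_law P G X2 (fun w => K2 (Y w)) ->
  cond_independent P G X1 X2 ->
  conditional_law Y (fun w => (X1 w, X2 w)) (kernel_prod K1 K2).
Proof.
move=> GY mX1 mX2 law1 law2 indep A B GA mB.
have mA : measurable A by case: subG => _; apply.
apply: conditional_pair_law => //; first exact: measurable_wrt_fun GY.
move=> B1 B2 mB1 mB2.
have [_ _ _ /(_ A GA)] := indep B1 B2 _ _ mB1 mB2 (law1 _ mB1) (law2 _ mB2).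
have mX12 : measurable (X1 @^-1` B1 `&` X2 @^-1` B2).
  by apply: measurableI; rewrite -[X in measurable X]setTI;
    [exact: mX1|exact: mX2].
rewrite integral_indic// setIC => <-; apply: eq_integral => w _ /=.
rewrite EFinM !fineK// ge0_fin_numE ?measure_ge0//;
  by rewrite (le_lt_trans (@probability_le1 _ _ _ (kernel_law _ _) _ _)) ?ltry.
Qed.

Lemma conditional_law_independent d d1 (T : measurableType d)
    (T1 : measurableType d1) (Y : Omega -> T) (X : Omega -> T1)
    (Q : probability T1 R) :
  independent_of P G X -> (forall B, measurable B -> P (X @^-1` B) = Q B) ->
  conditional_law Y X (@constant_law R _ _ T _ Q).
Proof.
move=> indep lawX A B GA mB; rewrite indep// lawX//.
have mA : measurable A by case: subG => _; apply.
by rewrite /constant_law integral_cst// muleC.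
Qed.

End conditional_law.

Section product_difference.
Context {R : realType} d d' (S : measurableType d) (S' : measurableType d').
Variables (Q : probability S R) (Q' : probability S' R).
Local Open Scope ereal_scope.

Lemma integrable_product_fst (X : S -> R) : Q.-integrable setT (EFin \o X) ->
  (Q \x Q').-integrable setT (fun p => (X p.1)%:E) /\
  \int[Q \x Q']_p (X p.1)%:E = \int[Q]_s (X s)%:E.
Proof.
move=> iX; have mX : measurable_fun setT (EFin \o X) by exact: (measurable_int Q).
have mX1 : measurable_fun setT (fun p : S * S' => (X p.1)%:E).
  exact: (measurableT_comp mX measurable_fst).
have iX1 : (Q \x Q').-integrable setT (fun p : S * S' => (X p.1)%:E).
  apply/(integrable12ltyP Q Q' mX1) => /=.
  under eq_integral do rewrite integral_probability_cst.
  by have /integrableP[] := iX.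
split => //; rewrite -(integral12_prod_meas1 iX1).
by apply: eq_integral => s _; rewrite /fubini_F /= integral_probability_cst.
Qed.

Lemma integrable_product_snd (X : S' -> R) : Q'.-integrable setT (EFin \o X) ->
  (Q \x Q').-integrable setT (fun p => (X p.2)%:E) /\
  \int[Q \x Q']_p (X p.2)%:E = \int[Q']_s (X s)%:E.
Proof.
move=> iX; have mX : measurable_fun setT (EFin \o X) by exact: (measurable_int Q').
have mX1 : measurable_fun setT (fun p : S * S' => (X p.2)%:E).
  exact: (measurableT_comp mX measurable_snd).
have iX1 : (Q \x Q').-integrable setT (fun p : S * S' => (X p.2)%:E).
  apply/(integrable21ltyP Q Q' mX1) => /=.
  under eq_integral do rewrite integral_probability_cst.
  by have /integrableP[] := iX.
split => //; rewrite -(integral21_prod_meas1 iX1).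
by apply: eq_integral => s _; rewrite /fubini_G /= integral_probability_cst.
Qed.

End product_difference.

(** * The two-point estimator at a fixed point *)

Section estimator.
Context {R : realType} (n : nat) dS (S : measurableType dS).
Local Notation V := 'rV[R]_n.
Local Notation U := (unif_ball R n).
Variables (Xi : R.-pker V ~> S) (F : V -> S -> R) (f : V -> R).
Variables (L sigma delta : R).
Hypothesis n_gt0 : (0 < n)%N.
Hypothesis mF : measurable_fun setT (fun p : V * S => F p.1 p.2).
Hypothesis intF : forall x, (Xi x).-integrable setT (EFin \o F x).
Hypothesis meanF : forall x, (\int[Xi x]_s (F x s)%:E = (f x)%:E)%E.
Hypothesis varF : forall x,
  (\int[Xi x]_s (`|F x s - f x| ^+ 2)%:E <= (sigma ^+ 2)%:E)%E.
Hypothesis L_ge0 : 0 <= L.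
Hypothesis lipf : forall x x', `|f x - f x'| <= L * enorm (x - x').
Hypothesis delta_gt0 : 0 < delta.

Let mf : measurable_fun setT f := measurable_kernel_mean mF meanF.

Definition query_plus (p : V * V) : V := p.1 + delta *: p.2.
Definition query_minus (p : V * V) : V := p.1 - delta *: p.2.

Lemma measurable_query_plus : measurable_fun setT query_plus.
Proof.
apply: measurable_rVD; first exact: measurable_fst.
by apply: measurable_rVZ => //; exact: measurable_snd.
Qed.

Lemma measurable_query_minus : measurable_fun setT query_minus.
Proof.
apply: measurable_rVB; first exact: measurable_fst.
by apply: measurable_rVZ => //; exact: measurable_snd.
Qed.

(** The conditional law of the two samples given the point and direction. *)
Definition sample_kernel : R.-pker (V * V) ~> (S * S)%type :=
  kernel_prod (kernel_pull Xi measurable_query_plus)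
    (kernel_pull Xi measurable_query_minus).

Definition estimator (p : (V * V) * (S * S)) : V :=
  g2pt F delta p.1.1 p.1.2 p.2.1 p.2.2.

Lemma measurable_estimator : measurable_fun setT estimator.
Proof.
have m11 : measurable_fun setT (fun p : (V * V) * (S * S) => p.1).
  exact: measurable_fst.
have m2 : measurable_fun setT (fun p : (V * V) * (S * S) => p.2).
  exact: measurable_snd.
apply: measurable_rVZ; last exact: (measurableT_comp measurable_snd m11).
apply: measurable_funM; first exact: measurable_cst.
apply: measurable_funB.
  apply: (measurableT_comp mF (g := fun p : (V * V) * (S * S) =>
    (query_plus p.1, p.2.1))).
  apply/measurable_fun_pairP; split => /=.
    exact: (measurableT_comp measurable_query_plus m11).
  exact: (measurableT_comp measurable_fst m2).
apply: (measurableT_comp mF (g := fun p : (V * V) * (S * S) =>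
  (query_minus p.1, p.2.2))).
apply/measurable_fun_pairP; split => /=.
  exact: (measurableT_comp measurable_query_minus m11).
exact: (measurableT_comp measurable_snd m2).
Qed.

Let scale := n%:R / (2 * delta).

Lemma estimator_entry p (i : 'I_n) : estimator p ord0 i =
  scale * p.1.2 ord0 i * (F (query_plus p.1) p.2.1 - F (query_minus p.1) p.2.2).
Proof. by rewrite /estimator /g2pt mxE mulrAC. Qed.

Lemma sqr_enorm_estimator p : enorm (estimator p) ^+ 2 =
  scale ^+ 2 * enorm p.1.2 ^+ 2 *
  (F (query_plus p.1) p.2.1 - F (query_minus p.1) p.2.2) ^+ 2.
Proof.
rewrite /estimator /g2pt enormZ exprMn real_normK ?num_real//.
by rewrite exprMn mulrAC.
Qed.

(** Noise averages out of the estimator. *)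
Lemma sample_kernel_mean p (i : 'I_n) :
  (sample_kernel p).-integrable setT (fun s => (estimator (p, s) ord0 i)%:E) /\
  (\int[sample_kernel p]_s (estimator (p, s) ord0 i)%:E =
   (scale * p.2 ord0 i * (f (query_plus p) - f (query_minus p)))%:E)%E.
Proof.
pose Q x : probability S R := kernel_law Xi x.
have [i1 e1] := @integrable_product_fst _ _ _ _ _ (Q (query_plus p))
  (Q (query_minus p)) _ (intF (query_plus p)).
have [i2 e2] := @integrable_product_snd _ _ _ _ _ (Q (query_plus p))
  (Q (query_minus p)) _ (intF (query_minus p)).
have iB := integrableB measurableT i1 i2.
have eE : (fun s => (estimator (p, s) ord0 i)%:E) = (fun s : S * S =>
    (scale * p.2 ord0 i)%:E * ((F (query_plus p) s.1)%:E - (F (query_minus p) s.2)%:E))%E.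
  by apply/funext => s; rewrite estimator_entry -EFinB -EFinM.
rewrite eE; split; first exact: (integrableZl measurableT _ iB).
transitivity ((scale * p.2 ord0 i)%:E * \int[Q (query_plus p) \x Q (query_minus p)]_s
    ((F (query_plus p) s.1)%:E - (F (query_minus p) s.2)%:E))%E.
  exact: (integralZl measurableT iB).
rewrite (integralB measurableT i1 i2) e1 e2.
by rewrite [X in (X - _)%E]meanF [X in (_ - X)%E]meanF -EFinB -EFinM.
Qed.

Lemma sample_kernel_moment p :
  (\int[sample_kernel p]_s (enorm (estimator (p, s)) ^+ 2)%:E <=
   (scale ^+ 2 * enorm p.2 ^+ 2 *
    ((f (query_plus p) - f (query_minus p)) ^+ 2 + 2 * sigma ^+ 2))%:E)%E.
Proof.
have me : measurable_fun setT (fun s => (enorm (estimator (p, s)) ^+ 2)%:E).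
  apply/measurable_EFinP; apply: measurable_funX.
  apply: (measurableT_comp (@measurable_enorm R n)).
  exact: (measurableT_comp measurable_estimator (pair1_measurable p)).
pose D (s : S * S) : \bar R :=
  ((F (query_plus p) s.1 - F (query_minus p) s.2) ^+ 2)%:E.
have mFx x : measurable_fun setT (F x).
  exact: (measurableT_comp mF (pair1_measurable x)).
have mD : measurable_fun setT D.
  apply/measurable_EFinP; apply: measurable_funX; apply: measurable_funB.
    exact: (measurableT_comp (mFx _)).
  exact: (measurableT_comp (mFx _)).
have D0 s : (0 <= D s)%E by rewrite lee_fin sqr_ge0.
have a0 : 0 <= scale ^+ 2 * enorm p.2 ^+ 2 by rewrite mulr_ge0 ?sqr_ge0.
rewrite (eq_integral (fun s => (scale ^+ 2 * enorm p.2 ^+ 2)%:E * D s)%E); last first.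
  by move=> s _; rewrite sqr_enorm_estimator EFinM.
rewrite (@ge0_integralZl_EFin _ _ _ (sample_kernel p) setT measurableT D)//.
rewrite [leRHS]EFinM lee_wpmul2l ?lee_fin// ge0_integral_kernel_prod//.
have := @second_moment_difference_le _ _ _ _ _ (kernel_law Xi (query_plus p))
  (kernel_law Xi (query_minus p)) _ _ _ _ _ _ (intF (query_plus p))
  (meanF (query_plus p)) (varF (query_plus p)) (intF (query_minus p))
  (meanF (query_minus p)) (varF (query_minus p)).
by rewrite -[X in _ + X]mulr2n -[_ *+ 2]mulr_natl.
Qed.

Lemma ge0_integral_unif_sphere (k : V -> \bar R) :
  measurable_fun setT k -> (forall v, (0 <= k v)%E) ->
  (\int[unif_sphere R n]_v k v = \int[U]_x k (enormalize x))%E.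
Proof. by move=> mk k0; rewrite ge0_integral_pushforward. Qed.

Definition second_moment_bound : R :=
  20 * n%:R * L ^+ 2 + n%:R ^+ 2 * sigma ^+ 2 / (2 * delta ^+ 2).

(** The noise contributes its variance; what remains is the mean squared
    difference of f between antipodal points of a sphere of radius delta, which
    concentration bounds by a multiple of (delta * L)^2 / n. *)
Lemma estimator_second_moment y :
  (\int[unif_sphere R n]_v \int[sample_kernel (y, v)]_s
     (enorm (estimator ((y, v), s)) ^+ 2)%:E <= second_moment_bound%:E)%E.
Proof.
pose p v := f (y + delta *: v).
have mp : measurable_fun setT p by exact: (measurable_affine_comp mf).
have pN v : f (query_plus (y, v)) - f (query_minus (y, v)) = p v - p (- v).
  by rewrite /query_plus /query_minus /p /= scalerN.
have mE : measurable_fun setT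
    (fun q : (V * V) * (S * S) => (enorm (estimator q) ^+ 2)%:E).
  apply/measurable_EFinP; apply: measurable_funX.
  exact: (measurableT_comp (@measurable_enorm R n) measurable_estimator).
have mI := measurable_kernel_integral sample_kernel mE.
have mIy : measurable_fun setT (fun v => \int[sample_kernel (y, v)]_s
     (enorm (estimator ((y, v), s)) ^+ 2)%:E)%E.
  exact: (measurableT_comp mI (pair1_measurable y)).
have mpN : measurable_fun setT (fun v : V => ((p v - p (- v)) ^+ 2)%:E).
  exact: (measurable_energy (S := id) mp _ (measurable_rVN (@measurable_id _ V _))).
rewrite ge0_integral_unif_sphere//; last first.
  by move=> v; apply: integral_ge0 => s _; rewrite lee_fin sqr_ge0.
apply: (@le_trans _ _ (\int[U]_x ((scale ^+ 2)%:E *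
    (((p (enormalize x) - p (- enormalize x)) ^+ 2)%:E + (2 * sigma ^+ 2)%:E)))%E).
  apply: ge0_le_integral; first exact: measurableT.
  - by move=> x _; apply: integral_ge0 => s _; rewrite lee_fin sqr_ge0.
  - exact: (measurableT_comp mIy (@measurable_enormalize R n)).
  - apply: emeasurable_funM; first exact: measurable_cst.
    apply: emeasurable_funD; last exact: measurable_cst.
    exact: (measurableT_comp mpN (@measurable_enormalize R n)).
  - move=> x _; apply: le_trans (sample_kernel_moment _) _.
    rewrite pN -EFinD -EFinM lee_fin /= -mulrA ler_wpM2l ?sqr_ge0// ler_piMl//.
      by rewrite addr_ge0 ?sqr_ge0// mulr_ge0 ?sqr_ge0//.
    by rewrite expr_le1 ?enorm_ge0// enorm_enormalize_le1.
have me : measurable_fun setT (fun x : V =>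
    ((p (enormalize x) - p (- enormalize x)) ^+ 2)%:E).
  exact: (measurableT_comp mpN (@measurable_enormalize R n)).
rewrite ge0_integralZl_EFin ?sqr_ge0//; last 2 first.
- by move=> x _; rewrite -EFinD lee_fin addr_ge0 ?sqr_ge0// mulr_ge0 ?sqr_ge0//.
- exact: emeasurable_funD.
rewrite ge0_integralD//; last 2 first.
- by move=> x _; rewrite lee_fin sqr_ge0.
- by move=> x _; rewrite lee_fin mulr_ge0 ?sqr_ge0//.
rewrite integral_probability_cst.
have lipp v w : `|p v - p w| <= delta * L * enorm (v - w).
  rewrite /p; apply: le_trans (lipf _ _) _.
  by rewrite opprD addrACA subrr add0r -scalerBr enormZ gtr0_norm// mulrCA mulrA.
have e := antipodal_energy_le n_gt0 mp (mulr_ge0 (ltW delta_gt0) L_ge0) lipp.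
apply: (@le_trans _ _ ((scale ^+ 2)%:E *
    ((80 * (delta * L) ^+ 2 / n%:R)%:E + (2 * sigma ^+ 2)%:E))%E).
  by rewrite lee_wpmul2l ?lee_fin ?sqr_ge0// leeD2r.
rewrite -EFinD -EFinM lee_fin /scale /second_moment_bound le_eqVlt.
apply/orP; left; apply/eqP; field.
by rewrite pnatr_eq0 -lt0n n_gt0 gt_eqF.
Qed.

(** The queries at v and - v contribute equally, because the law of the direction
    is symmetric. *)
Lemma estimator_mean y (i : 'I_n) :
  let k (v : V) :=
    scale * v ord0 i * (f (query_plus (y, v)) - f (query_minus (y, v))) in
  (unif_sphere R n).-integrable setT (EFin \o k) /\
  (\int[unif_sphere R n]_v (k v)%:E = (sphere_gradient f delta y ord0 i)%:E)%E.
Proof.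
move=> k; pose p v := f (y + delta *: v); pose q v := f (y + (- delta) *: v).
have kE v : k v = scale * (p v * v ord0 i - q v * v ord0 i).
  by rewrite /k /query_plus /query_minus /p /q /= scaleNr -mulrBl -mulrA [_ * (_ - _)]mulrC.
have bq eta : bounded_measurable
    (fun x => f (y + eta *: enormalize x) * enormalize x ord0 i).
  apply: bounded_measurableM; last exact: bounded_direction_entry.
  exact: (bounded_on_sphere mf L_ge0 lipf).
have bk : bounded_measurable (fun x => k (enormalize x)).
  under eq_fun do rewrite kE.
  by apply: bounded_measurableZ; apply: bounded_measurableB; exact: bq.
have mk : measurable_fun setT (EFin \o k).
  apply/measurable_EFinP; apply: eq_measurable_fun (fun v _ => esym (kE v)) _.
  apply: measurable_funM; first exact: measurable_cst.
  apply: measurable_funB; apply: measurable_funM; try exact: measurable_rV_coord.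
    exact: (measurable_affine_comp mf).
  exact: (measurable_affine_comp mf).
have ik : (unif_sphere R n).-integrable setT (EFin \o k).
  apply/integrableP; split => //.
  rewrite ge0_integral_unif_sphere//; last exact: measurableT_comp.
  by have /integrableP[_] := bounded_measurable_integrable U bk.
have symm : \int[U]_x (q (enormalize x) * enormalize x ord0 i) =
    - \int[U]_x (p (enormalize x) * enormalize x ord0 i).
  rewrite -(expectation_invariant_bounded (phi := fun x : V => - x) _ _ (bq (- delta))).
  - rewrite -[RHS]mulN1r -expectationZ_bounded; last exact: bq.
    congr (fine _); apply: eq_integral => x _; congr (_%:E).
    rewrite /enormalize enormN scalerN /p /q scalerN scaleNr opprK.
    by rewrite !mxE mulN1r mulrN.
  - exact: (measurable_rVN (@measurable_id _ V _)).
  - move=> A mA; apply: (@unif_ball_isometry _ _ _ (fun x => - x)) => //.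
    + exact: (measurable_rVN (@measurable_id _ V _)).
    + exact: opprK.
    + exact: opprD.
    + exact: enormN.
split=> //; rewrite integral_pushforward//; last first.
  exact: (bounded_measurable_integrable U bk).
transitivity (\int[U]_x k (enormalize x))%:E; first by rewrite EFin_expectation.
rewrite -[LHS]/((\int[U]_x k (enormalize x))%:E) /sphere_gradient mxE.
congr (_%:E).
under eq_Rintegral do rewrite kE.
rewrite expectationZ_bounded; last by apply: bounded_measurableB; exact: bq.
rewrite expectationB_bounded; [|exact: bq|exact: bq].
rewrite symm opprK -mulr2n -mulr_natr /scale; field.
by rewrite gt_eqF.
Qed.

End estimator.

(** * Conditional mean and second moment *)

(** The hypothesis is applied to the event that Z exceeds c. *)
Lemma condexp_ae_le {R : realType} d (Omega : measurableType d)
    (P : probability Omega R) (G : set (set Omega)) (X Z : Omega -> R) (c : R) :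
  sub_sigma_algebra_of G -> is_condexp P G X Z ->
  (forall A, G A -> (\int[P]_(w in A) (X w)%:E <= c%:E * P A)%E) ->
  {ae P, forall w, Z w <= c}.
Proof.
move=> subG [_ iZ GZ XZ] Xc.
pose I : set R := `]c, +oo[%classic; pose A := Z @^-1` I.
have GA : G A by apply: GZ; exists I; rewrite ?setTI//; exact: measurable_itv.
have mA : measurable A by case: subG => _; apply.
have AE w : A w -> c < Z w by rewrite /A /I /= in_itv/= andbT.
have iZA : P.-integrable A (EFin \o Z) by exact: integrableS iZ.
have icA : P.-integrable A (cst c%:E) by exact: finite_measure_integrable_cst.
have iD := integrableB mA iZA icA.
have D0 w : A w -> (0 <= (Z w)%:E - c%:E)%E.
  by move=> /AE cZ; rewrite -EFinB lee_fin subr_ge0 ltW.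
have I0 : (\int[P]_(w in A) ((Z w)%:E - c%:E) = 0)%E.
  apply/eqP; rewrite eq_le integral_ge0// andbT (integralB mA iZA icA).
  rewrite integral_cst// sube_le0 [X in (X <= _)%E]XZ//; exact: Xc.
have mD : measurable_fun A (fun w => (Z w)%:E - c%:E)%E by exact: (measurable_int P).
have /(ae_eq_integral_abs P mA mD) :
    (\int[P]_(w in A) `|((Z w)%:E - c%:E)| = 0)%E.
  by rewrite -[RHS]I0; apply: eq_integral => w; rewrite inE => Aw; rewrite gee0_abs// D0.
apply: filterS => w ZA; rewrite leNgt; apply/negP => cZ.
have Aw : A w by rewrite /A /I /= in_itv/= cZ.
by have /eqP := ZA Aw; rewrite -EFinB eqe subr_eq0 gt_eqF.
Qed.

Lemma measurable_sphere_gradient {R : realType} n (f : 'rV[R]_n -> R) delta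
    (i : 'I_n) : measurable_fun setT f ->
  measurable_fun setT (fun x => sphere_gradient f delta x ord0 i).
Proof.
move=> mf; under eq_fun do rewrite mxE.
apply: measurable_funM; first exact: measurable_cst.
apply: (measurable_Rintegral (unif_ball R n) (k := fun p : 'rV[R]_n * 'rV[R]_n =>
  f (p.1 + delta *: enormalize p.2) * enormalize p.2 ord0 i)).
have me : measurable_fun setT (fun p : 'rV[R]_n * 'rV[R]_n => enormalize p.2).
  exact: (measurableT_comp (@measurable_enormalize R n) measurable_snd).
apply: measurable_funM; last exact: measurable_entry.
apply: (measurableT_comp mf); apply: measurable_rVD; first exact: measurable_fst.
by apply: measurable_rVZ => //; exact: measurable_cst.
Qed.

Lemma lipschitz_constant_ge0 {R : realType} n (f : 'rV[R]_n -> R) L :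
  (0 < n)%N -> (forall x x', `|f x - f x'| <= L * enorm (x - x')) -> 0 <= L.
Proof.
move=> n0 lipf; pose e : 'rV[R]_n := delta_mx ord0 (Ordinal n0).
have e0 : 0 < enorm e.
  rewrite lt_def enorm_ge0 andbT enorm_eq0; apply/eqP => /rowP/(_ (Ordinal n0)).
  by rewrite !mxE !eqxx; apply/eqP; rewrite oner_eq0.
have := le_trans (normr_ge0 _) (lipf e 0).
by rewrite subr0 pmulr_lge0.
Qed.

Lemma second_moment_bound_le {R : realType} (n : nat) (L sigma delta : R) :
  second_moment_bound n L sigma delta <=
  n%:R ^+ 2 * sigma ^+ 2 / (2 * delta ^+ 2)
  + 16 * Num.sqrt (2 * pi) * n%:R * L ^+ 2.
Proof.
rewrite /second_moment_bound addrC lerD2l ler_wpM2r ?sqr_ge0// ler_wpM2r//.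
(* the square root is at least 2, and 20 <= 16 * 2 *)
have : Num.sqrt (2 ^+ 2) <= Num.sqrt (2 * pi) :> R.
  by apply: ler_wsqrtr; rewrite expr2 ler_wpM2l// pi_ge2.
rewrite sqrtr_sqr ger0_norm// => h.
by apply: (@le_trans _ _ (16 * 2)); [rewrite -natrM ler_nat|rewrite ler_wpM2l].
Qed.

Theorem lemma3p1 (R : realType) (d : nat) (d_gt0 : (0 < d)%N)
    (dS : measure_display) (S : measurableType dS)
    (Xi : R.-pker 'rV[R]_d ~> S)
    (F : 'rV[R]_d -> S -> R) (f : 'rV[R]_d -> R) (L sigma delta : R)
    (mF : measurable_fun [set: 'rV[R]_d * S] (fun p => F p.1 p.2))
    (intF : forall x, (Xi x).-integrable [set: S] (EFin \o F x))
    (meanF : forall x, (\int[Xi x]_s (F x s)%:E = (f x)%:E)%E)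
    (varF : forall x,
      (\int[Xi x]_s (`|F x s - f x| ^+ 2)%:E <= (sigma ^+ 2)%:E)%E)
    (lipf : forall x x', `|f x - f x'| <= L * enorm (x - x'))
    (delta_gt0 : 0 < delta)
    (dO : measure_display) (Omega : measurableType dO) (P : probability Omega R)
    (Ft : set (set Omega)) (y u : {RV P >-> 'rV[R]_d}) (xip xim : {RV P >-> S})
    (sFt : sub_sigma_algebra_of Ft)
    (my : measurable_wrt Ft y)
    (law_u : forall B, measurable B -> distribution P u B = unif_sphere R d B)
    (indep_u : independent_of P Ft u)
    (law_xip : has_cond_law P (sigma_join Ft u) xip
      (fun w => Xi (y w + delta *: u w)))
    (law_xim : has_cond_law P (sigma_join Ft u) xim
      (fun w => Xi (y w - delta *: u w)))
    (indep_xi : cond_independent P (sigma_join Ft u) xip xim) :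
  let g w := g2pt F delta (y w) (u w) (xip w) (xim w) in
  let fdelta := smoothing f delta in
  let C := d%:R ^+ 2 * sigma ^+ 2 / (2 * delta ^+ 2)
           + 16 * Num.sqrt (2 * pi) * d%:R * L ^+ 2 in
  [/\ forall x, differentiable fdelta x,
      is_condexp_rV P Ft g (fun w => grad fdelta (y w)),
      exists Z, is_condexp P Ft (fun w => enorm (g w) ^+ 2) Z
    & forall Z, is_condexp P Ft (fun w => enorm (g w) ^+ 2) Z ->
        {ae P, forall w, Z w <= C}].
Proof.
move=> g fdelta C.
have mu : measurable_fun setT u by [].
have L0 := lipschitz_constant_ge0 d_gt0 lipf.
have mf := measurable_kernel_mean mF meanF.
pose est := estimator F delta; pose SK := sample_kernel Xi delta.
(* The samples are integrated out given the past and the direction, and then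
   the direction given the past. *)
pose G := sigma_join Ft u.
have sG : sub_sigma_algebra_of G by exact: sub_sigma_algebra_join.
have FtG : Ft `<=` G by exact: sub_sigma_join.
pose Y w := (y w, u w); pose X w := (xip w, xim w).
have mX : measurable_fun setT X by exact/measurable_fun_pairP.
have GY : measurable_wrt G Y.
  apply: measurable_wrt_pair => //; last exact: measurable_wrt_join.
  exact: subset_trans my FtG.
have lawX : conditional_law P G Y X SK by exact: conditional_law_pair.
have lawu : conditional_law P Ft y u
  (@constant_law R _ _ ('rV[R]_d) _ (unif_sphere R d)).
  exact: conditional_law_independent.
have mest : measurable_fun setT est by exact: measurable_estimator.
pose sq p : \bar R := (enorm (est p) ^+ 2)%:E.
have msq : measurable_fun setT sq.
  apply/measurable_EFinP; apply: measurable_funX.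
  exact: (measurableT_comp (@measurable_enorm R d) mest).
have sq0 p : (0 <= sq p)%E by rewrite lee_fin sqr_ge0.
pose m1 p := (\int[SK p]_s sq (p, s))%E.
have m1_ge0 p : (0 <= m1 p)%E by exact: integral_ge0.
have mm1 : measurable_fun setT m1 by exact: measurable_kernel_integral.
pose m2 x := (\int[unif_sphere R d]_v m1 (x, v))%E.
have m2_ge0 x : (0 <= m2 x)%E by exact: integral_ge0.
have mm2 : measurable_fun setT m2.
  exact: (measurable_kernel_integral
    (@constant_law R _ _ ('rV[R]_d) _ (unif_sphere R d)) mm1).
have tower A : Ft A ->
    (\int[P]_(w in A) (enorm (g w) ^+ 2)%:E = \int[P]_(w in A) m2 (y w))%E.
  move=> FA.
  rewrite (ge0_conditional_integral sG GY mX lawX (FtG _ FA) msq sq0).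
  exact: (ge0_conditional_integral sFt my _ lawu FA mm1 m1_ge0).
have m2_le x : (m2 x <= (second_moment_bound d L sigma delta)%:E)%E.
  exact: estimator_second_moment.
set c2 := second_moment_bound d L sigma delta in m2_le.
pose Z w := fine (m2 (y w)).
have ZE w : (Z w)%:E = m2 (y w).
  by rewrite fineK// ge0_fin_numE// (le_lt_trans (m2_le _))// ltry.
have Z0 w : 0 <= Z w by exact: fine_ge0.
have Z_le w : Z w <= c2 by rewrite -lee_fin ZE.
have mZ : measurable_wrt Ft Z.
  exact: (measurable_wrt_comp (h := fine \o m2)
    (measurableT_comp (fine_measurable measurableT) mm2) my).
have iZ : P.-integrable setT (EFin \o Z).
  apply: bounded_measurable_integrable; split; first exact: measurable_wrt_fun mZ.
  by exists c2 => w; rewrite ger0_norm.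
have FtT : Ft setT by case: sFt => -[F0 FC _] _; rewrite -(setD0 setT); exact: FC.
have mYX : measurable_fun setT (fun w => (Y w, X w)).
  apply/measurable_fun_pairP; split => //; exact: measurable_wrt_fun GY.
have mg : measurable_fun setT g by exact: (measurableT_comp mest mYX).
have mgsq : measurable_fun setT (fun w => enorm (g w) ^+ 2).
  by apply: measurable_funX; exact: (measurableT_comp (@measurable_enorm R d)).
have igsq : P.-integrable setT (EFin \o (fun w => enorm (g w) ^+ 2)).
  apply/integrableP; split; first exact/measurable_EFinP.
  under eq_integral do rewrite gee0_abs ?lee_fin ?sqr_ge0//.
  rewrite (tower _ FtT); have /integrableP[_] := iZ; congr (_ < _)%E.
  by apply: eq_integral => w _; rewrite /= -ZE ger0_norm.
have smooth x := smoothing_differentiable d_gt0 mf L0 lipf x delta_gt0.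
split.
- by move=> x; have [] := smooth x.
- move=> i.
  have gradE w : grad fdelta (y w) ord0 i = sphere_gradient f delta (y w) ord0 i.
    by have [_ ->] := smooth (y w).
  have -> : (fun w => grad fdelta (y w) ord0 i) =
      (fun x => sphere_gradient f delta x ord0 i) \o y.
    by apply/funext => w; rewrite gradE.
  have mgrad := measurable_sphere_gradient delta i mf.
  (* the first moment is finite since the second one is: t <= 1 + t ^ 2 *)
  have ig : P.-integrable setT (EFin \o (fun w => g w ord0 i)).
    have ic : P.-integrable setT (cst 1%:E) by exact: finite_measure_integrable_cst.
    apply: le_integrable (integrableD measurableT ic igsq) => //.
      by apply/measurable_EFinP; exact: measurable_entry.
    move=> w _; rewrite /= lee_fin [leRHS]ger0_norm ?addr_ge0 ?sqr_ge0//.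
    have := ler_entry_enorm (g w) i; have := enorm_ge0 (g w).
    by move: (enorm (g w)) `|_| => a b; clear; nra.
  split => //.
  + apply: bounded_measurable_integrable; split.
      by apply: (measurableT_comp mgrad); exact: measurable_wrt_fun my.
    exists L => w; apply: le_trans (ler_entry_enorm (sphere_gradient f delta (y w)) i) _.
    exact: (sphere_gradient_le d_gt0 mf L0 lipf (y w) delta_gt0).
  + exact: measurable_wrt_comp mgrad my.
  + move=> A FA.
    have mA : measurable A by case: sFt => _; apply.
    pose k1 p := est p ord0 i.
    have [i1 e1] := conditional_integral (k := k1) sG GY mX lawX (FtG _ FA)
      (measurable_entry i mest)
      (fun p => (sample_kernel_mean delta intF meanF p i).1)
      (integrableS measurableT mA (@subsetT _ _) ig).
    pose k2 (p : 'rV[R]_d * 'rV[R]_d) :=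
      d%:R / (2 * delta) * p.2 ord0 i * (f (query_plus delta p) - f (query_minus delta p)).
    have k12 p : (\int[SK p]_s (k1 (p, s))%:E = (k2 p)%:E)%E.
      exact: (sample_kernel_mean delta intF meanF p i).2.
    have mk2 : measurable_fun setT k2.
      apply: measurable_funM.
        apply: measurable_funM; first exact: measurable_cst.
        by apply: measurable_entry; exact: measurable_snd.
      apply: measurable_funB.
        exact: (measurableT_comp mf (measurable_query_plus _)).
      exact: (measurableT_comp mf (measurable_query_minus _)).
    have [||_ e2] := conditional_integral (k := k2) sFt my mu lawu FA mk2.
    * move=> x; exact: (estimator_mean mF meanF L0 lipf delta_gt0 x i).1.
    * by move: i1; under eq_fun do rewrite k12.
    rewrite e1; under [RHS]eq_integral do rewrite k12.
    rewrite e2; apply: eq_integral => w _ /=.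
    by rewrite (estimator_mean mF meanF L0 lipf delta_gt0 (y w) i).2.
- exists Z; split => // A FA.
  by rewrite tower//; apply: eq_integral => w _; rewrite ZE.
(* the bound holds for one version of the conditional expectation, hence for the
   integrals over events of the past, hence for every version *)
- move=> Z' condZ'.
  apply: filterS (condexp_ae_le (c := c2) sFt condZ' _) => [w|A FA].
    by move=> /le_trans; apply; exact: second_moment_bound_le.
  have mA : measurable A by case: sFt => _; apply.
  rewrite (tower _ FA) -(integral_cst P mA).
  apply: ge0_le_integral; first exact: mA.
  + by move=> w _; exact: m2_ge0.
  + apply: measurable_funTS; apply: (measurableT_comp mm2).
    exact: measurable_wrt_fun my.
  + exact: measurable_cst.
  + by move=> w _; exact: m2_le.
Qed.
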